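(* Let $t \ge 1$ be an integer and let $G$ be a $400t^5$-edge-connected graph which does not contain $K_t$ as a strong immersion. Then there exist sets $A \subseteq V(G)$ and $Z \subseteq E(G)$ such that (1) $|A| \le 4t^2$ and $|Z| \le 6t^{10}$, and (2) $(G-Z)-A$ has at most $2t^2$ components, and moreover every component $J$ of $(G-Z)-A$, with $n$ vertices, has a linear order $v_1,\dots,v_n$ of its vertices such that (3) the only vertices of $J$ having a neighbor in $A$ in the graph $G-Z$ are $v_1$ and $v_n$, and (4) the linear order $v_1,\dots,v_n$ has hop-width at most $2t^6$ in $J$.
   Context: Graphs may have parallel edges but no loops. A graph $G$ contains $H$ as a strong immersion if there is an injective map $\pi$ from $V(H)$ to $V(G)$ and, for each edge $f=xy$ of $H$, a path $\pi(f)$ in $G$ with endpoints $\pi(x),\pi(y)$, such that these paths are pairwise edge-disjoint and no vertex $\pi(w)$, $w\in V(H)$, is an internal vertex of any path $\pi(f)$. $K_t$ is the complete graph on $t$ vertices. For a graph $J$ and a linear order $v_1,\dots,v_n$ of $V(J)$, let $T_i$ (for $2\le i\le n-1$) be the set of edges of $J$ with one end in $\{v_1,\dots,v_{i-1}\}$ and the other in $\{v_{i+1},\dots,v_n\}$; the hop-width of the order is $\max_{2\le i\le n-1}|T_i|$ (taken to be $0$ if $n\le 2$). $G-Z$ denotes $(V(G),E(G)\setminus Z)$ and $-A$ denotes deletion of the vertices in $A$. *)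

(* Defs.v *)
From mathcomp Require Import all_boot.

Set Implicit Arguments.
Unset Strict Implicit.
Unset Printing Implicit Defensive.

(* Finite loopless graphs with parallel edges.  Vertices and edges are finite
   subsets of ambient types, so that a graph and its subgraphs have the same
   type; [ends] is only meaningful on [edges]. *)
Record mgraph (V E : finType) := MGraph {
  verts : {set V};
  edges : {set E};
  ends : E -> {set V};
  ends_verts : forall e, e \in edges -> ends e \subset verts;
  ends_card : forall e, e \in edges -> #|ends e| = 2 }.

Section Graphs.
Variables V E : finType.
Implicit Types (G J : mgraph V E) (A X : {set V}) (Z : {set E}).

Definition adj G : rel V :=
  fun x y => [exists e in edges G, ends G e == [set x; y]].

Fact del_edges_verts G Z e :
  e \in edges G :\: Z -> ends G e \subset verts G.
Proof. by case/setDP=> eG _; apply: ends_verts. Qed.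

Fact del_edges_card G Z e : e \in edges G :\: Z -> #|ends G e| = 2.
Proof. by case/setDP=> eG _; apply: ends_card. Qed.

Definition del_edges G Z : mgraph V E :=
  MGraph (@del_edges_verts G Z) (@del_edges_card G Z).

Fact induced_verts G X e :
  e \in [set e in edges G | ends G e \subset X] ->
  ends G e \subset verts G :&: X.
Proof. by rewrite inE subsetI => /andP[/ends_verts-> ->]. Qed.

Fact induced_card G X e :
  e \in [set e in edges G | ends G e \subset X] -> #|ends G e| = 2.
Proof. by rewrite inE => /andP[/ends_card]. Qed.

Definition induced G X : mgraph V E :=
  MGraph (@induced_verts G X) (@induced_card G X).

Definition del_verts G A : mgraph V E := induced G (~: A).

(* The vertex sets of the components; the component itself is the subgraph
   induced on such a set. *)
Definition components G : {set {set V}} :=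
  equivalence_partition (connect (adj G)) (verts G).

(* Graphs with at most one vertex count as connected, hence also as
   k-edge-connected for every k. *)
Definition connected G : Prop :=
  {in verts G &, forall x y, connect (adj G) x y}.

Definition edge_connected (k : nat) G : Prop :=
  forall Z, Z \subset edges G -> #|Z| < k -> connected (del_edges G Z).

(* A walk is a starting vertex together with the list of its steps (traversed
   edge, vertex reached). *)
Definition walk : Type := (V * seq (E * V))%type.

Definition source (p : walk) : V := p.1.
Definition target (p : walk) : V := last p.1 (unzip2 p.2).
Definition walk_verts (p : walk) : seq V := p.1 :: unzip2 p.2.
Definition walk_edges (p : walk) : seq E := unzip1 p.2.

Fixpoint steps G (x : V) (s : seq (E * V)) : bool :=
  if s is (e, y) :: s' then
    [&& e \in edges G, ends G e == [set x; y] & steps G y s']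
  else true.

Definition is_path G (p : walk) : bool :=
  [&& source p \in verts G, steps G p.1 p.2 & uniq (walk_verts p)].

Definition internal (p : walk) (v : V) : bool :=
  [&& v \in walk_verts p, v != source p & v != target p].

(* With 1-based positions, [take i.-1 s] lists v_1, ..., v_(i-1) and
   [drop i s] lists v_(i+1), ..., v_n. *)
Definition hop_edges J (s : seq V) (i : nat) : {set E} :=
  [set e in edges J | [exists x, exists y,
     [&& ends J e == [set x; y], x \in take i.-1 s & y \in drop i s]]].

Definition hop_width J (s : seq V) : nat :=
  \max_(2 <= i < size s) #|hop_edges J s i|.

Definition linear_order J (s : seq V) : Prop := uniq s /\ s =i verts J.

End Graphs.

Definition strong_immersion (VH EH VG EG : finType)
    (H : mgraph VH EH) (G : mgraph VG EG) : Prop :=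
  exists (pi : VH -> VG) (P : EH -> walk VG EG),
    [/\ {in verts H, forall w, pi w \in verts G},
        {in verts H &, injective pi},
        {in edges H, forall f, is_path G (P f) /\
           [set source (P f); target (P f)] = pi @: ends H f},
        {in edges H &, forall f g, f != g ->
           forall e, e \in walk_edges (P f) -> e \notin walk_edges (P g)}
      & {in edges H & verts H, forall f w, ~~ internal (P f) (pi w)}].

Fact complete_verts t (e : {set 'I_t}) :
  e \in [set e : {set 'I_t} | #|e| == 2] -> e \subset [set: 'I_t].
Proof. by move=> _; apply: subsetT. Qed.

Fact complete_card t (e : {set 'I_t}) :
  e \in [set e : {set 'I_t} | #|e| == 2] -> #|e| = 2.
Proof. by rewrite inE => /eqP. Qed.

Definition complete (t : nat) : mgraph 'I_t {set 'I_t} :=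
  MGraph (ends := id) (@complete_verts t) (@complete_card t).

(* Main.v *)
(* Write q = t^2.  A vertex set is q-connected if it induces a subgraph all of
   whose cuts have at least q edges; a hub for W is a q-connected set H disjoint
   from W that receives at least q edges from every w in W.  If |W| >= t, a
   max-flow argument routes t - 1 paths from each w to a common vertex of H,
   which yields a strong immersion of K_t.  Hence every hub has fewer than t
   free vertices W.

   Call two vertices thick neighbours if they are joined by at least q edges.
   Every component C of the thick graph is spanned by a hub together with its
   free vertices; let lam C be the largest number of free vertices.  Up to
   O(lam C) vertices, C consists of O(lam C) thick paths, by growing a spanning
   tree with many leaves.  Two disjoint hubs joined by q(t+1)^2 edges can be
   merged at the expense of at most one free vertex, and a partition of G into
   hubs without such pairs has a dense quotient, in which Mader's argument finds
   a hub for t parts.  So all components merge into one hub, and the sum of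
   lam C - 1 is less than t.

   A vertex sending many thin edges to a thick path, or two thick paths joined
   by many thin edges, give t free vertices on the path.  Cutting every path,
   from its beginning, at vertices jumped by many edges again produces free
   vertices, so that there are at most lam C cuts in C.  The branching and the
   cut vertices form A; the thin edges between A and the paths and all edges
   between different paths form Z. *)
Require Import Defs.
From mathcomp Require Import all_boot.
From mathcomp Require Import zify.

Set Implicit Arguments.
Unset Strict Implicit.
Unset Printing Implicit Defensive.

(** * Arc-disjoint walks to a sink *)

(** The value q = t^2 exceeds t(t - 1), the number of walks that all branch vertices together send
    into the hub, so a cut that splits the hub never obstructs the flow. Mader's argument works in
    the quotient by the current parts, where a branch vertex is a whole part. This is why [has_hub]
    takes disjoint q-connected sets instead of free vertices and asks each of them for only t edges
    to the hub.

    The obstacle is to bound the deletions in terms of t although the number of thick components is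
    a priori unbounded: each component alone only gives lam C < t. Merging turns this into one
    budget. A merge may spend one free vertex as a connector, so a component is credited with lam C
    - 1, which is useful because lam C is at least 2 once C has three vertices. Smaller components
    have no such surplus. They are deleted whole and get credit 1, since joining one to a larger hub
    makes one of its vertices free. The numbers of deleted vertices and of segments are bounded by
    constant multiples of the total credit, which is at most t - 2. *)

Section Flow.
Variable V : finType.
Implicit Types (S I : {set V}) (D rest : seq (V * V)) (bs : seq V) (h x z : V).

Definition leaves S : pred (V * V) := fun a => (a.1 \in S) && (a.2 \notin S).

Fixpoint dwalk h x (l : seq (V * V)) : bool :=
  if l is a :: l' then (a.1 == x) && dwalk h a.2 l' else x == h.

Lemma dwalk_cat h x l1 a l2 :
  dwalk h x (l1 ++ a :: l2) =
  dwalk a.1 x l1 && dwalk h a.2 l2.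
Proof.
elim: l1 x => [|b l1 IH] x /=; first by rewrite eq_sym.
by rewrite IH andbA.
Qed.

(** Arc-disjointness is a permutation of lists: parallel arcs are repeated entries of [D], and [bs]
    lists the starting points with multiplicity. [rest] collects the arcs that no walk uses. *)
Definition linked h D bs : Prop :=
  exists (ps : seq (V * seq (V * V))) rest,
    [/\ perm_eq [seq p.1 | p <- ps] bs, all (fun p => dwalk h p.1 p.2) ps
      & perm_eq (flatten [seq p.2 | p <- ps] ++ rest) D].

Definition cut_cond h D bs : Prop :=
  forall S, h \notin S -> count (mem S) bs <= count (leaves S) D.

Lemma count_rem (T : eqType) (p : pred T) a (s : seq T) :
  a \in s -> count p s = p a + count p (rem a s).
Proof. by move=> aD; rewrite (permP (perm_to_rem aD) p). Qed.

Lemma sub_in_count (T : eqType) (p1 p2 : pred T) (s : seq T) :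
  (forall y : T, y \in s -> p1 y -> p2 y) -> count p1 s <= count p2 s.
Proof.
move=> sub; rewrite -(@eq_in_count _ (predI p1 p2) p1 s).
  by apply: sub_count => x /andP[].
by move=> x xs /=; case E: (p1 x) => //=; rewrite sub.
Qed.

Lemma count_rem_arc (p : pred (V * V)) a D :
  a \in D -> count p D = p a + count p (rem a D).
Proof. exact: count_rem. Qed.

Lemma arc_permP (s1 s2 : seq (V * V)) :
  (forall p : pred (V * V), count p s1 = count p s2) <-> perm_eq s1 s2.
Proof. by split=> [H|/permP//]; apply/permP. Qed.

Lemma linked_rem h D bs a : a \in D -> linked h (rem a D) bs -> linked h D bs.
Proof.
move=> aD [ps [rest [p1 p2 /arc_permP p3]]]; exists ps, (a :: rest); split=> //.
apply/arc_permP=> p; rewrite (count_rem_arc p aD) -p3 !count_cat /=; lia.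
Qed.

Lemma count_setUI S I bs :
  count (mem (S :|: I)) bs + count (mem (S :&: I)) bs =
  count (mem S) bs + count (mem I) bs.
Proof.
elim: bs => //= b bs IH; rewrite !inE.
by case: (b \in S); case: (b \in I) => /=; lia.
Qed.

Lemma leaves_setUI S I D :
  count (leaves (S :|: I)) D + count (leaves (S :&: I)) D <=
  count (leaves S) D + count (leaves I) D.
Proof.
elim: D => //= -[x y] D IH; rewrite /leaves /= !inE -!/(leaves _).
by case: (x \in S); case: (x \in I); case: (y \in S); case: (y \in I) => /=; lia.
Qed.

(** Demand is modular and out-degree is submodular, so the slacks of the union and of the
    intersection sum to at most 0. *)
Lemma tight_setUI h D bs S I : cut_cond h D bs -> h \notin S -> h \notin I ->
  count (leaves S) D = count (mem S) bs ->
  count (leaves I) D = count (mem I) bs ->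
  count (leaves (S :|: I)) D = count (mem (S :|: I)) bs /\
  count (leaves (S :&: I)) D = count (mem (S :&: I)) bs.
Proof.
move=> cc hS hI tS tI.
have h1 := cc (S :|: I); have h2 := cc (S :&: I).
rewrite !inE (negPf hS) (negPf hI) /= in h1 h2.
have := h1 isT; have := h2 isT.
have := leaves_setUI S I D; have := count_setUI S I bs; lia.
Qed.

Lemma linked_push h D bs x : (x, h) \in D -> x \in bs ->
  linked h (rem (x, h) D) (rem x bs) -> linked h D bs.
Proof.
move=> aD xb [ps [rest [p1 p2 /arc_permP p3]]].
exists ((x, [:: (x, h)]) :: ps), rest; split.
- by rewrite /= perm_sym (perm_trans (perm_to_rem xb)) // perm_cons perm_sym.
- by rewrite /= !eqxx.
- apply/arc_permP=> p; rewrite (count_rem_arc p aD) -p3 /=; lia.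
Qed.

(** A walk that uses the new arc zh takes the detour z, x, h instead; if no walk uses it, both old
    arcs return to [rest]. *)
Lemma linked_lift h D bs z x : (x, h) \in D -> (z, x) \in D -> x != h ->
  linked h ((z, h) :: rem (x, h) (rem (z, x) D)) bs -> linked h D bs.
Proof.
move=> aD bD xh [ps [rest [p1 p2 /arc_permP p3]]].
have aD' : (x, h) \in rem (z, x) D.
  have := permP (perm_to_rem bD) (pred1 (x, h)); rewrite /= xpair_eqE (negPf xh) andbF add0n.
  by move=> E; rewrite -has_pred1 has_count -E -has_count has_pred1.
have E p : count p (flatten [seq i.2 | i <- ps] ++ rest) + p (x, h) + p (z, x)
    = p (z, h) + count p D.
  rewrite p3 /= (count_rem_arc p bD) (count_rem_arc p aD'); move: (nat_of_bool (p (x, h))) (nat_of_bool (p (z, x))) (nat_of_bool (p (z, h))) => a b c; lia.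
have [zr | zr] := boolP ((z, h) \in rest).
  exists ps, ((x, h) :: (z, x) :: rem (z, h) rest); split=> //.
  apply/arc_permP=> p; have := E p; rewrite !count_cat /= (count_rem_arc p zr); move: (nat_of_bool (p (x, h))) (nat_of_bool (p (z, x))) (nat_of_bool (p (z, h))) => a b c; lia.
have: (z, h) \in flatten [seq i.2 | i <- ps] ++ rest.
  by rewrite (perm_mem (iffLR (arc_permP _ _) p3)) mem_head.
rewrite mem_cat (negPf zr) orbF => /flattenP[l /mapP[[v l'] vps /= ->]] zl.
case/path.splitPr: vps p1 p2 p3 E => ps1 ps2 p1 p2 p3 E.
case/path.splitPr: zl p1 p2 p3 E => l1 l2 p1 p2 p3 E.
exists (ps1 ++ (v, l1 ++ (z, x) :: (x, h) :: l2) :: ps2), rest; split=> //.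
- by move: p1; rewrite !map_cat.
- move: p2; rewrite !all_cat /= !dwalk_cat /= eqxx; case/and3P=> -> /=.
  by case/andP=> -> -> ->.
- apply/arc_permP=> p; have := E p; rewrite !map_cat /= !flatten_cat /= !count_cat /=; move: (nat_of_bool (p (x, h))) (nat_of_bool (p (z, x))) (nat_of_bool (p (z, h))) => a b c; lia.
Qed.

(* Induction on the number of arcs.  If no arc can be deleted, every arc leaves
   a tight set; then all arcs leaving the largest tight set M end in the sink
   h.  For such an arc xh, either a walk starts at x and can be sent along it,
   or some arc zx starts inside the smallest tight set containing x, and the
   arcs zx, xh can be lifted to the single arc zh. *)
Lemma flow_linked h D bs : h \notin bs -> cut_cond h D bs -> linked h D bs.
Proof.
elim: {D}(size D) {-2}D (leqnn (size D)) bs => [|n IH] D sD bs hb cc.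
  have D0 : D = [::] by apply: size0nil; apply/eqP; rewrite -leqn0.
  exists [::], [::]; rewrite D0; split=> //.
  case: bs hb cc => // b bs; rewrite inE negb_or => /andP[hb _] /(_ [set b]).
  by rewrite inE hb => /(_ isT); rewrite D0 /= inE eqxx.
case: (boolP (has (fun a => [forall S : {set V}, (h \notin S) ==>
    (count (mem S) bs <= count (leaves S) (rem a D))]) D)).
  case/hasP=> a aD /forallP ha; apply: (linked_rem aD); apply: IH => //.
    by rewrite size_rem //; case: (size D) sD.
  by move=> S hS; have /implyP := ha S; apply.
move/hasPn=> nd.
pose tight S := (h \notin S) && (count (leaves S) D == count (mem S) bs).
have tP S I : tight S -> tight I -> tight (S :|: I) /\ tight (S :&: I).
  move=> /andP[hS /eqP tS] /andP[hI /eqP tI].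
  have [t1 t2] := tight_setUI cc hS hI tS tI.
  by rewrite /tight !inE (negPf hS) (negPf hI) /= t1 t2 !eqxx.
have arcP a : a \in D -> exists S, tight S && leaves S a.
  move=> aD; have := nd a aD; rewrite negb_forall => /existsP[S].
  rewrite negb_imply -ltnNge => /andP[hS lt]; exists S.
  have := cc S hS; have := count_rem_arc (leaves S) aD; rewrite /tight hS /=.
  by case: (leaves S a) => /=; move: lt; lia.
have t0 : tight set0.
  rewrite /tight inE /= (eq_count (a2 := pred0)) ?count_pred0; last by move=> a; rewrite /leaves inE.
  by rewrite (eq_count (a2 := pred0)) ?count_pred0 // => a; rewrite /= inE.
have [M tM maxM] := arg_maxnP (fun S : {set V} => #|S|) t0.
have subM S : tight S -> S \subset M.
  move=> tS; have [tU _] := tP _ _ tM tS.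
  have /eqP <- : M :|: S == M by rewrite eq_sym eqEcard subsetUl; apply: maxM.
  exact: subsetUr.
have tlM a : a \in D -> a.1 \in M.
  by case/arcP=> S /andP[/subM/subsetP sM /andP[/sM]].
have /andP[hM /eqP eM] := tM.
have grow y : y != h -> y \notin M ->
    count (leaves M) D <= count (leaves (y |: M)) D.
  move=> yh yM; rewrite eM; apply: (leq_trans _ (cc (y |: M) _)).
    by apply: sub_count => b; rewrite /= inE => ->; rewrite orbT.
  by rewrite !inE negb_or eq_sym yh.
(* All tails lie in [M], so a larger set only loses leaving arcs. Against [grow] this excludes
   leaving arcs with a head other than h. *)
have growle y : count (leaves (y |: M)) D <= count (leaves M) D.
  elim: D tlM {sD cc nd tP arcP t0 tM maxM subM eM grow IH tight} => //= a D IH tlM.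
  apply: leq_add; last by apply: IH => b bD; apply: tlM; rewrite inE bD orbT.
  have aM := tlM a (mem_head _ _).
  rewrite /leaves !inE aM orbT /= negb_or; by case: (a.2 \in M); rewrite /= ?andbF ?andbT //; case: (_ != _).
have hdM a : a \in D -> a.2 \notin M -> a.2 = h.
  move=> aD aM; apply/eqP; apply: contraT => ah.
  suff: count (leaves (a.2 |: M)) D < count (leaves M) D by rewrite ltnNge grow.
  have sub : {in rem a D, forall b, leaves (a.2 |: M) b -> leaves M b}.
    move=> b bD; rewrite /leaves (tlM b (mem_rem bD)) !inE negb_or.
    by case/and3P.
  rewrite !(count_rem_arc _ aD) /leaves !inE eqxx andbF (tlM a aD) aM /= -!/(leaves _) !add0n add1n ltnS.
  by apply: sub_in_count => b bD; apply: sub.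
have bsM v : v \in bs -> v \in M.
  move=> vb; apply: contraT => vM.
  have vh : v != h by apply: contraNneq hb => <-.
  have := cc (v |: M); rewrite !inE negb_or eq_sym vh hM => /(_ isT).
  have := growle v; rewrite eM.
  have -> : count (mem (v |: M)) bs = count (pred1 v) bs + count (mem M) bs.
    rewrite -(count_predUI (pred1 v) (mem M)) (eq_count (a1 := predI _ _) (a2 := pred0)).
      by rewrite count_pred0 addn0; apply: eq_count => b; rewrite /= !inE.
    by move=> b /=; case: eqP => //= ->; rewrite (negPf vM).
  have : 0 < count (pred1 v) bs by rewrite -has_count has_pred1.
  lia.
have [bs0|[v vb]] : bs = [::] \/ exists v, v \in bs.
- by case: (bs) => [|v bs']; [left | right; exists v; rewrite mem_head].
- by rewrite bs0; exists [::], D; split.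
have : 0 < count (leaves M) D by rewrite eM -has_count; apply/hasP; exists v => //=; apply: bsM.
rewrite -has_count => /hasP[[x y] aD /andP[/= xM yM]].
have yh : y = h by apply: (hdM (x, y)).
rewrite {y}yh in aD yM.
have xh : x != h by apply: contraNneq hM => <-.
have [xb | xb] := boolP (x \in bs).
  apply: (linked_push aD xb); apply: IH.
  - by rewrite size_rem //; case: (size D) sD.
  - by apply: contra hb; apply: mem_rem.
  - move=> S hS; have := cc S hS; rewrite (count_rem_arc _ aD) (count_rem _ xb).
    rewrite {1}/leaves /= hS andbT; clear; lia.
have txM : predI tight (fun S : {set V} => x \in S) M by rewrite /= tM.
have [I /andP[tI xI] minI] := arg_minnP (fun S : {set V} => #|S|) txM.
have subI S : tight S -> x \in S -> I \subset S.
  move=> tS xS; have [_ tC] := tP _ _ tS tI.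
  have /eqP <- : S :&: I == I by rewrite eqEcard subsetIr; apply: minI; rewrite /= tC inE xS xI.
  exact: subsetIl.
have [z zI zD] : exists2 z, z \in I & (z, x) \in D.
  have [/hasP[[z y] zD /andP[/= zI /eqP yx]]|/hasPn no] :=
    boolP (has (fun a => (a.1 \in I) && (a.2 == x)) D).
    by exists z; rewrite -?yx.
  have /andP[hI /eqP eI] := tI.
  have := cc (I :\ x); rewrite !inE (negPf hI) andbF => /(_ isT).
  have -> : count (mem (I :\ x)) bs = count (mem I) bs.
    apply: eq_in_count => b bb; rewrite /= !inE.
    by have [bx|] := eqVneq b x; first by rewrite bx (negPf xb) in bb.
  rewrite -eI !(count_rem_arc _ aD) {1 3}/leaves /= !inE eqxx xI /= hI.
  rewrite add0n add1n ltnNge => /negP[]; apply: sub_in_count => b bD.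
  have := no b (mem_rem bD); rewrite /leaves !inE.
  by case: (b.1 \in I) => //=; rewrite ?andbF ?andbT // => -> /= /andP[].
have aD' : (x, h) \in rem (z, x) D.
  have := permP (perm_to_rem zD) (pred1 (x, h)).
  rewrite /= xpair_eqE (negPf xh) andbF add0n.
  by move=> E; rewrite -has_pred1 has_count -E -has_count has_pred1.
apply: (linked_lift aD zD xh); apply: IH => //.
  have := perm_size (perm_to_rem zD); have := perm_size (perm_to_rem aD').
  by move: sD; clear; rewrite /=; lia.
move=> S hS.
have := cc S hS; have := subI S; rewrite /tight hS.
rewrite !(count_rem_arc _ zD) !(count_rem_arc _ aD') /= {1 2 4 5 7}/leaves /= hS.
move: (count _ bs) (count _ _) => b d /=.
case: (boolP (z \in S)) => zS; case: (boolP (x \in S)) => xS //= sI le; try by move: le; clear; lia.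
(* A set with x but not z loses one leaving arc by the lift. It has slack: were it tight, it would
   contain [I] and hence z. *)
have bd : (d.+1 == b) = false.
  apply/negP=> E; have := sI; rewrite add0n add1n E => /(_ isT isT)/subsetP/(_ z zI).
  by rewrite (negPf zS).
by move: bd le; clear; lia.
Qed.

End Flow.

(** * Cuts and hubs *)

Section Cuts.
Variables (V : finType) (m : V -> V -> nat).
Implicit Types (S X Y : {set V}) (x y : V) (q : nat).

Definition cut X Y : nat := \sum_(x in X) \sum_(y in Y) m x y.

Lemma leq_sum_sub (A B : {pred V}) (F : V -> nat) :
  {subset A <= B} -> \sum_(x in A) F x <= \sum_(x in B) F x.
Proof.
move=> sAB; rewrite [X in _ <= X](bigID (mem A)) /=.
apply: leq_trans (leq_addr _ _); rewrite eq_leq //; apply: eq_bigl => x.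
by rewrite andbC; case: (boolP (x \in A)) => // /sAB ->.
Qed.

Lemma cutS X X' Y Y' : X \subset X' -> Y \subset Y' -> cut X Y <= cut X' Y'.
Proof.
move=> /subsetP sX /subsetP sY; apply: (leq_trans (leq_sum_sub _ sX)).
by apply: leq_sum => x _; apply: leq_sum_sub.
Qed.

Lemma cut_setUl X X' Y : [disjoint X & X'] ->
  cut (X :|: X') Y = cut X Y + cut X' Y.
Proof.
by move=> d; rewrite /cut -bigU //; apply: eq_bigl => x; rewrite inE.
Qed.

Lemma cut_setUr X Y Y' : [disjoint Y & Y'] ->
  cut X (Y :|: Y') = cut X Y + cut X Y'.
Proof.
move=> d; rewrite /cut -big_split /=; apply: eq_bigr => x _.
by rewrite -bigU //; apply: eq_bigl => y; rewrite inE.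
Qed.

Lemma cut1l x Y : cut [set x] Y = \sum_(y in Y) m x y.
Proof. by rewrite /cut big_set1. Qed.

Lemma cut11 x y : cut [set x] [set y] = m x y.
Proof. by rewrite cut1l big_set1. Qed.

Lemma cut_sum1 X Y : cut X Y = \sum_(x in X) cut [set x] Y.
Proof. by apply: eq_bigr => x _; rewrite cut1l. Qed.

Lemma leq_m_cut x y X Y : x \in X -> y \in Y -> m x y <= cut X Y.
Proof. by move=> xX yY; rewrite -cut11 cutS ?sub1set. Qed.

Lemma cut0l Y : cut set0 Y = 0. Proof. by rewrite /cut big_set0. Qed.

Lemma cut0r X : cut X set0 = 0.
Proof. by rewrite /cut big1 // => x _; rewrite big_set0. Qed.

Lemma cut_leq_card X Y b : {in X, forall x, cut [set x] Y <= b} -> cut X Y <= #|X| * b.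
Proof. by move=> h; rewrite cut_sum1 -sum_nat_const; apply: leq_sum. Qed.

Definition qconn q X : bool :=
  [forall S : {set V}, [&& S \subset X, S != set0 & S != X] ==> (q <= cut S (X :\: S))].

Lemma qconnP q X :
  reflect (forall S, S \subset X -> S != set0 -> S != X -> q <= cut S (X :\: S))
          (qconn q X).
Proof.
apply: (iffP forallP) => [h S s1 s2 s3|h S].
  by have /implyP := h S; apply; rewrite s1 s2.
by apply/implyP=> /and3P[]; apply: h.
Qed.

Lemma qconn_side q X S : qconn q X -> cut (X :&: S) (X :\: S) < q ->
  X \subset S \/ [disjoint X & S].
Proof.
move=> /qconnP h lt; have := h (X :&: S) (subsetIl _ _).
rewrite -setI_eq0; case: eqP => [->|_ /(_ isT)]; first by right.
case: eqP => [/setIidPl->|_ /(_ isT)]; first by left.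
by rewrite setDIr setDv set0U leqNgt lt.
Qed.

Lemma qconn1 q x : qconn q [set x].
Proof.
apply/qconnP=> S; rewrite subset1 => /orP[/eqP->|/eqP->]; by rewrite eqxx.
Qed.

Hypothesis msym : forall x y, m x y = m y x.

Lemma cutC X Y : cut X Y = cut Y X.
Proof.
rewrite /cut exchange_big; apply: eq_bigr => x _.
by apply: eq_bigr => y _; rewrite msym.
Qed.

Lemma qconnU q X Y : qconn q X -> qconn q Y -> q <= cut X Y -> qconn q (X :|: Y).
Proof.
move=> cX cY le; apply/qconnP=> S sS S0 SXY; rewrite leqNgt; apply/negP=> lt.
have sub (Z : {set V}) : Z \subset X :|: Y -> cut (Z :&: S) (Z :\: S) < q.
  by move=> sZ; apply: leq_ltn_trans lt; rewrite cutS ?subsetIr ?setSD.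
have [sX|dX] := qconn_side cX (sub _ (subsetUl _ _));
have [sY|dY] := qconn_side cY (sub _ (subsetUr _ _)).
- by case/eqP: SXY; apply/eqP; rewrite eqEsubset sS subUset sX sY.
- have : cut X Y <= cut S ((X :|: Y) :\: S) by rewrite cutS // subsetD subsetUr.
  by rewrite leqNgt (leq_trans lt le).
- have : cut Y X <= cut S ((X :|: Y) :\: S) by rewrite cutS // subsetD subsetUl.
  by rewrite cutC leqNgt (leq_trans lt le).
- case/negP: S0; rewrite -subset0; apply/subsetP=> x xS.
  have := subsetP sS x xS; rewrite inE => /orP[xX|xY].
    by rewrite (disjointFr dX xX) in xS.
  by rewrite (disjointFr dY xY) in xS.
Qed.

Lemma qconnU1 q x X : qconn q X -> q <= cut [set x] X -> qconn q (x |: X).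
Proof. by move=> cX; apply: qconnU => //; apply: qconn1. Qed.

End Cuts.

(* H is a hub for the sets P i, in each of which a branch vertex can be chosen. *)
Definition has_hub (V : finType) (m : V -> V -> nat) (t q : nat) : Prop :=
  exists (H : {set V}) (P : 'I_t -> {set V}),
    [/\ H != set0, qconn m q H,
        forall i, [/\ qconn m q (P i), [disjoint P i & H] & t <= cut m (P i) H]
      & forall i j, i != j -> [disjoint P i & P j]].

Definition mult (V E : finType) (G : mgraph V E) (x y : V) : nat :=
  #|[set e in edges G | ends G e == [set x; y]]|.

Section Mult.
Variables (V E : finType) (G : mgraph V E).

Lemma multC x y : mult G x y = mult G y x.
Proof. by rewrite /mult setUC. Qed.

Lemma multxx x : mult G x x = 0.
Proof.
apply/eqP; rewrite cards_eq0; apply/eqP/setP=> e; rewrite !inE setUid.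
apply/negP=> /andP[/ends_card + /eqP E1]; by rewrite E1 cards1.
Qed.

Lemma mult_gt0 x y : 0 < mult G x y -> [/\ x \in verts G, y \in verts G & x != y].
Proof.
move=> m0; split; last by apply: contraTneq m0 => ->; rewrite multxx.
- case/card_gt0P: m0 => e; rewrite inE => /andP[/ends_verts/subsetP s /eqP ee].
  by apply: s; rewrite ee !inE eqxx.
- case/card_gt0P: m0 => e; rewrite inE => /andP[/ends_verts/subsetP s /eqP ee].
  by apply: s; rewrite ee !inE eqxx orbT.
Qed.

Lemma ends_set2 e x y : e \in edges G -> x \in ends G e -> y \in ends G e ->
  x != y -> ends G e = [set x; y].
Proof.
move=> /ends_card c xe ye xy; apply/eqP; rewrite eq_sym eqEcard c cards2 xy.
by rewrite subUset !sub1set xe ye.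
Qed.

Lemma cut_gt0 X Y : 0 < cut (mult G) X Y ->
  exists x y, [/\ x \in X, y \in Y & 0 < mult G x y].
Proof.
rewrite lt0n sum_nat_eq0 negb_forall => /existsP[x].
rewrite negb_imply sum_nat_eq0 negb_forall => /andP[xX /existsP[y]].
by rewrite negb_imply -lt0n => /andP[yY m0]; exists x, y.
Qed.

End Mult.

(** * From a hub to a strong immersion of the complete graph *)

Section Walks.
Variables (V E : finType) (G : mgraph V E).
Implicit Types (x y : V) (l : seq (E * V)) (W : {set V}).

Lemma steps_cat x l1 l2 :
  steps G x (l1 ++ l2) = steps G x l1 && steps G (last x (unzip2 l1)) l2.
Proof. by elim: l1 x => //= -[e y] l1 IH x /=; rewrite IH !andbA. Qed.

Lemma last_unzip2_cat x l1 l2 :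
  last x (unzip2 (l1 ++ l2)) = last (last x (unzip2 l1)) (unzip2 l2).
Proof. by rewrite /unzip2 map_cat last_cat. Qed.

Lemma rev_steps x l : steps G x l ->
  exists l', [/\ steps G (last x (unzip2 l)) l',
    last (last x (unzip2 l)) (unzip2 l') = x,
    {subset unzip1 l' <= unzip1 l} & {subset unzip2 l' <= x :: unzip2 l}].
Proof.
elim: l x => [|[e y] l IH] x /=; first by exists [::].
case/and3P=> eG ee /IH[l' [s1 s2 s3 s4]]; exists (rcons l' (e, x)); split.
- by rewrite -cats1 steps_cat s1 /= s2 eG setUC ee.
- by rewrite /unzip2 map_rcons last_rcons.
- move=> f; rewrite /unzip1 map_rcons mem_rcons !inE => /orP[->//|/s3 ->].
  by rewrite orbT.
- move=> v; rewrite /unzip2 map_rcons mem_rcons !inE => /orP[->//|/s4].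
  by rewrite inE => ->; rewrite orbT.
Qed.

Lemma shorten_steps x l : steps G x l ->
  exists l', [/\ steps G x l', last x (unzip2 l') = last x (unzip2 l),
    uniq (x :: unzip2 l'), {subset unzip1 l' <= unzip1 l}
    & {subset unzip2 l' <= unzip2 l}].
Proof.
elim: l x => [|[e y] l IH] x /=; first by exists [::].
case/and3P=> eG ee /IH[l' [s1 s2 s3 s4 s5]].
have sub4 (s : seq E) : {subset s <= unzip1 l'} -> {subset s <= e :: unzip1 l}.
  by move=> h f /h/s4; rewrite inE => ->; rewrite orbT.
have sub5 (s : seq V) : {subset s <= unzip2 l'} -> {subset s <= y :: unzip2 l}.
  by move=> h f /h/s5; rewrite inE => ->; rewrite orbT.
have [xl|xl] := boolP (x \in y :: unzip2 l'); last first.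
  exists ((e, y) :: l'); split=> //=; first by rewrite eG ee.
  - by rewrite xl.
  - by move=> f; rewrite inE => /predU1P[->|/s4 fl]; rewrite !inE ?eqxx ?fl ?orbT.
  - by move=> f; rewrite inE => /predU1P[->|/s5 fl]; rewrite !inE ?eqxx ?fl ?orbT.
have [xy|xy] := eqVneq x y.
  subst y; exists l'; split=> //; [exact: sub4 | exact: sub5].
move: xl; rewrite inE (negPf xy) /= => /mapP[[f z] fl /= xz]; subst z.
case/path.splitPr: fl s1 s2 s3 s4 s5 sub4 sub5 => l1 l2 s1 s2 s3 s4 s5 sub4 sub5.
exists l2; split.
- by move: s1; rewrite steps_cat /= => /and4P[].
- by rewrite -s2 last_unzip2_cat.
- by move: s3; rewrite /unzip2 map_cat /= cat_uniq /= => /andP[_ /and3P[]].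
- by apply: sub4 => g gl; rewrite /unzip1 map_cat mem_cat inE gl !orbT.
- by apply: sub5 => g gl; rewrite /unzip2 map_cat mem_cat inE gl !orbT.
Qed.

Definition tail (a : E * V) : V :=
  if [pick x in ends G a.1 :\ a.2] is Some x then x else a.2.

Lemma tailP e y : e \in edges G -> y \in ends G e ->
  tail (e, y) != y /\ ends G e = [set tail (e, y); y].
Proof.
move=> eG ye; rewrite /tail /=; case: pickP => [x|no].
  by rewrite !inE => /andP[xy xe]; split=> //; apply: ends_set2.
have := ends_card eG; rewrite (cardsD1 y) ye (_ : _ :\ y = set0) ?cards0 //.
by apply/setP=> x; rewrite no inE.
Qed.

Lemma tail_set2 e x y : e \in edges G -> ends G e = [set x; y] -> tail (e, y) = x.
Proof.
move=> eG ee; have ye : y \in ends G e by rewrite ee !inE eqxx orbT.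
have [ty] := tailP eG ye; have : tail (e, y) \in ends G e.
  by have [_ ->] := tailP eG ye; rewrite !inE eqxx.
by rewrite {1}ee !inE (negPf ty) orbF => /eqP.
Qed.

(** Each edge in both directions, except towards [W]: a walk along these arcs meets [W] at most in
    its first vertex, so no branch vertex becomes internal. *)
Definition arcs W : seq (E * V) :=
  [seq a <- enum {: E * V} | [&& a.1 \in edges G, a.2 \in ends G a.1 & a.2 \notin W]].

Definition arc_ends (a : E * V) : V * V := (tail a, a.2).

Lemma steps_dwalk W h x l : {subset l <= arcs W} ->
  dwalk h x (map arc_ends l) = steps G x l && (last x (unzip2 l) == h).
Proof.
elim: l x => //= -[e y] l IH x sub /=.
rewrite IH; last by move=> a al; apply: sub; rewrite inE al orbT.
have := sub (e, y) (mem_head _ _); rewrite mem_filter /= => /andP[/and3P[eG ye _] _].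
rewrite eG /= andbA; congr (_ && _); congr (_ && _).
have [ty ee] := tailP eG ye; apply/eqP/eqP => [<- //|/(tail_set2 eG)//].
Qed.

Lemma cut_leq_arcs W (S : {set V}) :
  cut (mult G) S (~: (S :|: W)) <= count (leaves S) (map arc_ends (arcs W)).
Proof.
rewrite count_map /arcs count_filter -size_filter.
set p := (X in filter X).
have -> : size (filter p (enum {: E * V})) = #|[set a | p a]|.
  rewrite cardE; apply/perm_size/uniq_perm; rewrite ?enum_uniq //.
    by apply: filter_uniq; apply: enum_uniq.
  by move=> a; rewrite mem_filter !mem_enum [in RHS]inE; apply: andbT.
rewrite -sum1_card.
rewrite (partition_big arc_ends (fun u => (u.1 \in S) && (u.2 \in ~: (S :|: W)))) /=; last first.
  move=> a; rewrite inE /p /= /leaves /= !inE negb_or.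
  by case/andP=> /andP[-> ->] /and3P[_ _ ->].
rewrite /cut pair_big /=; apply: leq_sum => -[x y] /andP[/= xS yS].
rewrite sum1_card /mult -(card_imset (f := fun e => (e, y))); last by move=> e f [].
apply: subset_leq_card; apply/subsetP=> a /imsetP[e]; rewrite inE => /andP[eG /eqP ee] ->.
move: yS; rewrite !inE negb_or => /andP[yS yW].
rewrite unfold_in /= inE /p /= /leaves /arc_ends /= (tail_set2 eG ee) xS yS eG yW eqxx.
by rewrite ee !inE eqxx orbT.
Qed.

End Walks.

(** [flow_linked] only sees pairs of vertices. This lemma and the next one carry its output back to
    the labelled steps of [arcs]. *)
Lemma perm_map_lift (A B : eqType) (f : A -> B) (s : seq B) (X : seq A) :
  perm_eq s (map f X) -> exists2 X', perm_eq X' X & s = map f X'.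
Proof.
elim: s X => [|b s IH] X p.
  have : size X = 0 by rewrite -(size_map f) -(perm_size p).
  by move/size0nil->; exists [::].
have /mapP[x xX bx] : b \in map f X by rewrite -(perm_mem p) mem_head.
have [|X' p' ->] := IH (rem x X).
  have := perm_map f (perm_to_rem xX); rewrite /= -bx perm_sym => p2.
  have := perm_trans p (_ : perm_eq (map f X) (b :: map f (rem x X))).
  by rewrite perm_cons; apply; rewrite perm_sym.
exists (x :: X'); last by rewrite bx.
by rewrite perm_sym (perm_trans (perm_to_rem xX)) // perm_cons perm_sym.
Qed.

Lemma map_flatten_lift (A B : Type) (f : A -> B) (ss : seq (seq B)) (r : seq B) (X : seq A) :
  flatten ss ++ r = map f X ->
  exists es r', map (map f) es = ss /\ flatten es ++ r' = X.
Proof.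
elim: ss X => [|s ss IH] X /= E; first by exists [::], X.
have E1 : s = map f (take (size s) X) by rewrite map_take -E -catA take_size_cat.
have [es [r' [E2 E3]]] : exists es r',
    map (map f) es = ss /\ flatten es ++ r' = drop (size s) X.
  by apply: IH; rewrite map_drop -E -catA drop_size_cat.
by exists (take (size s) X :: es), r'; rewrite /= -E1 E2 -catA E3 cat_take_drop.
Qed.

Lemma mem_split (T : eqType) (a : T) (s : seq T) :
  a \in s -> exists s1 s2, s = s1 ++ a :: s2.
Proof. by case/path.splitPr=> s1 s2; exists s1, s2. Qed.

Section System.
Variables (V E : finType) (G : mgraph V E) (W : {set V}) (h : V).
Variables (I : finType) (g : I -> V) (L : {set I}).
Implicit Types ws : I -> seq (E * V).

(* A step (e, y) is the edge e traversed towards y. *)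
Definition occ (a : E * V) (l : seq (E * V)) : nat := count_mem a l.

Lemma occ_cat a l1 l2 : occ a (l1 ++ l2) = occ a l1 + occ a l2.
Proof. exact: count_cat. Qed.

Lemma occ_cons a b l : occ a (b :: l) = (b == a) + occ a l.
Proof. by []. Qed.

(** The index set allows many walks from the same vertex. An edge may still be used once in each
    direction; [wsystem_size_min] removes this. *)
Definition wsystem ws : Prop :=
  {in L, forall p, [/\ steps G (g p) (ws p), last (g p) (unzip2 (ws p)) = h
     & {subset ws p <= arcs G W}]} /\
  (forall a, \sum_(p in L) occ a (ws p) <= 1).

Lemma flow_wsystem : h \notin [set g p | p in L] ->
  (forall S : {set V}, h \notin S ->
     #|[set p in L | g p \in S]| <= cut (mult G) S (~: (S :|: W))) ->
  exists ws, wsystem ws.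
Proof.
move=> hL cc.
have [||ps [rest [p1 p2 p3]]] :=
    @flow_linked V h (map (arc_ends G) (arcs G W)) [seq g p | p <- enum L].
- apply: contra hL => /mapP[p]; rewrite mem_enum => pL ->; exact: imset_f.
- move=> S hS; apply: leq_trans (cut_leq_arcs _ _ _); apply: leq_trans (cc S hS).
  rewrite count_map cardE -size_filter eq_leq //.
  apply/perm_size/uniq_perm; rewrite ?enum_uniq //.
    by apply: filter_uniq; apply: enum_uniq.
  by move=> p; rewrite mem_filter !mem_enum [in RHS]inE /= andbC.
have [L' pL' E1] := perm_map_lift p1.
have [X' pX' E2] := perm_map_lift p3.
have [es [r' [E3 E4]]] := map_flatten_lift E2.
have uL : uniq L' by rewrite (perm_uniq pL') enum_uniq.
have sL : size es = size L'.
  by rewrite -(size_map (map (arc_ends G))) E3 size_map -(size_map g) -E1 size_map.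
have mL : L' =i L by move=> p; rewrite (perm_mem pL') mem_enum.
exists (fun p => nth [::] es (index p L')); split=> [p pL|a].
  have iL : index p L' < size L' by rewrite index_mem mL.
  have ip : index p L' < size ps by rewrite -(size_map (fun p => p.1)) E1 size_map.
  have sub : {subset nth [::] es (index p L') <= arcs G W}.
    move=> a an; rewrite -(perm_mem pX') -E4 mem_cat; apply/orP; left.
    by apply/flattenP; exists (nth [::] es (index p L')); rewrite ?mem_nth ?sL.
  have x0 : V * seq (V * V) by exact: (h, [::]).
  have := allP p2 _ (mem_nth x0 ip); rewrite -(nth_map _ h) // E1.
  rewrite (nth_map p) // nth_index ?mL // -(nth_map _ [::] (fun p => p.2)) // -E3.
  by rewrite (nth_map [::]) ?sL // (steps_dwalk _ _ sub) => /andP[-> /eqP->].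
rewrite /occ; have -> : \sum_(p in L) count_mem a (nth [::] es (index p L')) = count_mem a (flatten es).
  rewrite -(eq_bigl _ _ mL) -big_uniq //= count_flatten sumnE big_map.
  case: {E1 mL pL'} L' uL sL => [|p0 L'] uL sL.
    by move/size0nil: sL => ->; rewrite !big_nil.
  rewrite (big_nth p0) [RHS](big_nth [::]) sL; apply: eq_big_nat => i /andP[_ lti].
  by rewrite index_uniq.
have : uniq X' by rewrite (perm_uniq pX'); apply: filter_uniq; apply: enum_uniq.
rewrite -E4 cat_uniq => /and3P[u _ _].
by rewrite count_uniq_mem //; case: (_ \in _).
Qed.

Lemma sum_update2 (F1 F2 : I -> nat) (p p' : I) : p \in L -> p' \in L -> p != p' ->
  (forall r, r != p -> r != p' -> F1 r = F2 r) ->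
  \sum_(r in L) F1 r + (F2 p + F2 p') = \sum_(r in L) F2 r + (F1 p + F1 p').
Proof.
move=> pL pL' ne eF; rewrite (bigD1 p) //= (bigD1 p') ?pL' 1?eq_sym //=.
rewrite [in RHS](bigD1 p) //= [in RHS](bigD1 p') ?pL' 1?eq_sym //=.
rewrite (eq_bigr F2) => [|r /andP[/andP[_ rp] rp']]; last by apply: eF.
by clear; rewrite /=; lia.
Qed.

Lemma sum_update1 (F1 F2 : I -> nat) (p : I) : p \in L ->
  (forall r, r != p -> F1 r = F2 r) ->
  \sum_(r in L) F1 r + F2 p = \sum_(r in L) F2 r + F1 p.
Proof.
move=> pL eF; rewrite (bigD1 p) //= [in RHS](bigD1 p) //=.
rewrite (eq_bigr F2) => [|r /andP[_ rp]]; last by apply: eF.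
by clear; rewrite /=; lia.
Qed.

(* The flow may use an edge once in each direction; exchanging the tails of
   the two walks, which all end in h, then makes the system shorter. *)
Lemma wsystem_size_min ws : wsystem ws -> exists2 ws', wsystem ws' &
  {in L &, forall p p' e y y', (e, y) \in ws' p -> (e, y') \in ws' p' -> y = y'}.
Proof.
have [n] := ubnP (\sum_(p in L) size (ws p)); elim: n ws => // n IH ws le sys.
have [s1 s2] := sys.
have eP p e y : p \in L -> (e, y) \in ws p -> [/\ e \in edges G, y \in ends G e & y \notin W].
  by move=> /s1[_ _ sub] /sub; rewrite mem_filter /= => /andP[/and3P[]].
case: (boolP [exists p in L, exists p' in L, exists e, exists y, exists y',
  [&& (e, y) \in ws p, (e, y') \in ws p' & y != y']]); last first.
  move=> no; exists ws => // p p' pL pL' e y y' yp yp'; apply/eqP; apply: contraNT no => ne.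
  apply/exists_inP; exists p => //; apply/exists_inP; exists p' => //.
  apply/existsP; exists e; apply/existsP; exists y; apply/existsP; exists y'.
  by rewrite yp yp'.
case/exists_inP=> p pL /exists_inP[p' pL' /existsP[e /existsP[y /existsP[y' /and3P[yp yp' ne]]]]].
have [eG ye _] := eP _ _ _ pL yp; have [_ ye' _] := eP _ _ _ pL' yp'.
have ee : ends G e = [set y; y'] by apply: ends_set2.
have headE (u v : V) : ends G e == [set u; v] -> v \in ends G e -> u = tail G (e, v).
  by move=> /eqP uv ve; rewrite (tail_set2 eG uv).
have t1 : tail G (e, y) = y' by apply: tail_set2; rewrite // ee setUC.
have t2 : tail G (e, y') = y by apply: tail_set2.
have [pp|npp] := eqVneq p p'; last first.
  have [p1 [p2 Ep]] := mem_split yp; have [r1 [r2 Er]] := mem_split yp'.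
  have [a1 a2 a3] := s1 p pL; have [b1 b2 b3] := s1 p' pL'.
  pose ws2 r := if r == p then p1 ++ r2 else if r == p' then r1 ++ p2 else ws r.
  have e1 : ws2 p = p1 ++ r2 by rewrite /ws2 eqxx.
  have e2 : ws2 p' = r1 ++ p2 by rewrite /ws2 eqxx eq_sym (negPf npp).
  have e3 r : r != p -> r != p' -> ws2 r = ws r by rewrite /ws2 => /negPf-> /negPf->.
  move: a1 a2 a3 b1 b2 b3.
  rewrite Ep Er !steps_cat !last_unzip2_cat /=.
  case/and4P=> a1 _ /headE a4 a5 a2 a3 /and4P[b1 _ /headE b4 b5] b2 b3.
  move: a4 b4 => /(_ ye) a4 /(_ ye') b4.
  apply: (IH ws2).
    have := @sum_update2 (fun r => size (ws2 r)) (fun r => size (ws r)) p p' pL pL' npp.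
    rewrite e1 e2 Ep Er !size_cat /=.
    move=> /(_ (fun r rp rp' => congr1 size (e3 r rp rp'))).
    by move: le; clear; lia.
  split=> [r rL|a].
    have [->|rp] := eqVneq r p.
      rewrite e1 steps_cat last_unzip2_cat a1 a4 t1; split=> // a.
      by rewrite mem_cat => /orP[aa|aa]; [apply: a3|apply: b3]; rewrite mem_cat ?inE aa ?orbT.
    have [->|rp'] := eqVneq r p'; last by rewrite e3 //; apply: s1.
    rewrite e2 steps_cat last_unzip2_cat b1 b4 t2; split=> // a.
    by rewrite mem_cat => /orP[aa|aa]; [apply: b3|apply: a3]; rewrite mem_cat ?inE aa ?orbT.
  have := @sum_update2 (fun r => occ a (ws2 r)) (fun r => occ a (ws r)) p p' pL pL' npp.
  rewrite e1 e2 Ep Er !(occ_cat, occ_cons).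
  move=> /(_ (fun r rp rp' => congr1 (occ a) (e3 r rp rp'))).
  by move: (s2 a); clear; lia.
(* A single walk traverses e in both directions: the stretch from the first traversal to the second
   returns to its starting vertex and is cut out. *)
subst p'.
have [p1 [a [p2 [b [p3 [Ep ha]]]]]] : exists p1 a p2 b p3,
    ws p = p1 ++ a :: p2 ++ b :: p3 /\
    ((a = (e, y) /\ b = (e, y')) \/ (a = (e, y') /\ b = (e, y))).
  have [p1 [p2 Ep]] := mem_split yp; move: yp'; rewrite Ep mem_cat inE.
  case/or3P=> [/mem_split[q1 [q2 ->]]|/eqP[yy]|/mem_split[q1 [q2 ->]]].
  - exists q1, (e, y'), q2, (e, y), p2; rewrite -catA; split=> //; by right.
  - by rewrite yy eqxx in ne.
  - exists p1, (e, y), q1, (e, y'), q2; split=> //; by left.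
have [a1 a2 a3] := s1 p pL.
pose ws2 r := if r == p then p1 ++ p3 else ws r.
have e1 : ws2 p = p1 ++ p3 by rewrite /ws2 eqxx.
have e3 r : r != p -> ws2 r = ws r by rewrite /ws2 => /negPf->.
have [a4 a5 a6] : [/\ steps G (g p) p1, last (g p) (unzip2 p1) = b.2 & steps G b.2 p3].
  move: a1; rewrite Ep steps_cat; case: ha => [[-> ->]|[-> ->]] /=; rewrite steps_cat /=.
    by case/and4P=> -> _ /headE -> // /and4P[].
  by case/and4P=> -> _ /headE -> // /and4P[].
apply: (IH ws2).
  have := @sum_update1 (fun r => size (ws2 r)) (fun r => size (ws r)) p pL.
  rewrite e1 Ep !size_cat /= size_cat /=.
  move=> /(_ (fun r rp => congr1 size (e3 r rp))).
  by move: le; clear; lia.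
split=> [r rL|c].
  have [->|rp] := eqVneq r p; last by rewrite e3 //; apply: s1.
  rewrite e1 steps_cat last_unzip2_cat a4 a5 a6; split=> //.
    by rewrite -a2 Ep last_unzip2_cat /= last_unzip2_cat.
  by move=> c; rewrite mem_cat => /orP[aa|aa]; apply: a3; rewrite Ep mem_cat inE mem_cat inE aa ?orbT.
have := @sum_update1 (fun r => occ c (ws2 r)) (fun r => occ c (ws r)) p pL.
rewrite e1 Ep !(occ_cat, occ_cons).
move=> /(_ (fun r rp => congr1 (occ c) (e3 r rp))).
by move: (s2 c); clear; lia.
Qed.

End System.

(** Each ordered pair (i, j) with distinct entries sends one walk from [w i] to a fixed h in H. The
    path for the edge ij follows the walk of (i, j) to h and the reversed walk of (j, i) back, and
    is then shortened. *)
Lemma hub_immersion (V E : finType) (G : mgraph V E) (t : nat) :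
  0 < t -> has_hub (mult G) t (t ^ 2) -> strong_immersion (complete t) G.
Proof.
move=> t0 [H [P [H0 cH hP dP]]].
have [w wP] : exists w : 'I_t -> V, forall i, w i \in P i /\ w i \in verts G.
  apply: (@fin_all_exists _ (fun _ => V) (fun i x => x \in P i /\ x \in verts G)) => i.
  have [_ _ /(leq_trans t0)/cut_gt0[x [y [xP _ /mult_gt0[xG _ _]]]]] := hP i.
  by exists x.
case/set0Pn: H0 => h hH.
have wH i : w i \notin H.
  by have [_ d _] := hP i; rewrite (disjointFr d) //; case: (wP i).
have winj : injective w.
  move=> i j eij; apply/eqP; apply: contraT => /dP d.
  by have := disjointFr d (wP i).1; rewrite eij (wP j).1.
pose W := [set w i | i : 'I_t]; pose L := [set p : 'I_t * 'I_t | p.1 != p.2].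
pose g (p : 'I_t * 'I_t) := w p.1.
have hW : h \notin W by apply/imsetP=> -[i _ e]; rewrite e (negPf (wH i)) in hH.
have hL : h \notin [set g p | p in L].
  by apply/imsetP=> -[p _ e]; rewrite e (negPf (wH p.1)) in hH.
have HW : [disjoint H & W].
  apply/pred0P=> x /=; apply/negP=> /andP[xH /imsetP[i _ e]].
  by rewrite e (negPf (wH i)) in xH.
have cc (S : {set V}) : h \notin S ->
    #|[set p in L | g p \in S]| <= cut (mult G) S (~: (S :|: W)).
  move=> hS; have [dSH|nd] := boolP [disjoint H & S]; last first.
    apply: (@leq_trans (t ^ 2)).
      by apply: (leq_trans (max_card _)); rewrite card_prod card_ord.
    have := qconnP _ _ _ cH (H :&: S) (subsetIl _ _).
    rewrite setI_eq0 nd => /(_ isT) h1; apply: (leq_trans (h1 _)).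
      by apply: contraNneq hS => /setIidPl/subsetP; apply.
    apply: cutS; first exact: subsetIr.
    apply/subsetP=> x; rewrite !inE => /andP[xS xH].
    by rewrite xH (disjointFr HW xH) orbF in xS *.
  pose Y := ~: (S :|: W).
  apply: (@leq_trans (\sum_(i | w i \in S) t)).
    have -> : [set p in L | g p \in S] =
        [set p : 'I_t * 'I_t | (w p.1 \in S) && (p.1 != p.2)].
      by apply/setP=> p; rewrite !inE andbC.
    rewrite -sum1_card (eq_bigl (fun p : 'I_t * 'I_t => (w p.1 \in S) && (p.1 != p.2)));
      last by move=> p; rewrite inE.
    rewrite -(pair_big_dep (fun i => w i \in S) (fun i j => i != j) (fun _ _ => 1)) /=.
    by apply: leq_sum => i _; rewrite sum1_card (leq_trans (max_card _)) // card_ord.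
  apply: (@leq_trans (\sum_(i | w i \in S) cut (mult G) (S :&: P i) Y)).
    apply: leq_sum => i wS; have [cP dPH tP] := hP i.
    have [PS|PS] := boolP (P i \subset S).
      apply: (leq_trans tP); apply: cutS; first by rewrite subsetI PS subxx.
      apply/subsetP=> x xH; rewrite !inE negb_or (disjointFr dSH xH) /=.
      by rewrite (disjointFr HW xH).
    apply: (@leq_trans (t ^ 2)); first by rewrite leq_pmulr.
    rewrite setIC; apply: (leq_trans (qconnP _ _ _ cP (P i :&: S) (subsetIl _ _) _ _)).
    - by apply/set0Pn; exists (w i); rewrite inE (wP i).1.
    - by apply: contraNneq PS => /setIidPl.
    apply: cutS => //; apply/subsetP=> x; rewrite !inE => /andP[xS xP].
    rewrite xP /= in xS; rewrite negb_or xS /=; apply/imsetP=> -[j _ xj].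
    have [ij|/dP d] := eqVneq i j; first by rewrite xj -ij wS in xS.
    by have := disjointFr d xP; rewrite xj (wP j).1.
  rewrite /cut.
  rewrite (exchange_big_dep (fun x => x \in S)) /=; last first.
    by move=> i x _; rewrite inE => /andP[].
  apply: leq_sum => x xS; rewrite sum_nat_const -[X in _ <= X]mul1n leq_mul2r; apply/orP; right.
  apply/card_le1_eqP => i j /andP[_ +] /andP[_ +]; rewrite !inE => /andP[_ xi] /andP[_ xj].
  by apply/eqP; apply: contraT => /dP d; rewrite (disjointFr d xj) in xi.
have [ws0 sys0] := flow_wsystem hL cc.
have [ws [s1 s2] s3] := wsystem_size_min sys0.
have wsW p : p \in L -> {in unzip2 (ws p), forall v, v \notin W}.
  move=> /s1[_ _ sub] v /mapP[a /sub]; rewrite mem_filter => /andP[/and3P[_ _ vW] _ ->].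
  by [].
have disj p p' e : p \in L -> p' \in L -> e \in unzip1 (ws p) -> e \in unzip1 (ws p') -> p = p'.
  move=> pL pL' /mapP[[e1 y] a1 /= ->] /mapP[[e2 y'] a2 /= E1]; subst e2.
  have E2 := s3 _ _ pL pL' _ _ _ a1 a2; subst y'; apply/eqP; apply: contraT => ne.
  have := s2 (e1, y); rewrite (bigD1 p) //= (bigD1 p') ?pL' 1?eq_sym //=.
  have : 0 < occ (e1, y) (ws p) by rewrite /occ -has_count has_pred1.
  have : 0 < occ (e1, y) (ws p') by rewrite /occ -has_count has_pred1.
  by case: (occ _ _) => // k1; case: (occ _ _) => // k2 _ _; rewrite addnA addSn addnS.
pose routed (f : {set 'I_t}) (Q : walk V E) := #|f| = 2 ->
  exists i j, [/\ i != j, f = [set i; j], is_path G Q,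
    source Q = w i /\ target Q = w j &
    (forall e, e \in walk_edges Q -> e \in unzip1 (ws (i, j)) \/ e \in unzip1 (ws (j, i)))
    /\ (forall v, v \in walk_verts Q -> v \in W -> v = w i \/ v = w j)].
have [Q QP] : exists Q : {set 'I_t} -> walk V E, forall f, routed f (Q f).
  apply: (@fin_all_exists _ (fun _ => walk V E) routed) => f.
  have [|/eqP nf] := boolP (#|f| == 2); last by exists (h, [::]).
  case/cards2P=> i [j [ij ->]].
  have ijL : (i, j) \in L by rewrite inE.
  have jiL : (j, i) \in L by rewrite inE /= eq_sym.
  have [a1 a2 _] := s1 _ ijL; have [b1 b2 _] := s1 _ jiL.
  have [l [c1 c2 c3 c4]] := rev_steps b1; rewrite b2 /g /= in c1 c2 c4.
  have ab : steps G (w i) (ws (i, j) ++ l) by rewrite steps_cat a1 a2.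
  have [l' [d1 d2 d3 d4 d5]] := shorten_steps ab.
  exists (w i, l') => _; exists i, j; split=> //.
  - by rewrite /is_path /source /= (wP i).2 d1.
  - by split=> //; rewrite /target /= d2 last_unzip2_cat a2.
  split=> [e /d4|v]; first by rewrite /unzip1 map_cat mem_cat => /orP[->|/c3 ->]; [left|right].
  rewrite inE => /predU1P[->|/d5]; first by left.
  rewrite /unzip2 map_cat mem_cat => /orP[/(wsW _ ijL)/negPf->//|/c4].
  by rewrite inE => /predU1P[->|/(wsW _ jiL)/negPf->//]; right.
have card2 f : f \in edges (complete t) -> #|f| = 2 by rewrite inE => /eqP.
exists w, Q; split.
- by move=> i _; case: (wP i).
- by move=> i j _ _; apply: winj.
- move=> f /card2/QP[i [j [ij fij pQ [sQ tQ] _]]]; split=> //.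
  by rewrite sQ tQ /= fij imsetU1 imset_set1.
- move=> f f' /card2/QP[i [j [ij fij _ _ [eQ _]]]] /card2/QP[i' [j' [ij' fij' _ _ [eQ' _]]]] ff' e ef.
  apply/negP=> ef'; case/eqP: ff'.
  have mL (k k' : 'I_t) : k != k' -> (k, k') \in L by rewrite inE.
  have mR (k k' : 'I_t) : k != k' -> (k', k) \in L by rewrite inE eq_sym.
  rewrite fij fij'; case: (eQ e ef) => e1; case: (eQ' e ef') => e2.
  - by have [-> ->] := disj _ _ _ (mL _ _ ij) (mL _ _ ij') e1 e2.
  - by have [-> ->] := disj _ _ _ (mL _ _ ij) (mR _ _ ij') e1 e2; rewrite setUC.
  - by have [-> ->] := disj _ _ _ (mR _ _ ij) (mL _ _ ij') e1 e2; rewrite setUC.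
  - by have [-> ->] := disj _ _ _ (mR _ _ ij) (mR _ _ ij') e1 e2.
- move=> f i /card2/QP[i' [j [ij fij _ [sQ tQ] [_ vQ]]]] _.
  apply/negP=> /and3P[/vQ vv]; rewrite sQ tQ => n1 n2.
  by have [|E1|E1] := vv; [apply: imset_f|rewrite E1 eqxx in n1|rewrite E1 eqxx in n2].
Qed.

(** * Free vertices along thick paths *)

Lemma split_sum (T : eqType) (f : T -> nat) (q a b : nat) (s : seq T) :
  {in s, forall u, f u <= b} -> a < q -> q <= a + \sum_(u <- s) f u ->
  exists s1 s2, s = s1 ++ s2 /\ q <= a + \sum_(u <- s1) f u <= q + b.
Proof.
elim: s a => [|u s IH] a fb aq; first by rewrite big_nil; lia.
rewrite big_cons => le; have fu := fb u (mem_head _ _).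
have [le1|lt1] := leqP q (a + f u).
  by exists [:: u], s; rewrite big_seq1; split=> //; lia.
have [||s1 [s2 [-> le2]]] := IH (a + f u) _ lt1; last 1 first.
- by exists (u :: s1), s2; rewrite big_cons addnA.
- by move=> v vs; apply: fb; rewrite inE vs orbT.
- by rewrite -addnA.
Qed.

Section Hubs.
Variables (V : finType) (m : V -> V -> nat) (q : nat).
Hypothesis msym : forall x y, m x y = m y x.
Implicit Types (H W C S X Y : {set V}) (x y u v w : V) (s : seq V).

Definition thick x y := q <= m x y.

Lemma thick_sym : symmetric thick.
Proof. by move=> x y; rewrite /thick msym. Qed.

Definition hub H W : bool :=
  [&& H != set0, qconn m q H, [disjoint H & W] & [forall w in W, q <= cut m [set w] H]].

Lemma hubP H W : reflect [/\ H != set0, qconn m q H, [disjoint H & W]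
  & {in W, forall w, q <= cut m [set w] H}] (hub H W).
Proof. by apply: (iffP and4P) => -[? ? ? /forall_inP ?]. Qed.

Lemma hub0 H : H != set0 -> qconn m q H -> hub H set0.
Proof. by move=> *; apply/hubP; split; rewrite -?setI_eq0 ?setI0 // => w; rewrite inE. Qed.

Lemma hub_qconn H W : hub H W -> qconn m q (H :|: W).
Proof.
case/hubP=> H0 cH d wq; apply/qconnP=> S sS S0 SX; rewrite leqNgt; apply/negP=> lt.
have [|sH|dH] := @qconn_side _ _ _ _ S cH.
- by apply: leq_ltn_trans lt; rewrite cutS ?subsetIr ?setSD ?subsetUl.
- have [w wHW wS] : exists2 w, w \in H :|: W & w \notin S.
    apply/subsetPn; apply: contra SX => sub; by rewrite eqEsubset sS sub.
  have wW : w \in W.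
    by move: wHW; rewrite inE => /orP[/(subsetP sH)|//]; rewrite (negPf wS).
  have := wq w wW; rewrite cutC // leqNgt => /negP[]; apply: leq_ltn_trans lt.
  by rewrite cutS // sub1set inE wHW wS.
- case/set0Pn: S0 => w wS; have := subsetP sS w wS; rewrite inE.
  rewrite (disjointFl dH wS) /= => wW.
  have := wq w wW; rewrite leqNgt => /negP[]; apply: leq_ltn_trans lt.
  rewrite cutS ?sub1set // subsetD subsetUl /=; exact: dH.
Qed.

Lemma sorted_qconn s : sorted thick s -> qconn m q [set x in s].
Proof.
elim: s => [_|x [|y s] IH]; first by rewrite set_nil; apply/qconnP=> S; rewrite subset0 => ->.
  by move=> _; rewrite set_cons set_nil setU0; apply: qconn1.
case/andP=> xy /IH cs; rewrite set_cons; apply: qconnU1 => //.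
by apply: (leq_trans xy); rewrite leq_m_cut ?inE ?eqxx.
Qed.

Lemma cut_seq s X : uniq s -> cut m [set x in s] X = \sum_(u <- s) cut m [set u] X.
Proof.
move=> us; rewrite cut_sum1 (big_uniq _ us) /=; apply: eq_bigl => u.
by rewrite inE.
Qed.

Hypothesis q0 : 0 < q.

(* Along a thick path that sends many edges into X one can alternately absorb
   stretches with at least q edges to X into the hub and keep the next vertex
   outside of it. *)
Lemma hop_hub X s b n : X != set0 -> qconn m q X -> uniq s -> sorted thick s ->
  {in s, forall u, u \notin X} -> {in s, forall u, cut m [set u] X <= b} ->
  n * (q + b + b) <= cut m [set x in s] X ->
  exists H W, [/\ hub H W, #|W| = n, X \subset H, H \subset X :|: [set x in s]
                & W \subset [set x in s]].
Proof.
move=> X0 cX us; rewrite (cut_seq _ us).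
elim: n s us => [|n IH] s us ss dis hb le.
  by exists X, set0; rewrite hub0 // cards0 subxx sub0set subsetUl.
(* A stretch [s1] with between q and q + b edges to X is absorbed, and the next vertex [w], which
   stays free, uses up at most b more: hence q + b + b edges per round. *)
have [|s1 [s2 [es /andP[l1 l2]]]] := split_sum hb q0 (a := 0).
  by rewrite add0n /=; move: le; rewrite mulSn; clear; lia.
subst s; rewrite /= add0n in l1 l2.
have b0 : 0 < b.
  rewrite lt0n; apply/eqP=> b0; move: l1; rewrite big_seq big1; first by rewrite leqNgt q0.
  by move=> u us1; have := hb u; rewrite mem_cat us1 b0 leqn0 => /(_ isT)/eqP.
case: s2 us ss dis hb le => [|w s2] us ss dis hb le.
  by move: le l2 b0; rewrite cats0 mulSn; clear; lia.
have le2 : n * (q + b + b) <= \sum_(u <- s2) cut m [set u] X.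
  have := hb w; rewrite mem_cat mem_head orbT => /(_ isT).
  by move: le; rewrite big_cat big_cons mulSn /=; move: l2; clear; lia.
have us2 : uniq s2 by move: us; rewrite cat_uniq /= => /and4P[].
have ss2 : sorted thick s2.
  by have [_ /path_sorted] := cat_sorted2 ss.
have mem2 u : u \in s2 -> u \in s1 ++ w :: s2 by move=> us2'; rewrite mem_cat inE us2' !orbT.
have mem1 u : u \in s1 -> u \in s1 ++ w :: s2 by move=> us2'; rewrite mem_cat us2'.
have [u us2' |u us2' |H [W [hHW cW XH Hs Ws]]] := IH s2 us2 ss2 _ _ le2.
- by apply/dis/mem2.
- by apply/hb/mem2.
have [H0 cH dHW wq] := hubP _ _ hHW.
have wX : w \notin X by apply: dis; rewrite mem_cat mem_head orbT.
have ws2 : w \notin s2 by move: us; rewrite cat_uniq /= => /and4P[].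
have ws1 : w \notin s1.
  by move: us; rewrite cat_uniq /= => /and3P[_ + _]; rewrite negb_or => /andP[].
have s12 u : u \in s1 -> u \notin s2.
  move: us; rewrite cat_uniq /= => /and3P[_ + _]; rewrite negb_or => /andP[_ /hasPn h] us1.
  by apply/negP=> /h; rewrite us1.
have wH : w \notin H by apply: contra wX => /(subsetP Hs); rewrite !inE (negPf ws2) orbF.
have wW : w \notin W by apply: contra ws2 => /(subsetP Ws); rewrite inE.
exists (H :|: [set x in s1]), (w |: W); split.
- apply/hubP; split.
  + by apply: contraNneq H0 => /eqP; rewrite setU_eq0 => /andP[].
  + apply: qconnU => //; first by apply: sorted_qconn; have [] := cat_sorted2 ss.
    apply: (leq_trans l1); rewrite cutC // -cut_seq; first exact: cutS.
    by move: us; rewrite cat_uniq => /andP[].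
  + apply/pred0P=> u /=; rewrite !inE; apply/negP=> /andP[/orP[uH|us1] /predU1P[uw|uW]].
    * by rewrite -uw uH in wH.
    * by rewrite (disjointFr dHW uH) in uW.
    * by rewrite -uw us1 in ws1.
    * by have := subsetP Ws u uW; rewrite inE (negPf (s12 u us1)).
  + move=> u; rewrite !inE => /predU1P[->|/wq le3]; last first.
      by apply: (leq_trans le3); rewrite cutS ?subsetUl.
    (* [s1] is not empty, and its last vertex is a thick neighbour of [w]; this gives [w] its q
       edges to the new hub. *)
    case/lastP: s1 l1 ss {us dis hb le l2 mem2 mem1 ws1 s12} => [|s1 z] l1 ss.
      by move: l1; rewrite big_nil leqNgt q0.
    have zw : thick z w.
      by rewrite -cats1 -catA in ss; have [_ /= /andP[]] := cat_sorted2 ss.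
    rewrite thick_sym in zw; apply: (leq_trans zw); apply: leq_m_cut; rewrite !inE //.
    by rewrite mem_rcons mem_head orbT.
- by rewrite cardsU1 wW cW.
- by rewrite (subset_trans XH) ?subsetUl.
- apply/subsetP=> u; rewrite !inE mem_cat => /orP[/(subsetP Hs)|->]; last by rewrite orbT.
  by rewrite !inE => /orP[->//|->]; rewrite !orbT.
- apply/subsetP=> u; rewrite !inE mem_cat inE => /orP[->|/(subsetP Ws)].
    by rewrite orbT.
  by rewrite inE => ->; rewrite !orbT.
Qed.

Variable t : nat.
Hypothesis tq : t <= q.
Hypothesis nohub : ~ has_hub m t q.

Lemma hub_lt H W : hub H W -> #|W| < t.
Proof.
case/hubP=> H0 cH d wq; rewrite ltnNge; apply/negP=> le; apply: nohub.
exists H, (fun i => [set enum_val (widen_ord le i)]); split=> //.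
- move=> i; have iW := enum_valP (widen_ord le i); split; first exact: qconn1.
  + by rewrite disjoint_sym disjoints_subset subsetC sub1set inE (disjointFl d iW).
  + exact: leq_trans (wq _ iW).
- move=> i j ij; rewrite disjoints_subset sub1set !inE.
  by apply: contra ij => /eqP/enum_val_inj/(congr1 val) /= ij; apply/eqP/val_inj.
Qed.

(** [hop_hub] with the single vertex v as X and b = q: after t rounds the free vertices contradict
    [hub_lt]. *)
Lemma line_cut1 v s : uniq s -> sorted thick s ->
  {in s, forall u, m v u < q} -> v \notin s -> cut m [set v] [set x in s] < 3 * t * q.
Proof.
move=> us ss hm vs; rewrite ltnNge; apply/negP=> le.
have [||||H [W [/hub_lt + cW _ _ _]]] :=
  @hop_hub [set v] s q t _ (qconn1 m q v) us ss.
- by apply/set0Pn; exists v; rewrite inE.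
- by move=> u us'; rewrite inE; apply: contraNneq vs => <-.
- by move=> u us'; rewrite cut11 msym ltnW // hm.
- by rewrite cutC //; move: le; clear; nia.
by rewrite cW ltnn.
Qed.

(** [hop_hub] again, now with the other path as X; the bound b = 3tq for a single vertex comes from
    [line_cut1]. *)
Lemma line_cut2 s s' : s' != [::] -> uniq s -> sorted thick s -> uniq s' -> sorted thick s' ->
  {in s & s', forall u v, m u v < q} -> {in s, forall u, u \notin s'} ->
  cut m [set x in s] [set x in s'] < t * (q + 6 * t * q).
Proof.
move=> s'0 us ss us' ss' hm d; rewrite ltnNge; apply/negP=> le.
have [||||H [W [/hub_lt + cW _ _ _]]] :=
  @hop_hub [set x in s'] s (3 * t * q) t _ (sorted_qconn ss') us ss.
- by case: s' s'0 {us' ss' hm d le} => // x s' _; apply/set0Pn; exists x; rewrite inE mem_head.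
- by move=> u us2; rewrite inE d.
- move=> u us2; apply/ltnW/line_cut1 => //; last exact: d.
  by move=> v vs'; apply: hm.
- by move: le; clear; nia.
by rewrite cW ltnn.
Qed.

End Hubs.

(** * Merging hubs *)

Section DenseCore.
Variables (I : finType) (mu : I -> I -> nat) (M c t q : nat).
Hypothesis mu_sym : forall x y, mu x y = mu y x.
Hypothesis mu_irr : forall x, mu x x = 0.
Hypothesis mu_le : forall x y, mu x y <= M.
Hypothesis c_ge : (2 * t + 2) * M + q <= c.
Hypothesis q_gt0 : 0 < q.
Implicit Types (A B U W X : {set I}).

Lemma cut_self_setU A B : [disjoint A & B] ->
  cut mu (A :|: B) (A :|: B) = cut mu A A + 2 * cut mu A B + cut mu B B.
Proof.
by move=> d; rewrite cut_setUl // !cut_setUr // (cutC mu_sym B A); lia.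
Qed.

Lemma cut1_le x X : cut mu [set x] X <= #|X| * M.
Proof. by rewrite cut1l -sum_nat_const; apply: leq_sum. Qed.

(* Mader's counting argument: in a smallest set U of at least 2t+2 vertices
   with more than c(|U| - t - 1) edges, no t vertices W leave a cut of U - W
   with fewer than q edges, since otherwise one of the two sides together
   with W would be a smaller such set. *)
Lemma dense_core X : X != set0 -> {in X, forall x, 2 * c <= cut mu [set x] X} ->
  exists U, [/\ U \subset X, t < #|U|, {in U, forall x, c < cut mu [set x] U}
    & forall W, W \subset U -> #|W| <= t -> qconn mu q (U :\: W)].
Proof.
move=> /set0Pn[x0 x0X] degX.
(* [cut mu U U] counts every edge twice, hence the factors 2. *)
pose dense U := [&& U \subset X, 2 * t + 2 <= #|U|
  & 2 * c * #|U| < cut mu U U + 2 * c * (t + 1)].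
have c0 : 0 < c by apply: leq_trans c_ge; lia.
have dX : dense X.
  rewrite /dense subxx /=; apply/andP; split.
    have h := leq_trans (degX _ x0X) (cut1_le x0 X).
    rewrite leqNgt; apply/negP=> h2; have := leq_mul (ltnW h2) (leqnn M).
    by move: h c_ge c0; clear; nia.
  have : \sum_(x in X) 2 * c <= cut mu X X.
    by rewrite [in X in _ <= X]cut_sum1; apply: leq_sum.
  rewrite sum_nat_const; move: c0; clear; nia.
have [U /and3P[UX nU eU] minU] := arg_minnP (fun U : {set I} => #|U|) dX.
have sub_le A : A \subset X -> 2 * t + 2 <= #|A| -> #|A| < #|U| ->
    cut mu A A + 2 * c * (t + 1) <= 2 * c * #|A|.
  move=> AX nA lt; rewrite leqNgt; apply/negP=> dA.
  by have := minU A; rewrite /dense AX nA dA => /(_ isT); rewrite leqNgt lt.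
(* With exactly 2t + 2 vertices, density would force [cut mu U U] above c|U|, while multiplicities
   of at most M keep it below |U|(2t + 2)M <= c|U|. *)
have nU' : 2 * t + 2 < #|U|.
  rewrite ltn_neqAle nU andbT; apply/eqP=> E.
  have : cut mu U U <= #|U| * (#|U| * M).
    by apply: cut_leq_card => x _; apply: cut1_le.
  move: eU; rewrite -E; move: c_ge; clear.
  set n := 2 * t + 2; have -> : t + 1 = n - (t + 1) by rewrite /n; lia.
  move=> h1 h2 h3; have : n * (n * M) <= n * c.
    by rewrite leq_mul2l; apply/orP; right; apply: leq_trans h1; rewrite leq_addr.
  have : n = 2 * (t + 1) by rewrite /n; lia.
  nia.
(* A vertex of degree at most c could be removed without losing density. *)
have degU : {in U, forall x, c < cut mu [set x] U}.
  move=> x xU; have nUx : #|U| = #|U :\ x|.+1 by rewrite (cardsD1 x) xU.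
  have dUx : [disjoint [set x] & U :\ x].
    by rewrite disjoints_subset sub1set !inE eqxx.
  have := sub_le (U :\ x); rewrite (subset_trans (subsetDl _ _) UX) nUx ltnSn.
  move=> /(_ isT); rewrite -ltnS -nUx nU' => /(_ isT isT).
  have E1 : cut mu [set x] U = cut mu [set x] (U :\ x).
    by rewrite -{1}(setD1K xU) cut_setUr // cut11 mu_irr.
  have E2 : cut mu U U = 2 * cut mu [set x] U + cut mu (U :\ x) (U :\ x).
    by rewrite -{1 2}(setD1K xU) cut_self_setU // cut11 mu_irr E1.
  by move: eU c0; rewrite E2 nUx; clear; nia.
exists U; split=> //; first by move: nU'; clear; lia.
move=> W WU cW; apply/qconnP=> A sA A0 AU.
set B := (U :\: W) :\: A; rewrite leqNgt; apply/negP=> lt.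
have B0 : B != set0.
  by rewrite setD_eq0; apply: contra AU => h; rewrite eqEsubset sA h.
have EU : U = A :|: (W :|: B).
  apply/setP=> x; rewrite !inE; have := subsetP sA x; have := subsetP WU x.
  rewrite !inE; case: (x \in A); case: (x \in W); case: (x \in U) => //= a b;
  by [have := a isT | have := b isT].
have dAW : [disjoint A & W].
  by apply: disjointWl sA _; rewrite -setI_eq0; apply/eqP/setP=> x; rewrite !inE; case: (x \in W); rewrite ?andbF.
have dAB : [disjoint A & B].
  by rewrite -setI_eq0; apply/eqP/setP=> x; rewrite !inE; case: (x \in A).
have dWB : [disjoint W & B].
  by rewrite -setI_eq0; apply/eqP/setP=> x; rewrite !inE; case: (x \in W); rewrite ?andbF.
have dAWB : [disjoint A & W :|: B] by rewrite -setI_eq0 setIUr setU_eq0 !setI_eq0 dAW dAB.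
have cU : #|U| = #|A| + (#|W| + #|B|).
  rewrite {1}EU cardsU (eqP (_ : A :&: (W :|: B) == set0)) ?setI_eq0 // cards0 subn0.
  by rewrite cardsU (eqP (_ : W :&: B == set0)) ?setI_eq0 // cards0 subn0.
have eUle : cut mu U U <= cut mu (A :|: W) (A :|: W) + 2 * cut mu A B + cut mu (W :|: B) (W :|: B).
  rewrite {1 2}EU cut_self_setU // (cut_self_setU dAW) (cut_setUr _ _ dWB); clear; lia.
(* A vertex y of the side Y has degree above c, and fewer than q of its edges cross the cut. If Y
   and W had fewer than 2t + 2 vertices together, the remaining edges could not make up for the
   difference. *)
have big Y Z : Y != set0 -> [disjoint Y & W] -> U = Y :|: (W :|: Z) -> cut mu Y Z < q ->
    [disjoint W & Z] -> [disjoint Y & Z] -> 2 * t + 2 <= #|Y :|: W|.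
  move=> /set0Pn[y yY] dY EY ltY dWZ dYZ; rewrite leqNgt; apply/negP=> small.
  have yU : y \in U by rewrite EY inE yY.
  have := degU y yU; rewrite EY setUA cut_setUr; last first.
    by rewrite -setI_eq0 setIUl setU_eq0 !setI_eq0 dYZ dWZ.
  have : cut mu [set y] Z < q by apply: leq_ltn_trans ltY; rewrite cutS ?sub1set.
  have := cut1_le y (Y :|: W).
  have := leq_mul (ltnW small) (leqnn M); move: c_ge; clear; nia.
have n1 := big A B A0 dAW EU lt dWB dAB.
have EU' : U = B :|: (W :|: A) by rewrite {1}EU setUC (setUC W B) -setUA.
have n2 : 2 * t + 2 <= #|B :|: W|.
  by apply: (big B A) => //; rewrite 1?cutC 1?disjoint_sym.
have cAW : #|A :|: W| = #|A| + #|W|.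
  by rewrite cardsU (eqP (_ : A :&: W == set0)) ?setI_eq0 // cards0 subn0.
have cBW : #|W :|: B| = #|W| + #|B|.
  by rewrite cardsU (eqP (_ : W :&: B == set0)) ?setI_eq0 // cards0 subn0.
have A1 : 0 < #|A| by rewrite card_gt0.
have B1 : 0 < #|B| by rewrite card_gt0.
have h1 : cut mu (A :|: W) (A :|: W) + 2 * c * (t + 1) <= 2 * c * #|A :|: W|.
  apply: sub_le => //; last by rewrite cAW cU; move: B1; clear; lia.
  by apply: subset_trans UX; rewrite EU setUA subsetUl.
have h2 : cut mu (W :|: B) (W :|: B) + 2 * c * (t + 1) <= 2 * c * #|W :|: B|.
  apply: sub_le => //; last by rewrite cBW cU; move: A1; clear; lia.
    by apply: subset_trans UX; rewrite EU subsetUr.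
  by rewrite setUC.
(* Adding [h1] and [h2] counts W twice, but |W| <= t, so 2c is left over. It exceeds twice the cut
   between A and B, which is less than 2q. *)
have qc : q <= c by apply: leq_trans c_ge; rewrite leq_addl.
rewrite cAW in h1; rewrite cBW in h2; rewrite cU in eU.
have hW : 2 * c * #|W| <= 2 * c * t by rewrite leq_mul2l cW orbT.
move: eU eUle h1 h2 lt qc hW q_gt0; rewrite -/B; clear; rewrite !mulnDr; lia.
Qed.
End DenseCore.

(** * Joining two hubs *)

Section Merge.
Variables (V : finType) (m : V -> V -> nat) (q t : nat).
Hypothesis msym : forall x y, m x y = m y x.
Hypothesis q0 : 0 < q.
Hypothesis t0 : 0 < t.
Hypothesis tq : t <= q.
Hypothesis nohub : ~ has_hub m t q.
Variable kappa : V -> nat.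
Implicit Types (H W C S X Y P : {set V}) (x y u v w : V).

(** In the application [kappa] puts the credit of each thick component on its root, so [phi] adds up
    the credits of the components contained in P. *)
Definition phi P := \sum_(x in P) kappa x.

Lemma phiU P P' : [disjoint P & P'] -> phi (P :|: P') = phi P + phi P'.
Proof. by move=> d; rewrite /phi -bigU //; apply: eq_bigl => x; rewrite inE. Qed.

Lemma hub_join H W H' W' : hub m q H W -> hub m q H' W' ->
  [disjoint H :|: W & H' :|: W'] -> q <= cut m H H' ->
  hub m q (H :|: H') (W :|: W').
Proof.
case/hubP=> H0 cH d wq /hubP[H'0 cH' d' wq'] D le; apply/hubP; split.
- by apply: contraNneq H0 => /eqP; rewrite setU_eq0 => /andP[].
- exact: qconnU.
- apply/pred0P=> x /=; rewrite !inE; apply/negP=> /andP[h1 h2].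
  have := disjointFr D (x := x); rewrite !inE.
  case/orP: h1 => [xH|xH'].
    rewrite xH => /(_ isT); case/orP: h2 => [xW|->]; last by rewrite orbT.
    by rewrite (disjointFr d xH) in xW.
  case/orP: h2 => [->|xW]; first by rewrite orbT xH' => /(_ isT).
  by rewrite (disjointFr d' xH') in xW.
- move=> w; rewrite inE => /orP[/wq|/wq'] le2; apply: (leq_trans le2).
    by rewrite cutS ?subsetUl.
  by rewrite cutS ?subsetUr.
Qed.

Lemma hub_shift H W w : hub m q H W -> w \in W -> hub m q (w |: H) (W :\ w).
Proof.
case/hubP=> H0 cH d wq wW; apply/hubP; split.
- by apply/set0Pn; exists w; rewrite !inE eqxx.
- by apply: qconnU1 => //; apply: wq.
- apply/pred0P=> x /=; rewrite !inE; apply/negP=> /andP[/predU1P[->|xH] /andP[xw xW]].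
    by rewrite eqxx in xw.
  by rewrite (disjointFr d xH) in xW.
- move=> v; rewrite !inE => /andP[_ /wq le]; apply: (leq_trans le).
  by rewrite cutS // subsetUr.
Qed.

Lemma hub_add H W x : hub m q H W -> x \notin H -> q <= cut m [set x] H ->
  hub m q H (x |: W).
Proof.
case/hubP=> H0 cH d wq xH le; apply/hubP; split=> //.
  apply/pred0P=> y /=; rewrite !inE; apply/negP=> /andP[yH /predU1P[yx|yW]].
    by rewrite -yx yH in xH.
  by rewrite (disjointFr d yH) in yW.
by move=> w; rewrite !inE => /predU1P[->|/wq].
Qed.

(** A hub inside a set of one or two vertices has at most one free vertex, so such a set of weight 1
    misses the strict inequality in [large]. It is carried along until it meets a large part. *)
Definition small P : Prop :=
  [/\ P != set0, #|P| <= 2, {in P &, forall x y, x != y -> thick m q x y} & phi P <= 1].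

Definition large P : Prop :=
  exists H W, [/\ hub m q H W, P = H :|: W & phi P < #|W|].

Definition good P : Prop := small P \/ large P.

Lemma good_qconn P : good P -> qconn m q P.
Proof.
case=> [[_ _ th _]|[H [W [hHW -> _]]]]; last exact: hub_qconn hHW.
apply/qconnP=> S sS /set0Pn[x xS] SP.
have [y yP yS] : exists2 y, y \in P & y \notin S.
  by apply/subsetPn; apply: contra SP => h; rewrite eqEsubset sS.
have xy : x != y by apply: contraNneq yS => <-.
apply: (leq_trans (th x y (subsetP sS x xS) yP xy)).
by rewrite leq_m_cut // inE yP yS.
Qed.

(** Two hubs with fewer than t free vertices each that cannot be joined have at most q + 2(t - 1)q +
    (t - 1)^2 q = q t^2 edges between their parts. With t + 1 in place of t the bound also exceeds
    the 4(q - 1) edges that two small parts without thick pairs between them can have, even for t =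
    1. *)
Definition Mbound := q * (t + 1) ^ 2.

(** By counting, some x in P' sends q edges to the hub H. If x is all of P', it becomes free;
    otherwise x enters the hub and the second vertex becomes free. Either way one free vertex is
    gained for a weight of at most 1. *)
Lemma small_join P P' : large P -> small P' -> [disjoint P & P'] ->
  {in P & P', forall x y, m x y < q} -> Mbound <= cut m P P' -> large (P :|: P').
Proof.
move=> [H [W [hHW EP lt]]] [P'0 c2 th fP'] D thin le.
have [H0 cH d wq] := hubP _ _ _ _ hHW.
have cW := hub_lt tq nohub hHW.
have [x xP' xH] : exists2 x, x \in P' & q <= cut m [set x] H.
  apply/exists_inP; apply: contraLR le; rewrite negb_exists_in => /forall_inP no.
  rewrite -ltnNge cutC // EP cut_setUr //.
  have h1 : cut m P' H <= #|P'| * q.-1.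
    by apply: cut_leq_card => x xP'; have := no x xP'; rewrite -ltnNge; case: (q) q0.
  have h2 : cut m P' W <= #|P'| * (#|W| * q).
    apply: cut_leq_card => x xP'; rewrite cut1l -sum_nat_const; apply: leq_sum => w wW.
    by rewrite msym ltnW // thin // EP inE wW orbT.
  have h3 : #|P'| * (#|W| * q) <= 2 * (t.-1 * q).
    by apply: leq_mul => //; apply: leq_mul => //; case: (t) cW.
  have h4 : #|P'| * q.-1 <= 2 * q.-1 by rewrite leq_mul2r c2 orbT.
  rewrite /Mbound; case: (q) q0 h1 h2 h3 h4 => // q' _; case: (t) t0 => // t' _ /=.
  by clear; nia.
have xN : x \notin H by apply/negP=> xH'; have := disjointFl D xP'; rewrite EP inE xH'.
have DHW : [disjoint H :|: W & P'] by rewrite -EP.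
have [P'1|/subsetPn[y yP']] := boolP (P' \subset [set x]).
  have E : P' = [set x] by apply/eqP; rewrite eqEsubset P'1 sub1set.
  exists H, (x |: W); split; first exact: hub_add.
    by rewrite EP E -setUA (setUC W).
  have xW : x \notin W by apply/negP=> xW; have := disjointFl DHW xP'; rewrite inE xW orbT.
  by rewrite phiU // cardsU1 xW; move: fP' lt; clear; lia.
rewrite inE => yx.
have E : P' = [set x] :|: [set y].
  apply/eqP; rewrite eq_sym eqEcard cards2 eq_sym yx c2 andbT.
  by apply/subsetP=> z; rewrite !inE => /orP[] /eqP->.
have hxy : hub m q [set x] [set y].
  apply/hubP; split; rewrite ?qconn1 //.
  - by apply/set0Pn; exists x; rewrite inE.
  - by rewrite disjoints_subset sub1set !inE eq_sym.
  - by move=> z; rewrite inE => /eqP->; rewrite cut11; apply: th.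
exists (H :|: [set x]), (W :|: [set y]); split.
- by apply: hub_join => //; rewrite -?E // cutC.
- by rewrite EP E setUACA.
- have yW : y \notin W by apply/negP=> yW; have := disjointFl DHW yP'; rewrite inE yW orbT.
  by rewrite phiU // setUC cardsU1 yW; move: fP' lt; clear; lia.
Qed.

(* Either H and H' are joined directly, or some free vertex w of one side sends
   q edges to the hub of the other side and becomes the connection.  The one
   free vertex lost in this way is what the slack in phi P < #|W| pays for. *)
Lemma large_join P P' : large P -> large P' -> [disjoint P & P'] ->
  {in P & P', forall x y, m x y < q} -> Mbound <= cut m P P' -> large (P :|: P').
Proof.
move=> [H [W [hHW EP lt]]] [H' [W' [hHW' EP' lt']]] D thin le.
have [H0 cH d wq] := hubP _ _ _ _ hHW; have [H'0 cH' d' wq'] := hubP _ _ _ _ hHW'.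
have cW := hub_lt tq nohub hHW; have cW' := hub_lt tq nohub hHW'.
have D2 : [disjoint H :|: W & H' :|: W'] by rewrite -EP -EP'.
have dWW : [disjoint W & W'].
  by apply: disjointW D2; apply: subsetUr.
have D2' : [disjoint H' :|: W' & H :|: W] by rewrite disjoint_sym.
have cU : #|W :|: W'| = #|W| + #|W'|.
  by rewrite cardsU (eqP (_ : W :&: W' == set0)) ?setI_eq0 // cards0 subn0.
have [l1|l1] := leqP q (cut m H H').
  exists (H :|: H'), (W :|: W'); split; first exact: hub_join.
    by rewrite EP EP' setUACA.
  by rewrite phiU // cU; move: lt lt'; clear; lia.
have shift X Y X' Y' w : w \in Y -> q <= cut m [set w] X' -> hub m q X Y -> hub m q X' Y' ->
    [disjoint X :|: Y & X' :|: Y'] -> [disjoint Y & Y'] -> phi P + phi P' + 2 <= #|Y| + #|Y'| ->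
    P :|: P' = (X :|: Y) :|: (X' :|: Y') -> large (P :|: P').
  move=> wY qw hXY hXY' dXY dY phile E.
  exists ((w |: X) :|: X'), (Y :\ w :|: Y'); split.
  - apply: hub_join => //; first exact: hub_shift.
      rewrite (_ : (w |: X) :|: _ = X :|: Y) //.
      by apply/setP=> z; rewrite !inE; case: eqP => [->|]; rewrite ?wY ?orbT.
    by apply: (leq_trans qw); rewrite cutS // subsetUl.
  - rewrite E; apply/setP=> z; rewrite !inE.
    by case: eqP => [->|_]; rewrite ?wY ?orbT //=; do 4 case: (_ \in _).
  - rewrite phiU // (_ : #|_| = #|Y :\ w| + #|Y'|); last first.
      rewrite cardsU (eqP (_ : (Y :\ w) :&: Y' == set0)) ?cards0 ?subn0 //.
      by rewrite setI_eq0; apply: disjointWl dY; rewrite subsetDl.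
    by move: phile; rewrite (cardsD1 w Y) wY; clear; lia.
have ph : phi P + phi P' + 2 <= #|W| + #|W'| by move: lt lt'; clear; lia.
have [/exists_inP[w wW l2]|] := boolP [exists w in W, q <= cut m [set w] H'].
  by apply: (shift H W H' W' w) => //; rewrite -EP -EP'.
rewrite negb_exists_in => /forall_inP no1.
have [/exists_inP[w wW l2]|] := boolP [exists w in W', q <= cut m [set w] H].
  apply: (shift H' W' H W w) => //.
  - by rewrite disjoint_sym.
  - by rewrite (addnC #|W'|).
  - by rewrite -EP -EP' setUC.
rewrite negb_exists_in => /forall_inP no2.
have h1 : cut m W H' <= #|W| * q.-1.
  by apply: cut_leq_card => x xP'; have := no1 x xP'; rewrite -ltnNge; case: (q) q0.
have h2 : cut m W' H <= #|W'| * q.-1.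
  by apply: cut_leq_card => x xP'; have := no2 x xP'; rewrite -ltnNge; case: (q) q0.
have h3 : cut m W W' <= #|W| * (#|W'| * q).
  apply: cut_leq_card => x xW; rewrite cut1l -sum_nat_const; apply: leq_sum => w wW.
  by rewrite ltnW // thin // ?EP ?EP' inE ?xW ?wW orbT.
have h4 : #|W| * q.-1 <= t.-1 * q.-1 by rewrite leq_mul2r; case: (t) cW => // t' /=; rewrite ltnS => ->; rewrite orbT.
have h5 : #|W'| * q.-1 <= t.-1 * q.-1 by rewrite leq_mul2r; case: (t) cW' => // t' /=; rewrite ltnS => ->; rewrite orbT.
have h6 : #|W| * (#|W'| * q) <= t.-1 * (t.-1 * q).
  by apply: leq_mul; [|apply: leq_mul => //]; [case: (t) cW|case: (t) cW'].
have dHW' : [disjoint H' & W'] by [].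
move: le; rewrite EP EP' cut_setUl // !cut_setUr // (cutC msym H W') leqNgt => /negP[].
rewrite /Mbound; case: (q) q0 l1 h1 h2 h3 h4 h5 h6 => // q' _; case: (t) t0 => // t' _ /=.
by clear; nia.
Qed.

Lemma good_join P P' : good P -> good P' -> [disjoint P & P'] ->
  {in P & P', forall x y, m x y < q} -> Mbound <= cut m P P' -> good (P :|: P').
Proof.
move=> [sP|lP] [sP'|lP'] D thin le; last by right; apply: large_join.
- have [_ c2 _ _] := sP; have [_ c2' _ _] := sP'.
  have h1 : cut m P P' <= #|P| * (#|P'| * q.-1).
    apply: cut_leq_card => x xP; rewrite cut1l -sum_nat_const; apply: leq_sum => y yP.
    by have := thin x y xP yP; case: (q) q0.
  have h2 : #|P| * (#|P'| * q.-1) <= 2 * (2 * q.-1).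
    by apply: leq_mul => //; apply: leq_mul.
  have := leq_trans (leq_trans le h1) h2; rewrite leqNgt => /negP[].
  by rewrite /Mbound; case: (q) q0 => // q' _; case: (t) t0 => // t' _ /=; clear; nia.
- right; rewrite setUC; apply: small_join => //; first by rewrite disjoint_sym.
    by move=> x y xP yP; rewrite msym thin.
  by rewrite cutC.
- by right; apply: small_join.
Qed.

End Merge.

(** * Merging all parts of a partition *)

Section Partition.
Variables (V : finType) (m : V -> V -> nat) (q t : nat).
Hypothesis msym : forall x y, m x y = m y x.
Hypothesis q0 : 0 < q.
Hypothesis t0 : 0 < t.
Hypothesis tq : t <= q.
Hypothesis nohub : ~ has_hub m t q.
Variable kappa : V -> nat.
Variable Om : {set V}.
Implicit Types (A B S X Y P : {set V}) (x y u v w i j : V) (f : V -> V).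

(** A partition of [Om] is encoded by a map [f]: singletons A give its parts, larger sets give
    unions of parts. *)
Definition fib f A := [set x in Om | f x \in A].

Lemma fib_disjoint f A B : [disjoint A & B] -> [disjoint fib f A & fib f B].
Proof.
move=> d; apply/pred0P=> x /=; rewrite !inE; apply/negP=> /andP[/andP[_ xA] /andP[_ xB]].
by rewrite (disjointFr d xA) in xB.
Qed.

Lemma fibD f A B : fib f (A :\: B) = fib f A :\: fib f B.
Proof. by apply/setP=> x; rewrite !inE; do !case: (_ \in _). Qed.

Lemma disjointDr A B : [disjoint A & B :\: A].
Proof. by rewrite disjoints_subset; apply/subsetP=> x; rewrite !inE => ->. Qed.

Lemma fib1_neq0 f i : i \in f @: Om -> fib f [set i] != set0.
Proof. by case/imsetP=> x xO ->; apply/set0Pn; exists x; rewrite !inE xO eqxx. Qed.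

Lemma big_fib f A (F : V -> nat) :
  \sum_(x in fib f A) F x = \sum_(i in A) \sum_(x in fib f [set i]) F x.
Proof.
rewrite (partition_big f (mem A)) /=; last by move=> x; rewrite inE => /andP[].
apply: eq_bigr => i iA; apply: eq_bigl => x; rewrite !inE.
by case: eqP => [->|]; rewrite ?iA ?andbT ?andbF.
Qed.

(** The quotient multigraph of the partition; the diagonal is 0 because [dense_core] is about
    loopless multigraphs. *)
Definition fmu f i j := if i == j then 0 else cut m (fib f [set i]) (fib f [set j]).

Lemma fmuC f i j : fmu f i j = fmu f j i.
Proof. by rewrite /fmu eq_sym cutC. Qed.

Lemma cut_fib f A B : [disjoint A & B] -> cut m (fib f A) (fib f B) = cut (fmu f) A B.
Proof.
move=> d; rewrite [LHS]big_fib; apply: eq_bigr => i iA.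
have -> : \sum_(x in fib f [set i]) \sum_(y in fib f B) m x y =
    \sum_(x in fib f [set i]) \sum_(j in B) \sum_(y in fib f [set j]) m x y.
  by apply: eq_bigr => x _; rewrite big_fib.
rewrite exchange_big; apply: eq_bigr => j jB; rewrite /fmu.
by case: eqP => // ij; have := disjointFr d iA; rewrite ij jB.
Qed.

Variable k : nat.
Hypothesis k_cut : forall X, X \subset Om -> X != set0 -> X != Om -> k <= cut m X (Om :\: X).

Let M := Mbound q t.
Let c := (2 * t + 2) * M + q.
Hypothesis k_ge : 2 * c <= k.

(* If no two parts are joined by M edges, then the dense core of the quotient
   minus any t of its parts is a hub for these t parts. *)
Lemma parts_dense f : 1 < #|f @: Om| ->
  {in f @: Om, forall i, qconn m q (fib f [set i])} ->
  exists i j, [/\ i \in f @: Om, j \in f @: Om, i != j & M <= fmu f i j].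
Proof.
move=> I1 qc; set I := f @: Om in I1 qc *.
have [/exists_inP[i iI /exists_inP[j jI /andP[ij le]]]|] :=
  boolP [exists i in I, exists j in I, (i != j) && (M <= fmu f i j)].
  by exists i, j.
rewrite negb_exists_in => /forall_inP no; exfalso.
have fmu_le i j : fmu f i j <= M.
  have [ij|ij] := eqVneq i j; first by rewrite /fmu ij eqxx.
  have fib_out l : l \notin I -> fib f [set l] = set0.
    move=> lI; apply/setP=> x; rewrite !inE; apply/negP=> /andP[xO /eqP xl].
    by case/negP: lI; rewrite -xl; apply: imset_f.
  have [iI|/fib_out iI] := boolP (i \in I); last by rewrite /fmu (negPf ij) iI cut0l.
  have [jI|/fib_out jI] := boolP (j \in I); last by rewrite /fmu (negPf ij) jI cut0r.
  have := no i iI; rewrite negb_exists_in => /forall_inP/(_ j jI).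
  by rewrite ij /= -ltnNge => /ltnW.
have fmu0 i : fmu f i i = 0 by rewrite /fmu eqxx.
have I0 : I != set0 by rewrite -card_gt0 (leq_trans _ I1).
have degI : {in I, forall i, 2 * c <= cut (fmu f) [set i] I}.
  move=> i iI; apply: (leq_trans k_ge).
  have EI : i |: (I :\ i) = I by apply: setD1K.
  have d : [disjoint [set i] & I :\ i] by rewrite disjoints_subset sub1set !inE eqxx.
  rewrite -EI cut_setUr // cut11 fmu0 add0n -cut_fib //.
  have -> : fib f (I :\ i) = Om :\: fib f [set i].
    apply/setP=> x; rewrite !inE; have [xO|] := boolP (x \in Om); last by rewrite andbF.
    by rewrite imset_f // !andbT.
  apply: k_cut; first by apply/subsetP=> x; rewrite inE => /andP[].
    exact: fib1_neq0.
  have [j jI ji] : exists2 j, j \in I & j != i.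
    have : 0 < #|I :\ i| by move: I1; rewrite (cardsD1 i) iI.
    by case/card_gt0P=> j; rewrite !inE => /andP[ji jI]; exists j.
  case/imsetP: jI => y yO jy; apply/eqP=> /setP/(_ y); rewrite !inE yO -jy.
  by rewrite (negPf ji).
have [U [UI nU degU cU]] := dense_core (fmuC f) fmu0 fmu_le (leqnn c) q0 I0 degI.
pose e (i : 'I_t) := enum_val (widen_ord (ltnW nU) i).
have einj : injective e.
  by move=> a b /enum_val_inj/(congr1 val) /= ab; apply/val_inj.
have eU a : e a \in U by apply: enum_valP.
pose W := [set e a | a : 'I_t].
have WU : W \subset U by apply/subsetP=> _ /imsetP[a _ ->].
have cW : #|W| = t by rewrite card_imset // card_ord.
have H0 : U :\: W != set0.
  by rewrite -card_gt0 cardsD (setIidPr WU) cW subn_gt0.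
have qUW : qconn (fmu f) q (U :\: W) by apply: cU; rewrite // cW.
apply: nohub; exists (fib f (U :\: W)), (fun a => fib f [set e a]); split.
- case/set0Pn: H0 => i iUW; have : i \in I by apply: (subsetP UI); case/setDP: iUW.
  by move/fib1_neq0; apply: contraNneq => E; rewrite -subset0 -E;
    apply/subsetP=> x; rewrite !inE => /andP[-> /eqP->]; move: iUW; rewrite inE.
- apply/qconnP=> S sS S0 SX; rewrite leqNgt; apply/negP=> lt.
  (* Each part is q-connected, so a set S with a cut below q is a union of parts, and its cut is a
     cut of the quotient. *)
  have side i : i \in U :\: W -> fib f [set i] \subset S \/ [disjoint fib f [set i] & S].
    move=> iUW; apply: qconn_side (qc i _) _.
      by apply: (subsetP UI); case/setDP: iUW.
    apply: leq_ltn_trans lt; rewrite cutS ?subsetIr // setSD //.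
    apply/subsetP=> x; rewrite !inE => /andP[-> /eqP->].
    by move: iUW; rewrite inE.
  pose A := [set i in U :\: W | fib f [set i] \subset S].
  have memS x : x \in Om -> f x \in U :\: W -> (x \in S) = (f x \in A).
    move=> xO fx; rewrite inE fx /=.
    have xf : x \in fib f [set f x] by rewrite !inE xO eqxx.
    have [sub|dis] := side _ fx; first by rewrite sub (subsetP sub).
    rewrite (disjointFr dis xf); apply/esym/negP=> /subsetP/(_ x xf).
    by rewrite (disjointFr dis xf).
  have AU : A \subset U :\: W by apply/subsetP=> i; rewrite inE => /andP[].
  have ES : S = fib f A.
    apply/setP=> x; rewrite inE; have [xO|xO] := boolP (x \in Om); last first.
      by apply/negP=> /(subsetP sS); rewrite inE (negPf xO).
    have [fx|fx] := boolP (f x \in U :\: W); first exact: memS.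
    rewrite [f x \in A](contraNF _ fx) /=; last by move/(subsetP AU).
    by apply/negP=> /(subsetP sS); rewrite inE (negPf fx) andbF.
  have ED : fib f (U :\: W) :\: S = fib f ((U :\: W) :\: A).
    by rewrite ES -fibD.
  move: lt; rewrite ED ES cut_fib; last first.
    exact: disjointDr.
  rewrite ltnNge => /negP[]; apply: (qconnP _ _ _ qUW) => //.
    apply: contraNneq S0 => A0; rewrite ES A0; apply/eqP/setP=> x; by rewrite !inE andbF.
  by apply: contraNneq SX => E; rewrite ES E.
- move=> a; have eI : e a \in I by apply: (subsetP UI).
  have dW : [disjoint [set e a] & U :\: W].
    by rewrite disjoints_subset sub1set !inE negb_and negbK imset_f.
  split; [exact: qc | exact: fib_disjoint |].
  rewrite cut_fib //; have := degU _ (eU a); rewrite -{1}(setID U W) cut_setUr; last first.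
    by rewrite -setI_eq0; apply/eqP/setP=> x; rewrite !inE; case: (x \in W); rewrite ?andbF.
  have : cut (fmu f) [set e a] (U :&: W) <= t * M.
    rewrite (setIidPr WU) cut1l -cW -sum_nat_const; exact: leq_sum.
  (* Of the more than c edges at the part [e a], at most t * M go to chosen parts; the remaining
     ones, at least q >= t, reach the hub. *)
  move: tq; rewrite /c; clear; nia.
- move=> a b ab; apply: fib_disjoint; rewrite disjoints_subset sub1set !inE.
  by rewrite (inj_eq einj).
Qed.

Lemma partition_good n f : #|f @: Om| <= n -> Om != set0 ->
  {in Om &, forall x y, thick m q x y -> f x = f y} ->
  {in f @: Om, forall i, good m q kappa (fib f [set i])} ->
  good m q kappa Om.
Proof.
elim: n f => [|n IH] f le O0 tf gf.
  by case/set0Pn: O0 => x xO; move: le; rewrite leqn0 cards_eq0 => /eqP/setP/(_ (f x));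
     rewrite imset_f // inE.
have [le1|lt1] := leqP #|f @: Om| 1.
  case/set0Pn: O0 => x xO; have fxI : f x \in f @: Om by apply: imset_f.
  rewrite (_ : Om = fib f [set f x]); first exact: gf.
  apply/setP=> y; rewrite !inE; case yO: (y \in Om) => //=; symmetry.
  by apply/eqP; apply: (card_le1_eqP le1) => //; apply: imset_f.
have [|i [j [iI jI ij le2]]] := @parts_dense f lt1.
  by move=> i /gf /good_qconn; apply.
(* Renaming j to i merges the two parts and lowers the number of names, on which the induction
   runs. *)
pose f' x := if f x == j then i else f x.
have Ef' l : l != j -> fib f' [set l] = if l == i then fib f [set i; j] else fib f [set l].
  move=> lj; case: eqP => [->|li]; apply/setP=> x; rewrite !inE /f'.
    by case: (f x =P j) => [->|]; rewrite ?eqxx ?orbT ?orbF.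
  case: (f x =P j) => [->|] //; rewrite [i == l]eq_sym [j == l]eq_sym (negPf lj).
  by case: eqP.
apply: (IH f') => //.
- have sub : f' @: Om \subset (f @: Om) :\ j.
    apply/subsetP=> _ /imsetP[x xO ->]; rewrite !inE /f'.
    by case: (f x =P j) => [_|/eqP fx]; [rewrite ij iI | rewrite fx imset_f].
  by have := subset_leq_card sub; move: le; rewrite (cardsD1 j (f @: Om)) jI; clear; lia.
- by move=> x y xO yO xy; rewrite /f' (tf x y).
move=> l lI'.
have [lj lI] : l != j /\ l \in f @: Om.
  case/imsetP: lI' => x xO ->; rewrite /f'; case: (f x =P j) => [_|/eqP fx] //.
  by split=> //; apply: imset_f.
rewrite Ef' //; case: eqP => _; last exact: gf.
have -> : fib f [set i; j] = fib f [set i] :|: fib f [set j].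
  by apply/setP=> x; rewrite !inE andb_orr.
apply: (@good_join _ m q t) => //; [exact: gf | exact: gf | | |].
- by apply: fib_disjoint; rewrite disjoints_subset sub1set !inE.
- move=> x y; rewrite !inE => /andP[xO /eqP fx] /andP[yO /eqP fy]; rewrite ltnNge.
  by apply: contra ij => xy; rewrite -fx -fy (tf x y).
- by move: le2; rewrite /fmu (negPf ij).
Qed.

End Partition.

(** * Spanning trees with many leaves *)

Section Growth.
Variables (V : finType) (m : V -> V -> nat) (q : nat).
Hypothesis msym : forall x y, m x y = m y x.
Hypothesis mirr : forall x, m x x = 0.
Hypothesis q0 : 0 < q.
Implicit Types (H S U W X : {set V}) (x y u v w : V).

Local Notation T := (thick m q).

Definition nb x := [set y | T x y].
Definition D3 := [set x | 2 < #|nb x|].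

Lemma thick_irr x : T x x = false.
Proof. by rewrite /thick mirr leqNgt q0. Qed.

Variables (C A1 : {set V}) (z : V) (pc : V -> V).
Hypothesis C_closed : forall x y, x \in C -> T x y -> y \in C.
Hypothesis C_conn : forall S, S \subset C -> S != set0 ->
  (forall x y, x \in S -> T x y -> y \in S) -> S = C.
Hypothesis zC : z \in C.
Hypothesis z2 : 1 < #|nb z|.
Hypothesis zA1 : z \in A1.
Hypothesis D3A1 : D3 \subset A1.
Hypothesis A1C : forall x, x \in C -> x \in A1 -> x \in D3 \/ x = z.
Hypothesis pcT : forall x y, x \in C -> x \notin A1 -> y \notin A1 -> T x y -> pc x = pc y.

Definition bd H := [set w | (w \notin H) && [exists h in H, T h w]].
Definition cl H := H :|: bd H.
Definition fresh H w := nb w :\: cl H.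
Definition dead H := [set w in bd H | fresh H w == set0].
(** [pc] names the thick path through a vertex outside [A1], so this is the number of thick paths
    that U meets. *)
Definition pieces U := #|pc @: (U :\: A1)|.

Lemma bdP H w : reflect (w \notin H /\ exists2 h, h \in H & T h w) (w \in bd H).
Proof.
rewrite inE; apply: (iffP andP) => [[wH /exists_inP[h hH hw]]|[wH [h hH hw]]].
  by split=> //; exists h.
by split=> //; apply/exists_inP; exists h.
Qed.

Lemma cl_nb H h y : h \in H -> T h y -> y \in cl H.
Proof.
move=> hH hy; rewrite inE; case: (boolP (y \in H)) => //= yH.
by apply/bdP; split=> //; exists h.
Qed.

Lemma bd_add H w : w \in bd H -> bd (w |: H) = (bd H :\ w) :|: fresh H w.
Proof.
case/bdP=> wH _; apply/setP=> y; rewrite [RHS]inE in_setD1 in_setD.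
apply/bdP/orP => [[]|[/andP[yw /bdP[yH [h hH hy]]]|/andP[yc]]].
- rewrite in_setU1 negb_or => /andP[yw yH] [h]; rewrite in_setU1 => /predU1P[-> wy|hH hy].
    have [yc|yc] := boolP (y \in cl H); last by right; rewrite inE.
    by left; move: yc; rewrite yw in_setU (negPf yH).
  by left; rewrite yw; apply/bdP; split=> //; exists h.
- by split; [rewrite in_setU1 (negPf yw) | exists h; rewrite // in_setU1 hH orbT].
- rewrite inE => wy; split; last by exists w; rewrite // in_setU1 eqxx.
  have yw : y != w by apply: contraTneq wy => ->; rewrite thick_irr.
  by rewrite in_setU1 (negPf yw) /=; apply: contra yc => yH; rewrite in_setU yH.
Qed.

Lemma cl_add H w : w \in bd H -> cl (w |: H) = cl H :|: fresh H w.
Proof.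
move=> wb; rewrite /cl bd_add // setUA; congr (_ :|: _).
by apply/setP=> y; rewrite !in_setU in_set1 in_setD1; case: eqP => [->|] //=; rewrite wb orbT.
Qed.

Lemma bd_notcl H x y : x \in bd H -> y \in fresh H x -> [/\ y \notin cl H, T x y & y \notin bd H].
Proof.
move=> xb; rewrite in_setD => /andP[yc]; rewrite inE => xy; split=> //.
by apply: contra yc => yb; rewrite in_setU yb orbT.
Qed.

Lemma card_bd_add H w : w \in bd H -> #|bd (w |: H)|.+1 = #|bd H| + #|fresh H w|.
Proof.
move=> wb; rewrite bd_add // cardsU (eqP (_ : _ :&: _ == set0)); last first.
  apply/eqP/setP=> y; rewrite in_setI in_setD1 in_set0; apply/negP=> /andP[/andP[_ yb] /(bd_notcl wb)[_ _]].
  by rewrite yb.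
by rewrite cards0 subn0 (cardsD1 w (bd H)) wb.
Qed.

Lemma dead_add H w : w \in bd H -> fresh H w != set0 -> dead H \subset dead (w |: H).
Proof.
move=> wb fw; apply/subsetP=> v; rewrite in_set => /andP[vb fv].
rewrite in_set; apply/andP; split.
  rewrite bd_add // in_setU in_setD1 vb andbT; apply/orP; left.
  by apply: contraNneq fw => <-.
rewrite -subset0; apply: subset_trans (_ : fresh H v \subset _); last by rewrite subset0.
by apply: setDS; rewrite cl_add // subsetUl.
Qed.

Lemma D3_subset U X : #|D3 :&: (U :|: X)| <= #|D3 :&: U| + #|X|.
Proof.
by rewrite setIUr (leq_trans (leq_card_setU _ _)) // leq_add2l subset_leq_card ?subsetIr.
Qed.

Lemma pieces_subset U X : pieces (U :|: X) <= pieces U + #|X|.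
Proof.
rewrite /pieces setDUl imsetU (leq_trans (leq_card_setU _ _)) // leq_add2l.
by apply: (leq_trans (leq_imset_card _ _)); rewrite subset_leq_card ?subsetDl.
Qed.

(* Potential for growing a subtree H with leaves bd H.  A leaf is dead when it
   has no neighbour left outside; absorbing a vertex of degree at least 3
   either creates leaves or kills one. *)
Definition grown H : Prop :=
  [/\ z \in H, H \subset C, qconn m q H /\ 1 < #|bd H|,
      #|D3 :&: cl H| <= 3 * #|bd H| + #|dead H|
    & pieces (cl H) <= 2 * #|bd H| + #|D3 :&: H|].

Lemma bdC H : H \subset C -> bd H \subset C.
Proof. by move=> /subsetP HC; apply/subsetP=> w /bdP[_ [h /HC hC /(C_closed hC)]]. Qed.

Lemma qconn_add H w : qconn m q H -> w \in bd H -> qconn m q (w |: H).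
Proof.
move=> cH /bdP[_ [h hH hw]]; apply: qconnU1 => //.
rewrite cutC //; apply: (leq_trans hw).
by rewrite leq_m_cut // inE.
Qed.

Lemma grown_step H : grown H -> cl H != C -> exists H', grown H' /\ #|H| < #|H'|.
Proof.
move=> [zH HC [cH b2] hD hp] ncl.
have addC w : w \in bd H -> w |: H \subset C.
  by move=> wb; rewrite subUset sub1set HC (subsetP (bdC HC)).
have card1 G w : w \in bd G -> #|w |: G| = #|G|.+1 by case/bdP=> wG _; rewrite cardsU1 wG.
(* Absorbing a leaf with X >= 2 new neighbours gains X - 1 leaves, while the vertices of [D3]
   reached and the paths met grow by at most X <= 2(X - 1) each. *)
have [/exists_inP[w wb X2]|] := boolP [exists w in bd H, 1 < #|fresh H w|].
  have f0 : fresh H w != set0 by rewrite -card_gt0 ltnW.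
  exists (w |: H); split; last by rewrite card1.
  have c1 := card_bd_add wb; have d1 := subset_leq_card (dead_add wb f0).
  have := D3_subset (cl H) (fresh H w); have := pieces_subset (cl H) (fresh H w).
  rewrite -cl_add // => p1 p2; split; rewrite ?addC //.
  - by rewrite in_setU1 zH orbT.
  - by split; [apply: qconn_add | move: c1 b2 X2; clear; lia].
  - by move: c1 d1 p2 hD X2; clear; lia.
  - have : #|D3 :&: H| <= #|D3 :&: (w |: H)| by rewrite subset_leq_card ?setIS ?subsetUr.
    by move: c1 p1 hp X2; clear; lia.
rewrite negb_exists_in => /forall_inP X1.
have [w wb f0] : exists2 w, w \in bd H & fresh H w != set0.
  apply/exists_inP; apply: contraR ncl; rewrite negb_exists_in => /forall_inP no.
  apply/eqP/C_conn; first by rewrite subUset HC bdC.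
    by apply/set0Pn; exists z; rewrite in_setU zH.
  move=> x y; rewrite in_setU => /orP[xH|xb] xy; first exact: cl_nb xy.
  have := no x xb; rewrite negbK => /eqP/setP/(_ y).
  by rewrite in_set0 in_setD [y \in nb x]inE xy andbT => /negbFE.
have [u fu] : exists u, fresh H w = [set u].
  apply/cards1P; have := X1 w wb; rewrite -leqNgt => le1.
  by rewrite eqn_leq le1 card_gt0.
have uf : u \in fresh H w by rewrite fu inE.
have [ucl wu _] := bd_notcl wb uf.
have c1 := card_bd_add wb; have d1 := dead_add wb f0; have l1 := subset_leq_card d1.
rewrite fu cards1 addn1 in c1; case: c1 => c1.
have cl1 := cl_add wb; rewrite fu in cl1.
have D1 : #|D3 :&: H| <= #|D3 :&: (w |: H)| by rewrite subset_leq_card ?setIS ?subsetUr.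
have wC : w \in C by apply: (subsetP (bdC HC)).
have wH : w \notin H by case/bdP: wb.
have uC : u \in C by apply: C_closed wu.
have uz : u != z by apply: contraNneq ucl => ->; rewrite in_setU zH.
have zH1 : z \in w |: H by rewrite in_setU1 zH orbT.
have ub : u \in bd (w |: H) by rewrite bd_add // fu in_setU in_set1 eqxx orbT.
(* For u outside [D3] the number of leaves does not change, so a newly met path needs another
   payment: either u continues the path of w, or w lies in [D3] and now enters the tree. *)
have [uD|uD] := boolP (u \in D3); last first.
  exists (w |: H); split; last by rewrite card1.
  have uA : u \notin A1 by apply: contra uD => /(A1C uC)[//|uz']; rewrite uz' eqxx in uz.
  split; rewrite ?addC //.
  - by split; [apply: qconn_add | rewrite c1].
  - rewrite cl1 setIUr (_ : D3 :&: [set u] = set0) ?setU0 ?c1; last first.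
      by apply/setP=> x; rewrite in_setI in_set1 in_set0; case: eqP => [->|_]; rewrite ?andbF // (negPf uD).
    by move: hD l1; clear; lia.
  - have [wA|wA] := boolP (w \in A1).
      have wD : w \in D3 by case: (A1C wC wA) => // wz; rewrite wz zH in wH.
      have : #|D3 :&: (w |: H)| = #|D3 :&: H|.+1.
        have -> : D3 :&: (w |: H) = w |: (D3 :&: H).
          by apply/setP=> x; rewrite in_setI !in_setU1 in_setI; case: eqP => [->|] //; rewrite wD.
        by rewrite cardsU1 in_setI (negPf wH) andbF.
      have := pieces_subset (cl H) [set u]; rewrite -cl1 cards1 c1.
      by move: hp; clear; lia.
    have -> : pieces (cl (w |: H)) = pieces (cl H).
      rewrite /pieces cl1 setDUl imsetU; congr #|pred_of_set _|; apply/setUidPl.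
      apply/subsetP=> v /imsetP[x]; rewrite in_setD in_set1 => /andP[_ /eqP->] ->.
      by rewrite -(pcT wC wA uA wu); apply: imset_f; rewrite in_setD wA in_setU wb orbT.
    by rewrite c1; move: hp D1; clear; lia.
have uA : u \in A1 by apply: (subsetP D3A1).
have p1 : pieces (cl (w |: H)) = pieces (cl H).
  rewrite /pieces cl1 setDUl (_ : [set u] :\: A1 = set0) ?setU0 //.
  by apply/eqP; rewrite setD_eq0 sub1set.
have D2 := D3_subset (cl H) [set u]; rewrite -cl1 cards1 in D2.
(* Both w and u are absorbed. Two new vertices behind u mean one more leaf but up to three more
   vertices of [D3], u included; this is the factor 3 in [grown]. *)
have [X2|X2] := leqP 2 #|fresh (w |: H) u|.
  exists (u |: (w |: H)); split; last by rewrite !card1 // ltnW.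
  have f1 : fresh (w |: H) u != set0 by rewrite -card_gt0 ltnW.
  have c2 := card_bd_add ub; have d2 := subset_leq_card (dead_add ub f1).
  have := D3_subset (cl (w |: H)) (fresh (w |: H) u).
  have := pieces_subset (cl (w |: H)) (fresh (w |: H) u).
  rewrite -cl_add // => p2 p3.
  split.
  - by rewrite inE zH1 orbT.
  - by rewrite subUset sub1set uC addC.
  - split; first by apply/qconn_add/ub/qconn_add.
    by move: c1 c2 b2 X2; clear; lia.
  - by move: hD c1 c2 d2 l1 D2 p3 X2; clear; lia.
  - have : #|D3 :&: (w |: H)| <= #|D3 :&: (u |: (w |: H))|.
      by rewrite subset_leq_card ?setIS ?subsetUr.
    by move: hp D1 c1 c2 p1 p2 X2; clear; lia.
exists (w |: H); split; last by rewrite card1.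
(* At most one of the at least three thick neighbours of u is new, so a leaf w2 other than w is
   adjacent to u. The only new neighbour of w2 was u, which is now reached; thus w2 dies and pays
   for u. *)
have [w2 w2b [w2u w2w]] : exists2 w2, w2 \in bd H & T w2 u /\ w2 != w.
  have sub : nb u \subset (nb u :&: bd H) :|: fresh (w |: H) u.
    apply/subsetP=> y yu; rewrite in_setU in_setI in_setD yu andbT /= cl1.
    move: yu; rewrite inE => yu; rewrite in_setU in_set1.
    have -> : (y == u) = false by apply/eqP=> E; rewrite E thick_irr in yu.
    rewrite orbF in_setU; case: (boolP (y \in H)) => yH; last by case: (_ \in _).
    by case/negP: ucl; apply: (cl_nb yH); rewrite thick_sym.
  have := subset_leq_card sub; move: uD; rewrite inE => uD.
  have [h1 _] := leq_card_setU (nb u :&: bd H) (fresh (w |: H) u).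
  move=> h2; have : 1 < #|nb u :&: bd H| by move: h1 h2 uD X2; clear; lia.
  rewrite (cardsD1 w) => h3; have : 0 < #|(nb u :&: bd H) :\ w| by move: h3; case: (w \in _); clear; rewrite /=; lia.
  case/card_gt0P=> w2; rewrite in_setD1 in_setI inE => /and3P[a1 a2 a3].
  by exists w2 => //; rewrite thick_sym.
have fw2 : fresh H w2 = [set u].
  apply/eqP; rewrite eq_sym eqEcard cards1 leqNgt X1 // andbT sub1set in_setD ucl.
  by rewrite inE.
have : dead H \proper dead (w |: H).
  apply/properP; split=> //; exists w2.
    rewrite in_set bd_add // in_setU in_setD1 w2w w2b /= -subset0.
    apply/subsetP=> y; rewrite in_setD cl1 in_setU negb_or -andbA => /and3P[yc yu yw2].
    have : y \in fresh H w2 by rewrite in_setD yc.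
    by rewrite fw2 (negPf yu).
  by rewrite in_set fw2 w2b /=; apply/set0Pn; exists u; rewrite in_set1.
move/proper_card => l2; split; rewrite ?addC //.
- by split; [apply: qconn_add | rewrite c1].
- by rewrite c1; move: hD D2 l2; clear; lia.
- by rewrite c1 p1; move: hp D1; clear; lia.
Qed.

Lemma grown_max n H : grown H -> #|C| - #|H| <= n -> exists H', grown H' /\ cl H' = C.
Proof.
elim: n H => [|n IH] H gH le; have [?|ne] := eqVneq (cl H) C; try by exists H.
  have [H' [gH' lt]] := grown_step gH ne; have [_ HC' _ _ _] := gH'.
  by have := subset_leq_card HC'; move: le lt; clear; lia.
have [H' [gH' lt]] := grown_step gH ne; apply: (IH H' gH').
by have [_ HC' _ _ _] := gH'; have := subset_leq_card HC'; move: le lt; clear; lia.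
Qed.

Lemma many_leaves : exists H W, [/\ hub m q H W, H :|: W = C, 1 < #|W|,
  #|D3 :&: C| <= 4 * #|W| & pieces C <= 6 * #|W|].
Proof.
have bz : bd [set z] = nb z.
  apply/setP=> y; rewrite [RHS]in_set; apply/bdP/idP => [[_ [h /set1P->]] //|zy].
  split; last by exists z; rewrite ?in_set1.
  by rewrite in_set1; apply: contraTneq zy => ->; rewrite thick_irr.
have g0 : grown [set z].
  split; rewrite ?in_set1 ?sub1set ?bz //; first by split=> //; apply: qconn1.
    have := D3_subset [set z] (nb z); rewrite /cl bz => le.
    have : #|D3 :&: [set z]| <= 1 by rewrite -(cards1 z) subset_leq_card ?subsetIr.
    by move: le z2; clear; lia.
  have := pieces_subset [set z] (nb z); rewrite /cl bz => le.
  have : pieces [set z] = 0.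
    by rewrite /pieces (eqP (_ : _ :\: _ == set0)) ?imset0 ?cards0 // setD_eq0 sub1set.
  by move: le z2; clear; lia.
have [H [[zH HC [cH b2] hD hp] EC]] := grown_max g0 (leqnn _).
exists H, (bd H); rewrite EC in hD hp *.
(* Dead leaves are leaves, which turns 3 + 1 into the factor 4. The factor 6 is 2 plus this 4, as
   [grown] bounds the paths by 2 per leaf plus the vertices of [D3] in H. *)
have d : #|dead H| <= #|bd H| by rewrite subset_leq_card //; apply/subsetP=> w; rewrite in_set => /andP[].
have DH : #|D3 :&: H| <= #|D3 :&: C| by rewrite subset_leq_card ?setIS.
split=> //.
- apply/hubP; split=> //; first by apply/set0Pn; exists z.
    by apply/pred0P=> y /=; apply/negP=> /andP[yH /bdP[]]; rewrite yH.
  move=> w /bdP[_ [h hH hw]]; apply: (leq_trans hw); rewrite msym.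
  by rewrite leq_m_cut // in_set1.
- by move: hD d; clear; lia.
- by move: hD hp d DH; clear; lia.
Qed.
End Growth.

(** * Cutting thick paths *)

Section Line.
Variables (V : finType) (T : rel V).
Hypothesis Tsym : symmetric T.
Hypothesis Tirr : irreflexive T.
Variables (p : {set V}) (e y0 : V).
Hypothesis ep : e \in p.
Hypothesis y0p : y0 \notin p.
Hypothesis ey0 : T e y0.
Hypothesis deg2 : {in p, forall x, #|[set y | T x y]| <= 2}.
Hypothesis p_conn : forall S : {set V}, S \subset p -> S != set0 ->
  (forall x y, x \in S -> y \in p -> T x y -> y \in S) -> S = p.

Lemma deg2_nb x y u v : x \in p -> T x u -> T x v -> u != v -> T x y -> y = u \/ y = v.
Proof.
move=> xp xu xv uv xy; have : [set u; v] == [set y | T x y].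
  by rewrite eqEcard cards2 uv deg2 // andbT subUset !sub1set !inE xu xv.
by move/eqP/setP/(_ y); rewrite !inE xy => /orP[]/eqP; [left|right].
Qed.

Definition partial_line (s : seq V) : Prop :=
  [/\ path T e s, uniq (e :: s) & {subset e :: s <= p}].

(** Thick degrees are at most 2, and e already spends one neighbour on [y0] outside p. So e is an
    end of the path, and any other vertex before the last has only its predecessor and its
    successor. The condition on y excludes [y0] at position 0. *)
Lemma partial_nb s i y : partial_line s -> i < size s ->
  T (nth e (e :: s) i) y -> y \in p \/ 0 < i ->
  y = nth e (e :: s) i.+1 \/ (0 < i /\ y = nth e (e :: s) i.-1).
Proof.
move=> [/(pathP e) hp us sp] lti gy yp; pose g := nth e (e :: s).
rewrite -/(g i) in gy; rewrite -/(g i.+1) -/(g i.-1).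
have gp j : j <= size s -> g j \in p by move=> le; apply/sp/mem_nth.
have T1 : T (g i) (g i.+1) by apply: hp.
case: i => [|i] in lti yp gy T1 *.
  have ne : g 1 != y0 by apply: contraNneq y0p => <-; apply: gp.
  have [->|y0y] := deg2_nb (gp 0 isT) T1 ey0 ne gy; first by left.
  by case: yp => //; rewrite y0y (negPf y0p).
have T2 : T (g i.+1) (g i) by rewrite Tsym; apply: hp; apply: ltnW.
have ne : g i.+2 != g i by rewrite nth_uniq //=; [lia | exact: ltnW (ltnW _)].
by have [] := deg2_nb (gp _ (ltnW lti)) T1 T2 ne gy; [left|right].
Qed.

(** When the path cannot be extended, its last vertex has no further neighbour in p, and by
    [partial_nb] neither has any other vertex. The path is then closed in p, hence all of p. *)
Lemma line_cover : exists s, partial_line s /\ e :: s =i p.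
Proof.
suff H n s : partial_line s -> #|p| - size s <= n -> exists s, partial_line s /\ e :: s =i p.
  by apply: (H _ [::] _ (leqnn _)); split=> // x; rewrite inE => /eqP->.
elim: n s => [|n IH] s pl le; have [pt us sp] := pl.
  have : #|[set x in e :: s]| <= #|p| by rewrite subset_leq_card //; apply/subsetP=> x; rewrite inE => /sp.
  by rewrite cardsE (card_uniqP us) /=; move: le; clear; lia.
have [/exists_inP[y yp /andP[ly yn]]|] := boolP [exists y in p, T (last e s) y && (y \notin e :: s)].
  apply: (IH (rcons s y)); last by rewrite size_rcons; move: le; clear; lia.
  split; first by rewrite rcons_path pt.
    by rewrite -rcons_cons rcons_uniq yn.
  by move=> x; rewrite -rcons_cons mem_rcons inE => /predU1P[->|/sp].
rewrite negb_exists_in => /forall_inP no; exists s; split=> //.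
suff E : [set x in e :: s] = p by move=> x; rewrite -E in_set.
apply: p_conn; first by apply/subsetP=> x; rewrite inE => /sp.
  by apply/set0Pn; exists e; rewrite inE mem_head.
move=> x y; rewrite !in_set => xs yp xy; have := index_mem x (e :: s); rewrite xs /= ltnS leq_eqVlt.
set i := (if _ then _ else _); have gx : nth e (e :: s) i = x by apply: nth_index.
case/predU1P=> [il|il].
  have := no y yp; rewrite negb_and negbK.
  by rewrite (last_nth e) -il gx xy.
have := @partial_nb s i y pl il; rewrite gx => /(_ xy (or_introl yp))[->|[i0 ->]]; apply: mem_nth => //.
by apply: ltn_trans (ltnSn _); rewrite prednK // ltnW.
Qed.

Lemma line_order : exists s, [/\ uniq s, s =i p,
  forall i, i.+1 < size s -> T (nth e s i) (nth e s i.+1),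
  {in p &, forall x y, T x y -> index y s = (index x s).+1 \/ index x s = (index y s).+1}
  & forall x y, x \in p -> 0 < index x s -> (index x s).+1 < size s -> T x y -> y \in p].
Proof.
have [s [pl es]] := line_cover; have [pt us sp] := pl; exists (e :: s).
have nb1 x y : x \in p -> (index x (e :: s)).+1 < size (e :: s) -> T x y ->
    y \in p \/ 0 < index x (e :: s) ->
    (y \in p /\ index y (e :: s) = (index x (e :: s)).+1) \/
    (y \in p /\ index x (e :: s) = (index y (e :: s)).+1).
  move=> xp ltx xy h; have xs : x \in e :: s by rewrite es.
  have gx := nth_index e xs.
  have := @partial_nb s (index x (e :: s)) y pl; rewrite gx => /(_ ltx xy h).
  case=> [->|[i0 ->]]; [left|right]; rewrite -es mem_nth ?index_uniq //.
  - by rewrite prednK.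
  - exact: leq_ltn_trans (leq_pred _) (ltnW ltx).
  - exact: leq_ltn_trans (leq_pred _) (ltnW ltx).
split=> //.
- by move=> i lt; move/(pathP e): pt; apply.
- move=> x y xp yp xy.
  have [lx|lx] := ltnP (index x (e :: s)).+1 (size (e :: s)).
    by case: (nb1 x y xp lx xy (or_introl yp)) => -[_ ->]; [left|right].
  have [ly|ly] := ltnP (index y (e :: s)).+1 (size (e :: s)).
    by rewrite Tsym in xy; case: (nb1 y x yp ly xy (or_introl xp)) => -[_ ->]; [right|left].
  have ix : index x (e :: s) < size (e :: s) by rewrite index_mem es.
  have iy : index y (e :: s) < size (e :: s) by rewrite index_mem es.
  have xs : x \in e :: s by rewrite es.
  have ys : y \in e :: s by rewrite es.
  have E : index x (e :: s) = index y (e :: s) by move: lx ly ix iy; clear; rewrite /=; lia.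
  by move: xy; rewrite -(nth_index e xs) -(nth_index e ys) E Tirr.
- by move=> x y xp i0 lt xy; case: (nb1 x y xp lt xy (or_intror i0)) => -[].
Qed.

End Line.

(** * Segments of thick paths and the choice of cut vertices *)

Section Bads.
Variables (V : finType) (m : V -> V -> nat) (q t : nat).
Hypothesis msym : forall x y, m x y = m y x.
Hypothesis q0 : 0 < q.
Hypothesis tq : t <= q.
Hypothesis nohub : ~ has_hub m t q.
Implicit Types (B C S X Y : {set V}) (x y z u v w b : V).

Local Notation T := (thick m q).

Variables (A1 : {set V}) (pc : V -> V) (ix : V -> nat).

Definition sp x y := [&& x \notin A1, y \notin A1 & pc x == pc y].

Hypothesis ix_inj : forall x y, sp x y -> ix x = ix y -> x = y.
Hypothesis ix_next : forall x y, sp x y -> ix y = (ix x).+1 -> T x y.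
Hypothesis ix_gap : forall x y, sp x y -> ix x < ix y -> exists2 z, sp x z & ix z = (ix x).+1.
Hypothesis ix_thick : forall x y, x \notin A1 -> y \notin A1 -> T x y ->
  sp x y /\ (ix y = (ix x).+1 \/ ix x = (ix y).+1).
Hypothesis ix_inner : forall x a b y, sp x a -> sp x b -> ix a < ix x -> ix x < ix b ->
  T x y -> y \notin A1.

Lemma sp_sym x y : sp x y = sp y x.
Proof. by rewrite /sp eq_sym; case: (x \in A1); case: (y \in A1). Qed.

Lemma sp_trans x y z : sp x y -> sp y z -> sp x z.
Proof. by case/and3P=> xA _ /eqP xy /and3P[_ zA /eqP yz]; rewrite /sp xA zA xy yz eqxx. Qed.

Definition contig X : Prop :=
  {in X &, forall x y, sp x y} /\
  {in X &, forall x z y, sp x y -> ix x < ix y -> ix y < ix z -> y \in X}.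

Lemma contig_line X : contig X -> exists s,
  [/\ uniq s, s =i X, sorted T s & sorted (fun x y => ix x < ix y) s].
Proof.
move=> [spX gapX]; pose le := relpre ix leq; pose s := sort le (enum X).
have us : uniq s by rewrite sort_uniq enum_uniq.
have ms : s =i X by move=> x; rewrite mem_sort mem_enum.
have ss : sorted le s by apply: sort_sorted => x y; apply: leq_total.
have st : sorted (fun x y => ix x < ix y) s.
  have [x0 _|no] := pickP (mem X); last first.
    have -> : s = [::] by apply: size0nil; rewrite size_sort -cardE; apply/eq_card0.
    by [].
  apply/(sortedP x0) => i lt; have /(sortedP x0)/(_ i lt) := ss.
  rewrite /le /= leq_eqVlt => /predU1P[E|//].
  have := ix_inj (spX _ _ _ _) E; rewrite -!ms !mem_nth ?(ltnW lt) // => /(_ isT isT) /eqP.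
  by rewrite nth_uniq ?(ltnW lt) // -[X in X == _]addn0 -addn1 eqn_add2l.
exists s; split=> //.
have [x0 _|no] := pickP (mem X); last first.
  have -> : s = [::] by apply: size0nil; rewrite size_sort -cardE; apply/eq_card0.
  by [].
apply/(sortedP x0) => i lt; set a := nth x0 s i; set c := nth x0 s i.+1.
have aX : a \in X by rewrite -ms mem_nth // ltnW.
have cX : c \in X by rewrite -ms mem_nth.
have ac : ix a < ix c by have /(sortedP x0)/(_ i lt) := st.
have [z az zE] := ix_gap (spX _ _ aX cX) ac.
have [zc|zc] := eqVneq (ix z) (ix c).
  have <- : z = c by apply: ix_inj zc; apply: sp_trans (spX _ _ aX cX); rewrite sp_sym.
  exact: ix_next.
have zlt : ix z < ix c by rewrite ltn_neqAle zc zE.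
have alt : ix a < ix z by rewrite zE.
have zs : z \in s by rewrite ms; apply: (gapX a c).
have tr : transitive (fun x y => ix x < ix y) by move=> x y w; apply: ltn_trans.
have sl i1 j1 : i1 < j1 -> j1 < size s -> ix (nth x0 s i1) < ix (nth x0 s j1).
  by move=> ij j1s; apply: (sorted_ltn_nth tr x0 st) => //; rewrite inE // (ltn_trans ij).
have iz : index z s < size s by rewrite index_mem.
have gz : nth x0 s (index z s) = z by apply: nth_index.
exfalso; have [ji|ij|ji] := ltngtP (index z s) i.
- by have := sl _ _ ji (ltnW lt); rewrite gz -/a ltnNge ltnW.
- move: ij; rewrite leq_eqVlt => /predU1P[E|ij].
    by move: zlt; rewrite -gz -E ltnn.
  by have := sl _ _ ij iz; rewrite gz -/c ltnNge ltnW.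
- by move: alt; rewrite -gz ji ltnn.
Qed.

Lemma contig_qconn X : contig X -> qconn m q X.
Proof.
case/contig_line=> s [_ ms ss _]; rewrite (_ : X = [set x in s]); last first.
  by apply/setP=> x; rewrite inE ms.
exact: sorted_qconn.
Qed.

Lemma contig_cut1 v X : contig X -> v \notin X -> {in X, forall u, ~~ T v u} ->
  cut m [set v] X < 3 * t * q.
Proof.
case/contig_line=> s [us ms ss _] vX thin; rewrite (_ : X = [set x in s]); last first.
  by apply/setP=> x; rewrite inE ms.
apply: (line_cut1 msym q0 tq nohub) => //; last by rewrite ms.
by move=> u; rewrite ms => /thin; rewrite -ltnNge.
Qed.

Lemma contig_cut2 X Y : contig X -> contig Y -> [disjoint X & Y] ->
  {in X & Y, forall u v, ~~ T u v} -> cut m X Y <= t * (q + 6 * t * q).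
Proof.
case/contig_line=> s [us ms ss _] /contig_line[s' [us' ms' ss' _]] d thin.
rewrite (_ : X = [set x in s]); last by apply/setP=> x; rewrite inE ms.
rewrite (_ : Y = [set x in s']); last by apply/setP=> x; rewrite inE ms'.
have [->|s'0] := eqVneq s' [::].
  by rewrite set_nil cut0r.
apply/ltnW/(line_cut2 msym q0 tq nohub) => //.
- by move=> u v; rewrite ms ms' => uX vY; have := thin u v uX vY; rewrite -ltnNge.
- by move=> u; rewrite ms ms' => uX; rewrite (disjointFr d uX).
Qed.

Definition rank B x := #|[set b in B | sp b x && (ix b < ix x)]|.
Definition seg B x := [set y | [&& sp x y, y \notin B & rank B y == rank B x]].
(** The inequality in [rank] is strict, so a cut vertex has the rank of the segment that ends at it.
    For w in B this is therefore the whole segment before w; otherwise it is the part before w of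
    its own segment. *)
Definition segl B w := [set y in seg B w | ix y < ix w].
Definition segr B w := [set y in seg B w | ix w < ix y].
Definition aft w := [set y | sp w y & ix w < ix y].

Lemma rank_le B x y : sp x y -> ix x <= ix y -> rank B x <= rank B y.
Proof.
move=> xy le; apply/subset_leq_card/subsetP=> b; rewrite !inE => /and3P[-> bx lt] /=.
by rewrite (sp_trans bx xy) (leq_trans lt le).
Qed.

Lemma rank_lt B x y : x \in B -> sp x y -> ix x < ix y -> rank B x < rank B y.
Proof.
move=> xB xy lt; apply/proper_card/properP; split; last first.
  by exists x; rewrite !inE ?ltnn ?andbF // xB xy lt.
apply/subsetP=> b; rewrite !inE => /and3P[-> bx lt'] /=.
by rewrite (sp_trans bx xy) (ltn_trans lt' lt).
Qed.

Lemma rank_succ B x y : sp x y -> x \notin B -> ix y = (ix x).+1 -> rank B y = rank B x.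
Proof.
move=> xy xB E; apply/eqP; rewrite eqn_leq [X in _ && X]rank_le ?E // andbT.
apply/subset_leq_card/subsetP=> b; rewrite !inE => /and3P[bB by_ lt]; rewrite bB /=.
have bx : sp b x by apply: sp_trans by_ _; rewrite sp_sym.
rewrite bx /=; move: lt; rewrite E ltnS leq_eqVlt => /predU1P[E2|//].
by rewrite (ix_inj bx E2) (negPf xB) in bB.
Qed.

Lemma seg_contig B x : contig (seg B x).
Proof.
split=> [y z|y z ys zs w].
  by rewrite !inE => /and3P[xy _ _] /and3P[xz _ _]; apply: sp_trans xz; rewrite sp_sym.
move: ys zs; rewrite !inE => /and3P[xy yB /eqP ry] /and3P[xz zB /eqP rz] yw lt1 lt2; have wz : sp w z.
  by rewrite sp_sym; apply: sp_trans yw; apply: sp_trans xy; rewrite sp_sym.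
have xw := sp_trans xy yw; rewrite xw /=.
have l1 := rank_le B yw (ltnW lt1); have l2 := rank_le B wz (ltnW lt2).
have E : rank B w = rank B x by apply/eqP; rewrite eqn_leq -{1}rz l2 -ry l1.
rewrite E eqxx andbT; apply/negP=> wB; have := rank_lt wB wz lt2.
by rewrite E rz ltnn.
Qed.

Lemma sub_contig (p : pred V) X : contig X ->
  {in X &, forall x z y, y \in X -> ix x < ix y -> ix y < ix z -> p x -> p z -> p y} ->
  contig [set x in X | p x].
Proof.
move=> [h1 h2] h3; split=> [x y|x z xs zs y].
  by rewrite !inE => /andP[xX _] /andP[yX _]; apply: h1.
move: xs zs; rewrite !inE => /andP[xX px] /andP[zX pz].
by move=> xy l1 l2; have yX := h2 x z xX zX y xy l1 l2; rewrite yX (h3 x z).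
Qed.

Lemma segl_contig B w : contig (segl B w).
Proof.
apply: sub_contig (seg_contig B w) _ => x z _ _ y _ l1 l2 _ lz.
exact: ltn_trans l2 lz.
Qed.

Lemma seg_refl B x : x \notin A1 -> x \notin B -> x \in seg B x.
Proof. by move=> xA xB; rewrite inE /sp xA xB !eqxx. Qed.

Lemma seg_eq B x y : y \in seg B x -> seg B y = seg B x.
Proof.
rewrite inE => /and3P[xy yB /eqP ry]; apply: eq_finset => z; rewrite ry.
congr (_ && _); apply/idP/idP; first exact: sp_trans.
by apply: sp_trans; rewrite sp_sym.
Qed.

Lemma seg_thick B u v : u \notin A1 -> u \notin B -> v \notin A1 -> v \notin B ->
  T u v -> seg B u = seg B v.
Proof.
move=> uA uB vA vB uv; have [suv EE] := ix_thick uA vA uv; apply/esym.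
case: EE => E; apply: seg_eq; rewrite inE suv vB /=; first by rewrite (rank_succ suv).
by rewrite (@rank_succ B v u) // sp_sym.
Qed.

(** An inner vertex of a segment has no thick neighbour in [A1] by [ix_inner], and its neighbours on
    the path stay weakly between x and z, hence in the segment. So only the ends of segments have
    thick neighbours among the deleted vertices. *)
Lemma seg_inner B r x y z a : x \in seg B r -> y \in seg B r -> z \in seg B r ->
  ix x < ix y -> ix y < ix z -> T y a -> a \notin A1 /\ a \notin B.
Proof.
move=> xr yr zr l1 l2 ya; have [spr gap] := seg_contig B r.
have yx := spr y x yr xr; have yz := spr y z yr zr.
have aA := ix_inner yx yz l1 l2 ya; split=> //.
have yA : y \notin A1 by case/and3P: yx.
have nB w : w \in seg B r -> w \notin B by rewrite inE => /and3P[].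
have [sya [E|E]] := ix_thick yA aA ya.
  have [az|az] := eqVneq (ix a) (ix z).
    apply: nB; rewrite (_ : a = z) //; apply: ix_inj az.
    by apply: sp_trans yz; rewrite sp_sym.
  apply/nB/(gap x z) => //; first by apply: sp_trans sya; rewrite sp_sym.
    by rewrite E ltnS ltnW.
  by rewrite ltn_neqAle az E.
have [ax|ax] := eqVneq (ix x) (ix a).
  apply: nB; rewrite (_ : a = x) //; apply: ix_inj (esym ax).
  by apply: sp_trans yx; rewrite sp_sym.
apply/nB/(gap x z) => //; first by apply: sp_trans sya; rewrite sp_sym.
  by rewrite ltn_neqAle ax -ltnS -E.
by apply: ltn_trans l2; rewrite E.
Qed.

(* A vertex w is cut out of its path only if the segment segl w before it sends
   at least hopb edges to the vertices beyond w.  At most t * (3 * t * q) of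
   these end in later cut vertices, so every segment stays attached to a later
   segment, whatever is cut out afterwards. *)
Definition hopb := q + t * (3 * t * q).

Definition stage B w := hopb <= cut m (segl B w) (aft w).

Lemma stage_neq0 B w : stage B w -> segl B w != set0 /\ aft w != set0.
Proof.
rewrite /stage => st; split; apply: contraTneq st => ->; rewrite ?cut0l ?cut0r -ltnNge /hopb; lia.
Qed.

Lemma stage_pred B w : w \in B -> stage B w -> exists2 y, y \in segl B w & T y w.
Proof.
move=> wB /stage_neq0[/set0Pn[y0 y0s] _].
have [y /= ys maxy] := @arg_maxnP _ y0 (mem (segl B w)) ix y0s.
have ys' : y \in segl B w by exact: ys.
exists y => //; move: (ys'); rewrite !inE => /andP[/and3P[wy yB /eqP ry] lt].
have yw : sp y w by rewrite sp_sym.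
have [z yz zE] := ix_gap yw lt.
have [zw|zw] := eqVneq (ix z) (ix w).
  have <- : z = w by apply: ix_inj zw; apply: sp_trans yw; rewrite sp_sym.
  exact: ix_next.
have lzw : ix z < ix w by rewrite ltn_neqAle zw zE.
suff zs : z \in segl B w by have := maxy z zs; rewrite /= zE ltnn.
have wz := sp_trans wy yz; have rz := rank_succ yz yB zE.
rewrite !inE wz rz ry eqxx lzw !andbT /=; apply/negP=> zB.
by have := rank_lt zB (_ : sp z w) lzw; rewrite rz ry ltnn sp_sym => /(_ wz).
Qed.

(** [stage] makes both sides of w non-empty, so w is an inner vertex of its path and [ix_inner]
    applies. *)
Lemma stage_inner B w y : w \in B -> stage B w -> T w y -> sp w y.
Proof.
move=> wB st wy; have [/set0Pn[a] + /set0Pn[b]] := stage_neq0 st.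
rewrite !inE => /andP[/and3P[wa _ _] la] /andP[wb lb].
have yA : y \notin A1 by apply: (ix_inner wa wb la lb wy).
by have /and3P[wA _ _] := wa; have [] := ix_thick wA yA wy.
Qed.

Section StageHub.
Variables (C B : {set V}).
Hypothesis C_closed : forall x y, x \in C -> T x y -> y \in C.
Hypothesis C_conn : forall S, S \subset C -> S != set0 ->
  (forall x y, x \in S -> T x y -> y \in S) -> S = C.
Hypothesis C_sp : forall x y, x \in C -> sp x y -> y \in C.
Hypothesis C0 : C != set0.
Hypothesis B_stage : {in B :&: C, forall w, stage B w}.
Hypothesis B_card : #|B :&: C| <= t.

Lemma stage_mem w : w \in B :&: C -> (w \in B) * (w \in C) * stage B w.
Proof. by move=> wBC; have := B_stage wBC; move: wBC; rewrite inE => /andP[-> ->]. Qed.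

Section Side.
Variable S : {set V}.
Hypothesis SC : S \subset C :\: B.
Hypothesis S_cut : cut m S ((C :\: B) :\: S) < q.

Lemma side_contig X : contig X -> X \subset C :\: B -> X \subset S \/ [disjoint X & S].
Proof.
move=> cX XC; apply: (qconn_side (contig_qconn cX)).
by apply: leq_ltn_trans S_cut; rewrite cutS ?subsetIr ?setSD.
Qed.

Lemma side_thick x y : x \in C :\: B -> y \in C :\: B -> T x y -> (x \in S) = (y \in S).
Proof.
move=> xC yC xy; apply/idP/idP => h; apply: contraLR S_cut => n; rewrite -leqNgt.
  by apply: (leq_trans xy); rewrite leq_m_cut // inE n yC.
by rewrite thick_sym // in xy; apply: (leq_trans xy); rewrite leq_m_cut // inE n xC.
Qed.

Lemma side_mixed X Y : contig X -> X \subset C :\: B -> Y \subset C :\: B ->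
  {in X & Y, forall x y, (x \in S) != (y \in S)} -> cut m X Y < q.
Proof.
move=> cX XC YC hXY; apply: leq_ltn_trans S_cut.
have [XS|XS] := side_contig cX XC.
  have [/set0Pn[x xX]|] := boolP (X != set0); last by rewrite negbK => /eqP->; rewrite cut0l.
  rewrite cutS // subsetD YC /= disjoint_sym disjoints_subset; apply/subsetP=> y yS.
  rewrite inE; apply/negP=> yY; have := hXY x y xX yY; by rewrite (subsetP XS) // yS.
have [/set0Pn[x xX]|] := boolP (X != set0); last by rewrite negbK => /eqP->; rewrite cut0l.
rewrite cutC // cutS //; last by rewrite subsetD XC.
by apply/subsetP=> y yY; have := hXY x y xX yY; rewrite (disjointFr XS xX); case: (y \in S).
Qed.

Definition after x := #|[set z | sp x z & ix x < ix z]|.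

Lemma after_lt x z : sp x z -> ix x < ix z -> after z < after x.
Proof.
move=> xz lt; apply/proper_card/properP; split; last by exists z; rewrite !inE ?ltnn ?andbF // xz lt.
apply/subsetP=> y; rewrite !inE => /andP[zy lt2]; by rewrite (sp_trans xz zy) (ltn_trans lt lt2).
Qed.

(** Induction from the end of the path backwards. The critical case is a cut vertex z right after x:
    the segment before z lies on the side of x and, by induction, all uncut vertices beyond z on the
    side of y. If these sides differ, too few edges jump over z for [stage]. *)
Lemma side_piece x y : x \in C :\: B -> y \notin B -> sp x y -> (x \in S) = (y \in S).
Proof.
have [n] := ubnP (maxn (after x) (after y)); elim: n x y => // n IH x y.
wlog le : x y / ix x <= ix y => [W|].
  case: (leqP (ix x) (ix y)) => [le|/ltnW le] h xC yB xy; first exact: W.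
  symmetry; apply: W => //; rewrite 1?maxnC // 1?sp_sym //; last by move: xC; rewrite inE => /andP[].
  by rewrite inE yB (C_sp _ xy) //; move: xC; rewrite inE => /andP[].
rewrite gtn_max ltnS => /andP[hx _] xC yB xy.
have xCC : x \in C by move: xC; rewrite inE => /andP[].
have xB : x \notin B by move: xC; rewrite inE => /andP[].
have xxs : sp x x by apply: (sp_trans xy); rewrite sp_sym.
move: le; rewrite leq_eqVlt => /predU1P[/(ix_inj xy)->//|lt].
have IHx u v : sp x u -> sp x v -> ix x < ix u -> ix x < ix v -> u \notin B -> v \notin B ->
    (u \in S) = (v \in S).
  move=> xu xv l1 l2 uB vB; apply: IH => //.
  - by rewrite gtn_max !(leq_trans (after_lt _ _) hx).
  - by rewrite inE uB (C_sp xCC xu).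
  - by apply: sp_trans xv; rewrite sp_sym.
have [z xz zE] := ix_gap xy lt.
have lxz : ix x < ix z by rewrite zE.
have [zB|zB] := boolP (z \in B); last first.
  rewrite (@side_thick x z) //; first exact: IHx.
    by rewrite inE zB (C_sp xCC xz).
  exact: ix_next.
have zC : z \in C by apply: C_sp xz.
have zBC : z \in B :&: C by rewrite inE zB.
have stz := B_stage zBC.
apply/eqP; apply: contraLR stz => ne; rewrite /stage -ltnNge.
have zx : sp z x by rewrite sp_sym.
have rx : rank B z = rank B x by apply: rank_succ.
have xseg : x \in segl B z by rewrite !inE zx xB rx eqxx.
have segC : segl B z \subset C :\: B.
  by apply/subsetP=> u; rewrite !inE => /andP[/and3P[zu -> _] _]; rewrite (C_sp zC zu).
have color u v : u \in segl B z -> v \in aft z :\: B -> (u \in S) != (v \in S).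
  move=> us; rewrite !inE => /andP[vB /andP[zv lv]].
  have -> : (v \in S) = (y \in S).
    have lzy : ix x < ix v by apply: leq_trans lv; rewrite zE.
    by apply: IHx => //; apply: sp_trans xz zv.
  suff -> : (u \in S) = (x \in S) by [].
  have [XS|XS] := side_contig (segl_contig B z) segC.
    by rewrite !(subsetP XS).
  by rewrite !(disjointFr XS).
have h1 : cut m (segl B z) (aft z :\: B) < q.
  apply: side_mixed (segl_contig B z) segC _ color.
  by apply/subsetP=> v; rewrite !inE => /and3P[-> zv _]; rewrite (C_sp zC zv).
(* Edges to later cut vertices are not controlled by S. They are few: such a vertex has no thick
   neighbour in the segment, because z lies between them. *)
have h2 : cut m (segl B z) (aft z :&: B) <= t * (3 * t * q).
  rewrite cutC //; apply: (@leq_trans (#|aft z :&: B| * (3 * t * q))).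
    apply: cut_leq_card => b; rewrite !inE => /andP[/andP[zb lb] bB].
    apply/ltnW/contig_cut1; first exact: segl_contig.
      by rewrite !inE bB /= !andbF.
    move=> u; rewrite !inE => /andP[/and3P[zu _ _] lu]; apply/negP=> bu.
    have /and3P[_ bA _] := zb; have /and3P[_ uA _] := zu.
    by have [_ []] := ix_thick bA uA bu; move: lb lu; clear; lia.
  rewrite leq_mul2r; apply/orP; right; apply: leq_trans B_card.
  apply/subset_leq_card/subsetP=> b; rewrite !inE => /andP[/andP[zb _] ->].
  by rewrite (C_sp zC zb).
rewrite -(setID (aft z) B) cut_setUr; last first.
  by rewrite -setI_eq0; apply/eqP/setP=> v; rewrite in_setI in_setI in_setD in_set0; case: (v \in B); rewrite ?andbF.
by move: h1 h2; rewrite /hopb; clear; lia.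
Qed.

(** Add to S all cut vertices whose path meets S. Thick neighbours of a cut vertex lie on its own
    path, and by [side_piece] S never splits a path, so the enlarged set is closed under thick
    adjacency and is all of C. *)
Lemma side_trivial x : x \in C :\: B -> x \notin S -> S = set0.
Proof.
move=> xC xS; apply/eqP; apply: contraT => /set0Pn[s0 s0S].
pose S' := S :|: [set w in B :&: C | [exists y in S, sp w y]].
have s0C := subsetP SC _ s0S.
have SC' u : u \in S -> u \in C /\ u \notin B by move/(subsetP SC); rewrite inE => /andP[].
suff E : S' = C.
  have : x \in S' by rewrite E; move: xC; rewrite inE => /andP[].
  by rewrite inE (negPf xS) /=; move: xC; rewrite !inE => /andP[/negPf->].
apply: C_conn.
- apply/subsetP=> u; rewrite inE => /orP[/SC'[]//|]; rewrite inE => /andP[]; by rewrite inE => /andP[].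
- by apply/set0Pn; exists s0; rewrite inE s0S.
have inS' w : w \in S' -> w \in S \/ [/\ w \in B, w \in C & exists2 y, y \in S & sp w y].
  rewrite in_setU => /orP[|h]; [by left | right].
  by move: h; rewrite in_set in_setI => /andP[/andP[-> ->] /exists_inP[y yS wy]]; split=> //; exists y.
have toS' w y : w \in B -> w \in C -> y \in S -> sp w y -> w \in S'.
  move=> wB wC yS wy; rewrite in_setU in_set in_setI wB wC /=; apply/orP; right.
  by apply/exists_inP; exists y.
move=> u v /inS'[uS|[uB uC [y yS uy]]] uv.
  have [uC uB] := SC' u uS; have vC := C_closed uC uv.
  have [vB|vB] := boolP (v \in B).
    have stv : stage B v by apply: B_stage; rewrite inE vB.
    apply: (toS' v u) => //; apply: (stage_inner vB) => //; by rewrite thick_sym.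
  by rewrite in_setU -(@side_thick u v) ?uS // inE ?vB ?uB.
have vC := C_closed uC uv.
have stu : stage B u by apply: B_stage; rewrite inE uB.
have uvp := stage_inner uB stu uv.
have vy : sp v y by apply: sp_trans uy; rewrite sp_sym.
have [vB|vB] := boolP (v \in B); first exact: (toS' v y).
have [yC yB] := SC' y yS.
by rewrite in_setU (@side_piece v y) ?yS // inE vB.
Qed.
End Side.

Lemma stage_hub : hub m q (C :\: B) (B :&: C).
Proof.
have pred w : w \in B :&: C -> exists2 y, y \in C :\: B & T y w.
  move=> wBC; have [[wB wC] stw] := stage_mem wBC.
  have [y + yw] := stage_pred wB stw; rewrite !inE => /andP[/and3P[wy yB _] _].
  by exists y => //; rewrite inE yB (C_sp wC wy).
apply/hubP; split.
- case/set0Pn: C0 => x xC; have [xB|xB] := boolP (x \in B).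
    by have [|y yCB _] := pred x; [rewrite inE xB | apply/set0Pn; exists y].
  by apply/set0Pn; exists x; rewrite inE xB.
- apply/qconnP=> S SC S0 SX; rewrite leqNgt; apply/negP=> lt.
  have [x xC xS] : exists2 x, x \in C :\: B & x \notin S.
    by apply/subsetPn; apply: contra SX => h; rewrite eqEsubset SC h.
  by rewrite (side_trivial SC lt xC xS) eqxx in S0.
- by rewrite -setI_eq0; apply/eqP/setP=> v; rewrite !inE; case: (v \in B); rewrite ?andbF.
- move=> w /pred[y yC yw]; apply: (leq_trans yw); rewrite msym.
  by rewrite leq_m_cut // inE.
Qed.
End StageHub.

Section ExistsBads.
Variable K : V -> {set V}.
Hypothesis t0 : 0 < t.
Hypothesis K_closed : forall r x y, x \in K r -> T x y -> y \in K r.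
Hypothesis K_conn : forall r S, S \subset K r -> S != set0 ->
  (forall x y, x \in S -> T x y -> y \in S) -> S = K r.
Hypothesis K_sp : forall r x y, x \in K r -> sp x y -> y \in K r.
Hypothesis K0 : forall r, K r != set0.

Definition hop B u := cut m (segl B u) (segr B u).

(** The last clause records that paths are cut from their beginning: nothing uncut before a cut
    vertex is jumped by many edges. Hence the next vertex to cut lies beyond all earlier cuts of its
    path. *)
Definition staged B : bool :=
  [&& [disjoint B & A1], [forall r, #|B :&: K r| < t]
    & [forall w in B, (hopb <= cut m (segl B w) (aft w)) &&
        [forall u, [&& sp w u, u \notin B & ix u < ix w] ==> (hop B u < hopb)]]].

Lemma staged_hub B r : {in B, forall w, stage B w} -> #|B :&: K r| <= t ->
  hub m q (K r :\: B) (B :&: K r).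
Proof.
move=> st cB; apply: stage_hub => //.
- exact: K_closed.
- exact: K_conn.
- exact: K_sp.
- by move=> w; rewrite inE => /andP[/st].
Qed.

Section AddBad.
Variables (B : {set V}) (u : V).
Hypothesis uA : u \notin A1.
Hypothesis uB : u \notin B.
Hypothesis u_last : {in B, forall b, sp b u -> ix b < ix u}.

Lemma rank_add_eq y : (sp u y -> ix y <= ix u) -> rank (u |: B) y = rank B y.
Proof.
move=> h; rewrite /rank; congr #|pred_of_set _|; apply/setP=> b; rewrite !inE.
case: eqP => [->|] //=; rewrite (negPf uB); apply/negP=> /andP[/h].
by rewrite leqNgt => /negPf->.
Qed.

Lemma rank_add_lt y : sp u y -> ix u < ix y -> rank B y < rank (u |: B) y.
Proof.
move=> uy lt; apply/proper_card/properP; split; last first.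
  by exists u; rewrite !inE ?eqxx ?(negPf uB) //= uy lt.
by apply/subsetP=> b; rewrite !inE => /andP[-> ->]; rewrite orbT.
Qed.

Lemma seg_add_sub x : (sp u x -> ix x < ix u) -> seg (u |: B) x \subset seg B x.
Proof.
move=> h; have rx : rank (u |: B) x = rank B x by apply: rank_add_eq => /h/ltnW.
apply/subsetP=> y; rewrite !inE negb_or => /and3P[xy /andP[yu yB] ry].
rewrite xy yB /=; rewrite rx in ry.
have [uy|uy] := boolP (sp u y); last by rewrite -rank_add_eq // (negPf uy).
have [le|lt] := leqP (ix y) (ix u); first by rewrite -rank_add_eq.
have ux : sp u x by apply: sp_trans uy _; rewrite sp_sym.
have := rank_add_lt uy lt; rewrite (eqP ry) ltnNge rank_le //.
by apply: ltnW; apply: ltn_trans (h ux) lt.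
Qed.

Lemma segl_add_sup w : (sp u w -> ix w <= ix u) -> segl B w \subset segl (u |: B) w.
Proof.
move=> h; apply/subsetP=> y; rewrite !inE negb_or => /andP[/and3P[wy yB ry] lt].
rewrite wy yB lt !andbT /=; apply/andP; split.
  apply: contraTneq lt => yu; rewrite yu in wy *; rewrite -leqNgt h //.
  by rewrite sp_sym.
rewrite !rank_add_eq // => uy; apply: ltnW; apply: leq_trans lt _; apply: h.
by apply: sp_trans uy _; rewrite sp_sym.
Qed.

End AddBad.

Lemma exists_bads : exists B, [/\ [disjoint B & A1],
  forall r, hub m q (K r :\: B) (B :&: K r)
  & forall u, u \notin A1 -> u \notin B -> hop B u < hopb].
Proof.
have st0 : staged set0.
  apply/and3P; split.
  - by rewrite -setI_eq0 set0I.
  - by apply/forallP=> r; rewrite set0I cards0.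
  - by apply/forall_inP=> w; rewrite inE.
have [B stB maxB] := @arg_maxnP _ set0 staged (fun B : {set V} => #|B|) st0.
have [dB cB hB] := and3P stB.
have stage_B : {in B, forall w, stage B w}.
  by move=> w wB; have /forall_inP/(_ w wB)/andP[] := hB.
exists B; split=> //.
  by move=> r; apply: staged_hub => //; apply: ltnW; apply: (forallP cB).
pose bad u := [&& u \notin A1, u \notin B & hopb <= hop B u].
suff no x0 : ~~ bad x0.
  by move=> u uA uB; have := no u; rewrite /bad uA uB -ltnNge.
(* The choice of smallest index makes u the first bad vertex of its path, as the last clause of
   [staged] requires. Adding u then contradicts the maximality of B. *)
apply/negP=> bad0; have [u /and3P[uA uB bu] minu] := @arg_minnP _ x0 bad ix bad0.
have hopB w v : w \in B -> sp w v -> v \notin B -> ix v < ix w -> hop B v < hopb.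
  move=> wB wv vB lt; have /forall_inP/(_ w wB)/andP[_ /forallP/(_ v)] := hB.
  by rewrite wv vB lt.
have u_last : {in B, forall b, sp b u -> ix b < ix u}.
  move=> b bB bsu; rewrite ltnNge leq_eqVlt; apply/negP=> /predU1P[E|lt].
    by move: uB; rewrite (_ : u = b) ?bB //; apply: ix_inj E; rewrite sp_sym.
  by have := hopB b u bB bsu uB lt; rewrite ltnNge bu.
have stage' : {in u |: B, forall w, stage (u |: B) w}.
  move=> w; rewrite !inE => /predU1P[->|wB].
    (* The edges counted by [hop] end in [segr B u], which lies in [aft u]; so a large hop gives
       [stage]. *)
    apply: (leq_trans bu); apply: cutS; first exact: segl_add_sup.
    by apply/subsetP=> y; rewrite !inE => /andP[/and3P[-> _ _] ->].
  apply: (leq_trans (stage_B w wB)); apply: cutS => //; apply: segl_add_sup => // uw.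
  by apply/ltnW/u_last; rewrite // sp_sym.
suff : staged (u |: B) by move/maxB; rewrite /= cardsU1 uB add1n ltnn.
apply/and3P; split.
- rewrite -setI_eq0; apply/eqP/setP=> y; rewrite !inE; case: eqP => [->|_] /=.
    by rewrite (negPf uA).
  by have := pred0P dB y; rewrite /= => ->.
- apply/forallP=> r; have [uK|uK] := boolP (u \in K r).
    apply: (hub_lt tq nohub) (staged_hub stage' _).
    rewrite (_ : _ :&: _ = u |: (B :&: K r)); last first.
      by apply/setP=> y; rewrite !inE; case: eqP => [->|].
    by rewrite cardsU1 inE (negPf uB) /= add1n; apply: (forallP cB).
  rewrite (_ : _ :&: _ = B :&: K r); first exact: (forallP cB).
  by apply/setP=> y; rewrite !inE; case: eqP => [->|] //=; rewrite (negPf uK) andbF.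
- apply/forall_inP=> w wB'; apply/andP; split; first exact: stage'.
  apply/forallP=> v.
  apply/implyP=> /and3P[wv]; rewrite !inE negb_or => /andP[vu vB] lt.
  have uv : sp u v -> ix v < ix u.
    move=> uv; move: wB' wv lt; rewrite !inE => /predU1P[-> //|wB] wv lt.
    apply: (ltn_trans lt); apply: u_last => //.
    by apply: sp_trans wv _; rewrite sp_sym.
  have hv : hop B v < hopb.
    move: wB'; rewrite !inE => /predU1P[wu|wB]; last exact: (hopB w).
    rewrite ltnNge; apply/negP=> hv; have := minu v; rewrite /bad vB hv /=.
    have /and3P[_ -> _] := wv; rewrite leqNgt -wu lt; by move/(_ isT).
  apply: leq_ltn_trans hv; rewrite /hop /segl /segr !setIdE.
  by apply: cutS; apply: setSI; apply: seg_add_sub.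
Qed.

End ExistsBads.
End Bads.

(** * The components of the thick graph *)

Section Classes.
Variables (V : finType) (e : rel V).
Hypothesis e_sym : symmetric e.

Definition class x : {set V} := [set y | connect e x y].

Lemma class_refl x : x \in class x.
Proof. by rewrite inE connect0. Qed.

Lemma class_closed r x y : x \in class r -> e x y -> y \in class r.
Proof. by rewrite !inE => rx xy; apply: connect_trans rx (connect1 xy). Qed.

Lemma class_conn r (S : {set V}) : S \subset class r -> S != set0 ->
  (forall x y, x \in S -> e x y -> y \in S) -> S = class r.
Proof.
move=> SC /set0Pn[s sS] cl; apply/eqP; rewrite eqEsubset SC; apply/subsetP=> y.
have cS := sym_connect_sym e_sym.
have := subsetP SC s sS; rewrite !inE => rs ry.
have sy : connect e s y by apply: connect_trans ry; rewrite cS.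
by rewrite -(closed_connect (intro_closed cS (fun u v uv uS => cl u v uS uv)) sy).
Qed.

Lemma class_root x y : (y \in class x) = (root e y == root e x).
Proof. by rewrite inE -(root_connect (sym_connect_sym e_sym)) eq_sym. Qed.

Lemma class_eq x y : y \in class x -> class y = class x.
Proof.
by rewrite class_root => /eqP E; apply/setP=> z; rewrite !class_root E.
Qed.

Lemma root_class x : root e x \in class x.
Proof. by rewrite class_root root_root //; apply: sym_connect_sym. Qed.

End Classes.

(** * Branch vertices and positions along thick paths *)

Section Coordinates.
Variables (V : finType) (m : V -> V -> nat) (q : nat).
Hypothesis msym : forall x y, m x y = m y x.
Hypothesis mirr : forall x, m x x = 0.
Hypothesis q0 : 0 < q.
Implicit Types (S X : {set V}) (x y z u v r : V).

Local Notation T := (thick m q).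
Let Tsym : symmetric T := thick_sym q msym.

Definition tcomp := class T.

(** A vertex with two thick neighbours, where the growth of the tree starts. Being a branch vertex,
    it also breaks up components that are cycles. By [center_nb] the default r only occurs in
    components with at most two vertices. *)
Definition center r := odflt r [pick z in tcomp r | 1 < #|nb m q z|].

Definition branch : {set V} :=
  [set x | [|| #|tcomp x| <= 2, x \in D3 m q | x == center (root T x)]].

Lemma center_tcomp r : center r \in tcomp r.
Proof.
rewrite /center; case: pickP => [z /andP[]//|_] /=; exact: class_refl.
Qed.

Lemma center_branch r : root T r = r -> center r \in branch.
Proof.
move=> rr; rewrite inE; have := center_tcomp r; rewrite class_root // => /eqP->.
by rewrite rr eqxx !orbT.
Qed.

Lemma center_nb r : 2 < #|tcomp r| -> 1 < #|nb m q (center r)|.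
Proof.
move=> c3; rewrite /center; case: pickP => [z /andP[]//|no] /=; exfalso.
have nb1 x : x \in tcomp r -> #|nb m q x| <= 1.
  by move=> xr; rewrite leqNgt; apply/negP=> h; have := no x; rewrite /= xr h.
have rC : r \in tcomp r by apply: class_refl.
have [E|/set0Pn[y]] := eqVneq (nb m q r) set0.
  have : [set r] = tcomp r.
    apply: class_conn => //; rewrite ?sub1set ?rC //.
      by apply/set0Pn; exists r; rewrite inE.
    by move=> x y; rewrite inE => /eqP-> ry; move/setP/(_ y): E; rewrite !inE ry.
  by move=> E2; move: c3; rewrite -E2 cards1.
rewrite inE => ry; have yC : y \in tcomp r by apply: class_closed ry.
have one x u v : x \in tcomp r -> T x u -> T x v -> u = v.
  move=> xC xu xv; apply: (card_le1_eqP (nb1 x xC)); by rewrite inE.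
have : [set r; y] = tcomp r.
  apply: class_conn => //.
  - by apply/subsetP=> x; rewrite !inE => /orP[/eqP->|/eqP->]; rewrite -?/(tcomp r); move: rC yC; rewrite !inE.
  - by apply/set0Pn; exists r; rewrite !inE eqxx.
  move=> u v; rewrite !inE => /orP[/eqP->|/eqP->] uv.
    by rewrite (one r v y) ?eqxx ?orbT.
  by rewrite (one y v r) ?eqxx // Tsym.
by move=> E2; move: c3; rewrite -E2; case: (r =P y) => [->|_]; rewrite ?cards2 ?setUid ?cards1 //; case: (_ != _).
Qed.

(** Thick adjacency outside [branch]; its classes are the thick paths. *)
Definition thin_off x y := [&& T x y, x \notin branch & y \notin branch].

Lemma off_sym : symmetric thin_off.
Proof. by move=> x y; rewrite /thin_off Tsym; case: (x \in _); case: (y \in _); rewrite ?andbF. Qed.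

Definition piece_of := root thin_off.
Local Notation piece := (class thin_off).

Lemma piece_branch x y : x \notin branch -> y \in piece x -> y \notin branch.
Proof.
move=> xb; rewrite inE => /connectP[p]; elim: p x xb => [|z p IH] x xb /=; first by move=> _ ->.
by case/andP=> /and3P[_ _ zb] pz E; apply: IH zb pz E.
Qed.

Lemma piece_tcomp x y : y \in piece x -> y \in tcomp x.
Proof.
rewrite !inE; apply: connect_sub => u v /and3P[uv _ _]; exact: connect1.
Qed.

(** Otherwise the piece would be the whole component and contain its center, a branch vertex. The
    exit edge is what [line_order] starts from, and it rules out cyclic pieces. *)
Lemma piece_exit x : x \notin branch -> exists a b, [/\ a \in piece x, b \notin piece x & T a b].
Proof.
move=> xb; have [/exists_inP[a ap /exists_inP[b bp ab]]|] :=
  boolP [exists a in piece x, exists b in ~: piece x, T a b].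
  by exists a, b; split=> //; move: bp; rewrite in_setC.
rewrite negb_exists_in => /forall_inP no; exfalso.
have E : piece x = tcomp x.
  apply: (class_conn Tsym); first by apply/subsetP=> y /piece_tcomp.
    by apply/set0Pn; exists x; apply: class_refl.
  move=> a b ap ab; have := no a ap; rewrite negb_exists_in => /forall_inP/(_ b).
  by rewrite in_setC ab /=; case: (b \in _) => // /(_ isT).
have : center (root T x) \in piece x.
  rewrite E /tcomp -(class_eq Tsym (root_class Tsym x)); exact: center_tcomp.
move/(piece_branch xb); rewrite center_branch // root_root //; exact: sym_connect_sym.
Qed.

Lemma exists_index : exists ix : V -> nat,
  let sp x y := [&& x \notin branch, y \notin branch & piece_of x == piece_of y] in
  [/\ forall x y, sp x y -> ix x = ix y -> x = y,
      forall x y, sp x y -> ix y = (ix x).+1 -> T x y,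
      forall x y, sp x y -> ix x < ix y -> exists2 z, sp x z & ix z = (ix x).+1,
      forall x y, x \notin branch -> y \notin branch -> T x y ->
        sp x y /\ (ix y = (ix x).+1 \/ ix x = (ix y).+1)
    & forall x a b y, sp x a -> sp x b -> ix a < ix x -> ix x < ix b ->
        T x y -> y \notin branch].
Proof.
pose lined x (s : seq V) := x \notin branch -> [/\ uniq s, s =i piece x,
  forall z i, i.+1 < size s -> T (nth z s i) (nth z s i.+1),
  {in piece x &, forall x y, T x y -> index y s = (index x s).+1 \/ index x s = (index y s).+1}
  & forall u y, u \in piece x -> 0 < index u s -> (index u s).+1 < size s ->
      T u y -> y \in piece x].
have [sq sqP] : exists sq : V -> seq V, forall x, lined x (sq x).
  apply: (@fin_all_exists _ (fun _ => seq V) lined) => x.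
  have [xb|xb] := boolP (x \in branch); first by exists [::]; rewrite /lined xb.
  have [a [b [ap bp ab]]] := piece_exit xb.
  have [|||s [s1 s2 s3 s4 s5]] := @line_order _ T Tsym _ (piece x) a b ap bp ab.
  - by move=> y; apply: thick_irr.
  - move=> y /(piece_branch xb); rewrite inE !negb_or inE -leqNgt => /and3P[_ + _].
    by rewrite /nb.
  - move=> S SC S0 h; apply: (class_conn off_sym) => // u v uS uv.
    have up := subsetP SC u uS; apply: (h u) => //; last by case/and3P: uv.
    exact: class_closed up uv.
  exists s => _; split=> // z i lt.
  by rewrite (set_nth_default a) ?(set_nth_default a z lt) ?(ltnW lt) //; apply: s3.
(* The enumeration is taken at the root of the piece, so that all its vertices are numbered by the
   same list. *)
exists (fun x => index x (sq (piece_of x))) => sp.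
have cS := sym_connect_sym off_sym.
have root_off x : x \notin branch -> piece_of x \notin branch.
  by move=> xb; apply: piece_branch xb _; apply: root_class; apply: off_sym.
have in_sq x : x \notin branch -> x \in sq (piece_of x).
  move=> xb; have [_ -> _ _ _] := sqP _ (root_off x xb).
  by rewrite class_root ?root_root //; apply: off_sym.
have in_piece x y : sp x y -> y \in piece (piece_of x).
  case/and3P=> _ _ /eqP E; rewrite class_root /piece_of; last exact: off_sym.
  by rewrite root_root // -/piece_of E.
have sp_refl x : x \notin branch -> sp x x by move=> xb; rewrite /sp xb eqxx.
split.
- move=> x y /and3P[xb yb /eqP E]; rewrite -E => Ei.
  by rewrite -(nth_index x (in_sq x xb)) Ei nth_index // E in_sq.
- move=> x y /and3P[xb yb /eqP E]; rewrite -E => Ei.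
  have [s1 s2 s3 s4 s5] := sqP _ (root_off x xb).
  have ys : y \in sq (piece_of x) by rewrite E in_sq.
  rewrite -(nth_index x (in_sq x xb)) -(nth_index x ys) Ei; apply: s3.
  by rewrite -Ei index_mem.
- move=> x y xy; have /and3P[xb yb /eqP E] := xy; rewrite -E => lt.
  have [s1 s2 s3 s4 s5] := sqP _ (root_off x xb).
  have ys : y \in sq (piece_of x) by rewrite E in_sq.
  have li : (index x (sq (piece_of x))).+1 < size (sq (piece_of x)).
    by apply: leq_ltn_trans lt _; rewrite index_mem.
  pose z := nth x (sq (piece_of x)) (index x (sq (piece_of x))).+1.
  have zp : z \in piece (piece_of x) by rewrite -s2 mem_nth.
  have Ez : piece_of z = piece_of x.
    by move: zp; rewrite class_root ?root_root //; [move/eqP | apply: off_sym].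
  exists z; last by rewrite Ez index_uniq.
  by rewrite /sp xb Ez eqxx andbT (piece_branch (root_off x xb) zp).
- move=> x y xb yb xy.
  have E : piece_of x = piece_of y.
    by apply/eqP; rewrite /piece_of (root_connect cS) connect1 // /thin_off xy xb.
  have spxy : sp x y by rewrite /sp xb yb E eqxx.
  split=> //; rewrite -E; have [s1 s2 s3 s4 s5] := sqP _ (root_off x xb).
  by apply: s4 => //; apply: in_piece; rewrite ?sp_refl.
- move=> x a b y xa xb l1 l2 xy; have /and3P[xbr _ /eqP Ea] := xa.
  have /and3P[_ bbr /eqP Eb] := xb.
  have [s1 s2 s3 s4 s5] := sqP _ (root_off x xbr).
  apply: (piece_branch (root_off x xbr)); apply: (s5 x) => //.
  - by apply: in_piece; apply: sp_refl.
  - by apply: leq_ltn_trans l1.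
  - rewrite -Eb in l2; apply: leq_ltn_trans l2 _; rewrite index_mem Eb; exact: in_sq.
Qed.

End Coordinates.

Lemma card_bigcup_leq (I T : finType) (P : {pred I}) (F : I -> {set T}) :
  #|\bigcup_(i in P) F i| <= \sum_(i in P) #|F i|.
Proof.
apply: (big_ind2 (fun (A : {set T}) n => #|A| <= n)) => //; first by rewrite cards0.
by move=> A n A' n' h h'; rewrite (leq_trans (leq_card_setU _ _)) // leq_add.
Qed.

(** * Bounds summed over the thick components *)

Section Structure.
Variables (V : finType) (m : V -> V -> nat) (q t k : nat) (Om : {set V}).
Hypothesis msym : forall x y, m x y = m y x.
Hypothesis mirr : forall x, m x x = 0.
Hypothesis q0 : 0 < q.
Hypothesis t0 : 0 < t.
Hypothesis tq : t <= q.
Hypothesis nohub : ~ has_hub m t q.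
Hypothesis m_supp : forall x y, 0 < m x y -> y \in Om.
Hypothesis k_cut : forall X : {set V}, X \subset Om -> X != set0 -> X != Om -> k <= cut m X (Om :\: X).
Hypothesis k_ge : 2 * ((2 * t + 2) * Mbound q t + q) <= k.
Implicit Types (S X B W H : {set V}) (x y z u v r b : V).

Local Notation T := (thick m q).
Local Notation C := (tcomp m q).
Local Notation A1 := (branch m q).
Local Notation pc := (piece_of m q).
Let Tsym : symmetric T := thick_sym q msym.
Let cT := sym_connect_sym Tsym.

Definition lam r := \max_(W : {set V} | (W \subset C r) && hub m q (C r :\: W) W) #|W|.

(* The number of free vertices that the component of r adds to a merged hub. *)
Definition cost r := if #|C r| <= 2 then 1 else lam r - 1.

Definition kappa x := if root T x == x then cost x else 0.

Lemma lam_ge r H W : hub m q H W -> H :|: W = C r -> #|W| <= lam r.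
Proof.
move=> hHW E; have [_ _ d _] := hubP _ _ _ _ hHW.
apply: (@leq_bigmax_cond _ _ (fun W : {set V} => #|W|)); rewrite -E subsetUr /=.
by rewrite setDUl setDv setU0 (setDidPl d).
Qed.

Lemma thick_Om x y : T x y -> y \in Om.
Proof. by move=> xy; apply: (m_supp (x := x)); apply: leq_trans xy. Qed.

Lemma C_Om x : x \in Om -> C x \subset Om.
Proof.
move=> xO; apply/subsetP=> y; rewrite inE => /connectP[p].
elim: p x xO => [|z p IH] x xO /=; first by move=> _ ->.
by case/andP=> /thick_Om zO; apply: IH.
Qed.

Lemma big_leaves r : root T r = r -> 2 < #|C r| -> exists H W,
  [/\ hub m q H W, H :|: W = C r, 1 < #|W|, #|D3 m q :&: C r| <= 4 * #|W|
    & pieces A1 pc (C r) <= 6 * #|W|].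
Proof.
move=> rr c3; apply: (@many_leaves _ _ _ msym mirr q0 (C r) A1 (center m q r) pc).
- exact: class_closed.
- exact: class_conn.
- exact: center_tcomp.
- exact: center_nb.
- exact: center_branch.
- by apply/subsetP=> x xD; rewrite in_set xD orbT.
- move=> x xC; rewrite in_set; have E : root T x = r.
    by move: xC; rewrite class_root // rr => /eqP.
  rewrite /tcomp (class_eq Tsym xC) -/(C r) leqNgt c3 /= E.
  by case/orP=> [|/eqP]; [left|right].
- move=> x y xC xA yA xy; apply/eqP; rewrite /piece_of root_connect; last first.
    exact/sym_connect_sym/off_sym.
  by rewrite connect1 // /thin_off xy xA.
Qed.

Lemma small_thick r x y : #|C r| <= 2 -> x \in C r -> y \in C r -> x != y -> T x y.
Proof.
move=> c2 xC yC xy; apply: contraT => nxy.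
have Er : C r = [set x; y].
  by apply/eqP; rewrite eq_sym eqEcard cards2 xy c2 andbT subUset !sub1set xC yC.
have : [set x] = C r.
  apply: (class_conn Tsym); rewrite ?sub1set //.
    by apply/set0Pn; exists x; rewrite inE.
  move=> u v /set1P-> xv; have := class_closed xC xv; rewrite -/(C r) Er !inE.
  by case/orP=> // /eqP vy; rewrite -vy xv in nxy.
by rewrite Er => /setP/(_ y); rewrite !inE eqxx orbT eq_sym (negPf xy).
Qed.

Lemma phi_C r : root T r = r -> phi kappa (C r) = cost r.
Proof.
move=> rr; rewrite /phi (bigD1 r) ?class_refl //= /kappa rr eqxx big1 ?addn0 //.
move=> x /andP[xC xr]; case: eqP => // E.
by move: xC; rewrite class_root // rr E (negPf xr).
Qed.

Lemma good_C r : root T r = r -> good m q kappa (C r).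
Proof.
move=> rr; have [c2|c3] := leqP #|C r| 2.
  left; split=> //; first by apply/set0Pn; exists r; apply: class_refl.
    by move=> x y; apply: small_thick.
  by rewrite phi_C // /cost c2.
right; have [H [W [hHW E W2 _ _]]] := big_leaves rr c3.
have [W' W'P W'E] : exists2 W' : {set V}, (W' \subset C r) && hub m q (C r :\: W') W' & lam r = #|W'|.
  pose P := [pred W : {set V} | (W \subset C r) && hub m q (C r :\: W) W].
  have [|W' W'P W'E] := @eq_bigmax_cond _ P (fun W : {set V} => #|W|).
    apply/card_gt0P; exists W; have [_ _ d _] := hubP _ _ _ _ hHW.
    by rewrite inE /= -E subsetUr /= setDUl setDv setU0 (setDidPl d).
  by exists W'; [exact: W'P | rewrite -W'E; apply: eq_bigl].
have /andP[W'C hW'] := W'P; exists (C r :\: W'), W'; split=> //.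
  apply/setP=> x; rewrite in_setU in_setD.
  by case: (boolP (x \in W')) => [/(subsetP W'C)->|]; rewrite ?orbT ?orbF.
rewrite phi_C // /cost (ltn_geF c3) -W'E.
by have := lam_ge hHW E; move: W2; clear; lia.
Qed.

Lemma good_Om : Om != set0 -> good m q kappa Om.
Proof.
move=> O0; apply: (@partition_good _ m q t msym q0 t0 tq nohub kappa Om k k_cut k_ge _ (root T) (leqnn _) O0).
  by move=> x y _ _ xy; apply/eqP; rewrite root_connect // connect1.
move=> _ /imsetP[x xO ->]; have rr : root T (root T x) = root T x by apply: root_root.
rewrite (_ : fib _ _ _ = C (root T x)); first exact: good_C.
apply/setP=> y; rewrite in_set in_set1 class_root // rr.
by apply: andb_idl => yx; apply: (subsetP (C_Om xO)); rewrite class_root.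
Qed.

Lemma phi_Om : 2 < #|Om| -> phi kappa Om + 2 <= t.
Proof.
move=> O3; have O0 : Om != set0 by rewrite -card_gt0; apply: ltn_trans O3.
case: (good_Om O0) => [[_ le2 _ _]|[H [W [hHW _ lt]]]].
  by move: O3 le2; clear; lia.
by have := hub_lt tq nohub hHW; move: lt; clear; lia.
Qed.

Lemma card_roots X M : X \subset Om ->
  (forall r, r \in Om -> root T r = r -> #|X :&: C r| <= M * cost r) ->
  #|X| <= M * phi kappa Om.
Proof.
move=> XO hX; rewrite -sum1_card (partition_big (root T) (mem Om)) /=; last first.
  by move=> x xX; apply: (subsetP (C_Om (subsetP XO x xX))); apply: root_class.
rewrite /phi big_distrr /=; apply: leq_sum => r rO; rewrite /kappa.
case: eqP => [rr|rr]; last first.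
  by rewrite big1 // => x /andP[_ /eqP xr]; case: rr; rewrite -xr root_root.
rewrite sum1_card; apply: leq_trans (hX r rO rr).
apply/subset_leq_card/subsetP=> x; rewrite unfold_in /= => /andP[xX /eqP xr].
by rewrite in_setI xX class_root // rr xr eqxx.
Qed.

Section Count.
Variables (ix : V -> nat) (B : {set V}).
Hypothesis dB : [disjoint B & A1].
Hypothesis hubB : forall r, hub m q (C r :\: B) (B :&: C r).

Lemma B_lam r : #|B :&: C r| <= lam r.
Proof.
apply: (lam_ge (hubB r)); apply/setP=> x; rewrite in_setU in_setD in_setI.
by case: (x \in B); rewrite ?orbF.
Qed.

Lemma cost_gt0 r : root T r = r -> 2 < #|C r| -> lam r <= 2 * cost r /\ lam r + 1 <= 3 * cost r.
Proof.
move=> rr c3; have [H [W [hHW E W2 _ _]]] := big_leaves rr c3.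
rewrite /cost (ltn_geF c3); have := lam_ge hHW E; move: W2; clear; lia.
Qed.

Lemma small_branch r x : #|C r| <= 2 -> x \in C r -> x \in A1.
Proof. by move=> c2 xC; rewrite in_set /tcomp (class_eq Tsym xC) -/(C r) c2. Qed.

Lemma card_deleted : #|Om :&: (A1 :|: B)| <= 11 * phi kappa Om.
Proof.
apply: card_roots; first exact: subsetIl.
move=> r rO rr; have [c2|c3] := leqP #|C r| 2.
  apply: (@leq_trans #|C r|); first by rewrite subset_leq_card ?subsetIr.
  by rewrite /cost c2; move: c2; clear; lia.
have [H [W [hHW E _ hD _]]] := big_leaves rr c3; have lW := lam_ge hHW E.
have sub : (Om :&: (A1 :|: B)) :&: C r \subset
    (center m q r |: (D3 m q :&: C r)) :|: (B :&: C r).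
  apply/subsetP=> x; rewrite !in_setI !in_setU => /andP[/andP[_ xAB] xC].
  rewrite in_set1 !in_setI xC !andbT; case/orP: xAB => [|->]; last by rewrite orbT.
  have E2 : root T x = r by move: xC; rewrite class_root // rr => /eqP.
  rewrite in_set /tcomp (class_eq Tsym xC) -/(C r) (ltn_geF c3) E2 /=.
  by case/orP=> ->; rewrite ?orbT.
apply: (leq_trans (subset_leq_card sub)).
have h1 : #|(center m q r |: (D3 m q :&: C r)) :|: (B :&: C r)| <=
    #|center m q r |: (D3 m q :&: C r)| + #|B :&: C r| by apply: leq_card_setU.
have h2 : #|center m q r |: (D3 m q :&: C r)| <= 1 + #|D3 m q :&: C r|.
  by rewrite cardsU1 leq_add2r; case: (_ \in _).
(* The center, at most 4 lam vertices of [D3] and at most lam cut vertices: 5 lam + 1 in all, where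
   4 lam is at most 8 times the cost and lam + 1 at most 3 times. *)
have := B_lam r; have [] := cost_gt0 rr c3; move: h1 h2 hD lW; clear; lia.
Qed.

Definition level p i : {set V} :=
  [set y | [&& y \notin A1, pc y == p, y \notin B & rank A1 pc ix B y == i]].

Definition Bp r p := [set b in B :&: C r | pc b == p].

(** A segment is determined by its component, its path and its rank, and a path with b cut vertices
    has b + 1 ranks. A component thus has at most 6 lam + lam segments, and 7 lam is at most 14
    times its cost. *)
Lemma card_segs :
  #|[set seg A1 pc ix B x | x in Om :\: (A1 :|: B)]| <= 14 * phi kappa Om.
Proof.
have sub : [set seg A1 pc ix B x | x in Om :\: (A1 :|: B)] \subset
    \bigcup_(r in [pred r | (r \in Om) && (root T r == r)])
      \bigcup_(p in pc @: (C r :\: A1)) [set level p i | i : 'I_(#|Bp r p|.+1)].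
  apply/subsetP=> S0 /imsetP[x]; rewrite in_setD in_setU negb_or => /andP[/andP[xA xB] xO] ->.
  have xr : x \in C (root T x) by rewrite class_root // root_root.
  apply/bigcupP; exists (root T x).
    by rewrite inE /= root_root // eqxx andbT (subsetP (C_Om xO)) // root_class.
  apply/bigcupP; exists (pc x); first by apply: imset_f; rewrite in_setD xA.
  have lt : rank A1 pc ix B x < #|Bp (root T x) (pc x)|.+1.
    rewrite ltnS; apply/subset_leq_card/subsetP=> b; rewrite in_set => /and3P[bB /and3P[bA _ bx] _].
    apply/setIdP; split=> //; rewrite in_setI bB /=.
    have : b \in class (thin_off m q) x by rewrite class_root //; apply: off_sym.
    by move/piece_tcomp; rewrite !class_root // root_root.
  apply/imsetP; exists (Ordinal lt) => //; apply: eq_finset => y.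
  by rewrite /sp xA /= (eq_sym (pc x)) -andbA.
apply: (leq_trans (subset_leq_card sub)); apply: (leq_trans (card_bigcup_leq _ _)).
rewrite /phi big_distrr [X in _ <= X](bigID (fun r => root T r == r)) /=.
apply: leq_trans (leq_addr _ _); apply: leq_sum => r /andP[rO /eqP rr].
rewrite /kappa rr eqxx; have [c2|c3] := leqP #|C r| 2.
  rewrite (_ : C r :\: A1 = set0) ?imset0 ?big_set0 ?cards0 //.
  by apply/eqP; rewrite setD_eq0; apply/subsetP=> x; apply: small_branch.
apply: (leq_trans (card_bigcup_leq _ _)).
apply: (@leq_trans (\sum_(p in pc @: (C r :\: A1)) (#|Bp r p| + 1))).
  apply: leq_sum => p _; apply: (leq_trans (leq_imset_card _ _)).
  by rewrite card_ord addn1.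
rewrite big_split /= sum1_card.
have hB : \sum_(p in pc @: (C r :\: A1)) #|Bp r p| <= #|B :&: C r|.
  rewrite -[X in _ <= X]sum1_card.
  rewrite [X in _ <= X](partition_big pc (mem (pc @: (C r :\: A1)))) /=; last first.
    move=> b /setIP[bB bC]; apply: imset_f; rewrite in_setD bC andbT.
    by rewrite (disjointFr dB bB).
  apply: leq_sum => p _; rewrite sum1_card eq_leq //; apply: eq_card => b.
  by rewrite in_set unfold_in.
have [H [W [hHW E _ _ hp]]] := big_leaves rr c3; have lW := lam_ge hHW E.
rewrite /pieces in hp; have := B_lam r; have [] := cost_gt0 rr c3.
by move: hB hp lW; clear; lia.
Qed.

End Count.
End Structure.

(** * The theorem *)

Section Crossing.
Variables (V E : finType) (G : mgraph V E).
Implicit Types (X Y : {set V}).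

Definition crossing X Y : {set E} :=
  \bigcup_(x in X) \bigcup_(y in Y) [set e in edges G | ends G e == [set x; y]].

Lemma crossingP X Y e : reflect
  (exists x y, [/\ x \in X, y \in Y, e \in edges G & ends G e = [set x; y]])
  (e \in crossing X Y).
Proof.
apply: (iffP bigcupP) => [[x xX /bigcupP[y yY]]|[x [y [xX yY eG ee]]]].
  by rewrite inE => /andP[eG /eqP ee]; exists x, y.
by exists x => //; apply/bigcupP; exists y => //; rewrite inE eG ee eqxx.
Qed.

Lemma card_crossing X Y : #|crossing X Y| <= cut (mult G) X Y.
Proof.
apply: (leq_trans (card_bigcup_leq _ _)); apply: leq_sum => x _.
exact: card_bigcup_leq.
Qed.

Lemma edge_connected_cut k X : edge_connected k G -> X \subset verts G ->
  X != set0 -> X != verts G -> k <= cut (mult G) X (verts G :\: X).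
Proof.
move=> kG XG /set0Pn[x xX] XV; apply: leq_trans (card_crossing _ _).
have [y yG yX] : exists2 y, y \in verts G & y \notin X.
  by apply/subsetPn; apply: contra XV => h; rewrite eqEsubset XG h.
rewrite leqNgt; apply/negP=> lt.
have sub : crossing X (verts G :\: X) \subset edges G.
  by apply/subsetP=> e /crossingP[? [? []]].
have := kG _ sub lt x y (subsetP XG x xX) yG.
move/connectP=> [p]; elim: p x xX => [|z p IH] x xX /=; first by move=> _ E1; rewrite E1 xX in yX.
case/andP=> /exists_inP[e]; rewrite inE => /andP[eC eG] /eqP /= ee pz E1.
apply: IH pz E1; apply: contraR eC => zX; apply/crossingP; exists x, z; split=> //.
rewrite inE zX; apply: (subsetP (ends_verts eG)); by rewrite ee !inE eqxx orbT.
Qed.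

End Crossing.

(** * The deleted sets and the remaining components *)

Section Assembly.
Variables (V E : finType) (G : mgraph V E) (t : nat).
Hypothesis t0 : 0 < t.
Hypothesis nohub : ~ has_hub (mult G) t (t ^ 2).
Local Notation m := (mult G).
Local Notation q := (t ^ 2).
Local Notation T := (thick m q).
Local Notation A1 := (branch m q).
Local Notation pc := (piece_of m q).
Local Notation Om := (verts G).
Local Notation spG := (sp A1 pc).

Variables (ix : V -> nat) (B : {set V}).
Hypothesis ix_inj : forall x y, spG x y -> ix x = ix y -> x = y.
Hypothesis ix_next : forall x y, spG x y -> ix y = (ix x).+1 -> T x y.
Hypothesis ix_gap : forall x y, spG x y -> ix x < ix y -> exists2 z, spG x z & ix z = (ix x).+1.
Hypothesis ix_thick : forall x y, x \notin A1 -> y \notin A1 -> T x y ->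
  spG x y /\ (ix y = (ix x).+1 \/ ix x = (ix y).+1).
Hypothesis ix_inner : forall x a b y, spG x a -> spG x b -> ix a < ix x -> ix x < ix b ->
  T x y -> y \notin A1.
Hypothesis hop_lt : forall u, u \notin A1 -> u \notin B -> hop m A1 pc ix B u < hopb q t.
Local Notation segB := (seg A1 pc ix B).

Let q0 : 0 < q. Proof. by rewrite expn_gt0 t0. Qed.
Let tq : t <= q. Proof. by rewrite leq_pmulr. Qed.
Let msym : forall x y, m x y = m y x := multC G.

Definition delV : {set V} := Om :&: (A1 :|: B).
Definition rest : {set V} := Om :\: delV.
Definition segs : {set {set V}} := [set segB x | x in rest].
Definition thin_at a (S : {set V}) : {set V} := [set u in S | ~~ T a u].
Definition delE : {set E} :=
  (\bigcup_(a in delV) \bigcup_(S in segs) crossing G [set a] (thin_at a S)) :|: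
  (\bigcup_(S in segs) \bigcup_(S' in segs | S' != S) crossing G S S').

Lemma restP x : reflect [/\ x \in Om, x \notin A1 & x \notin B] (x \in rest).
Proof.
rewrite /rest /delV; apply: (iffP setDP) => [[xO]|[xO xA xB]].
  by rewrite in_setI in_setU xO negb_or => /andP[].
by split=> //; rewrite in_setI in_setU xO negb_or xA xB.
Qed.

Lemma delV_B a : a \in delV -> a \notin A1 -> a \in B.
Proof. by rewrite in_setI in_setU => /andP[_ /orP[->|]]. Qed.

Lemma seg_memA1 x y : y \in segB x -> [/\ y \notin A1, y \notin B & segB y = segB x].
Proof.
move=> yx; have yx' := yx; rewrite inE in yx'.
by have /and3P[/and3P[_ yA _] yB _] := yx'; split=> //; apply: seg_eq.
Qed.

Lemma rest_seg x : x \in rest -> x \in segB x.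
Proof. by case/restP=> _ xA xB; apply: seg_refl. Qed.

Lemma thin_cut a S : a \in delV -> S \in segs -> cut m [set a] (thin_at a S) <= 3 * t * q.
Proof.
move=> aD /imsetP[r rR ->]; apply/ltnW.
apply: (contig_cut1 msym q0 tq nohub ix_inj ix_next ix_gap).
(* Inner vertices of a segment have no thick neighbour in [delV], so [thin_at] drops at most the
   ends and leaves an interval. *)
- apply: sub_contig; first exact: seg_contig.
  move=> x z xr zr y yr l1 l2 _ _; apply/negP=> ay; rewrite thick_sym // in ay.
  have [aA /negP[]] := seg_inner ix_inj ix_thick ix_inner xr yr zr l1 l2 ay.
  exact: delV_B aD aA.
- rewrite inE; apply/negP=> /andP[/seg_memA1[aA aB _] _].
  by rewrite (delV_B aD aA) in aB.
- by move=> u; rewrite inE => /andP[].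
Qed.

Lemma segs_cut S S' : S \in segs -> S' \in segs -> S' != S ->
  cut m S S' <= t * (q + 6 * t * q).
Proof.
move=> /imsetP[x xR ->] /imsetP[x' xR' ->] ne.
apply: (contig_cut2 msym q0 tq nohub ix_inj ix_next ix_gap).
- exact: seg_contig.
- exact: seg_contig.
- apply/pred0P=> u /=; apply/negP=> /andP[/seg_memA1[_ _ e1] /seg_memA1[_ _ e2]].
  by rewrite -e1 -e2 eqxx in ne.
- move=> u v /seg_memA1[uA uB e1] /seg_memA1[vA vB e2]; apply/negP=> uv.
  by rewrite -e1 -e2 (seg_thick ix_inj ix_thick uA uB vA vB uv) eqxx in ne.
Qed.

Lemma card_delE : #|delE| <=
  #|delV| * (#|segs| * (3 * t * q)) + #|segs| * (#|segs| * (t * (q + 6 * t * q))).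
Proof.
apply: (leq_trans (leq_card_setU _ _)); apply: leq_add.
  apply: (leq_trans (card_bigcup_leq _ _)); rewrite -sum_nat_const.
  apply: leq_sum => a aD; apply: (leq_trans (card_bigcup_leq _ _)).
  rewrite -sum_nat_const; apply: leq_sum => S SS.
  by apply: (leq_trans (card_crossing _ _ _)); apply: thin_cut.
apply: (leq_trans (card_bigcup_leq _ _)); rewrite -sum_nat_const.
apply: leq_sum => S SS; apply: (leq_trans (card_bigcup_leq _ _)).
apply: (@leq_trans (\sum_(S' in segs) t * (q + 6 * t * q))); last by rewrite sum_nat_const.
rewrite [X in _ <= X](bigID (fun S' => S' != S)) /=; apply: leq_trans (leq_addr _ _).
apply: leq_sum => S' /andP[SS' ne].
by apply: (leq_trans (card_crossing _ _ _)); apply: segs_cut.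
Qed.

Lemma delE_edges : delE \subset edges G.
Proof.
rewrite subUset; apply/andP; split.
  by apply/bigcupsP=> a _; apply/bigcupsP=> S _; apply/subsetP=> e /crossingP[? [? []]].
by apply/bigcupsP=> S _; apply/bigcupsP=> S' _; apply/subsetP=> e /crossingP[? [? []]].
Qed.

Local Notation D := (del_verts (del_edges G delE) delV).

Lemma vertsD x : (x \in verts D) = (x \in rest).
Proof. by rewrite /= in_setI in_setC /rest in_setD andbC. Qed.

Lemma adjD x y : adj D x y -> [/\ x \in rest, y \in rest & segB x = segB y].
Proof.
case/exists_inP=> e; rewrite in_set => /andP[/setDP[eG eZ] sub] /eqP /= ee.
have xe : x \in ends G e by rewrite ee !inE eqxx.
have ye : y \in ends G e by rewrite ee !inE eqxx orbT.
have inR z : z \in ends G e -> z \in rest.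
  move=> ze; rewrite in_setD (subsetP (ends_verts eG)) // andbT.
  by have := subsetP sub z ze; rewrite in_setC.
have xR := inR x xe; have yR := inR y ye; split=> //.
apply/eqP; apply: contraR eZ => ne; rewrite in_setU; apply/orP; right.
apply/bigcupP; exists (segB x); first exact: imset_f.
apply/bigcupP; exists (segB y); first by rewrite imset_f // eq_sym.
by apply/crossingP; exists x, y; split=> //; apply: rest_seg.
Qed.

Lemma thick_adjD x y : x \in rest -> y \in rest -> segB x = segB y -> T x y -> adj D x y.
Proof.
move=> xR yR E1 xy; have : 0 < m x y by apply: leq_trans xy.
case/card_gt0P=> e; rewrite inE => /andP[eG /eqP ee]; apply/exists_inP; exists e; last by rewrite /= ee.
have sub : ends G e \subset ~: delV.
  rewrite ee; apply/subsetP=> z; rewrite !in_setU !in_set1 in_setC.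
  by case/orP=> /eqP->; [move: xR | move: yR]; rewrite in_setD => /andP[].
rewrite in_set in_setD eG sub !andbT in_setU negb_or; apply/andP; split.
  apply/bigcupP=> -[a aD /bigcupP[S _ /crossingP[a' [u [+ _ _ e2]]]]].
  rewrite in_set1 => /eqP aa; have aE : a \in ends G e by rewrite e2 aa !inE eqxx.
  by have := subsetP sub a aE; rewrite in_setC aD.
apply/bigcupP=> -[S SS /bigcupP[S' /andP[SS' ne] /crossingP[u [v [uS vS' _ e2]]]]].
case/imsetP: SS uS ne => r _ -> /seg_memA1[_ _ eu].
case/imsetP: SS' vS' => r' _ -> /seg_memA1[_ _ ev]; rewrite -eu -ev.
have seg2 z : z \in [set u; v] -> segB z = segB x.
  by rewrite -e2 ee !inE => /orP[/eqP->|/eqP->].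
by rewrite !seg2 ?eqxx // !inE eqxx ?orbT.
Qed.

(** Consecutive vertices of a segment are joined by thick edges, which are not deleted. Segments are
    defined in the ambient type, so membership in [Om] has to be passed along these edges from one
    end. *)
Lemma seg_rest x y : x \in rest -> y \in segB x -> connect (adj D) x y.
Proof.
move=> xR yx; have adjS : symmetric (adj D).
  by move=> u v; rewrite /adj; apply: eq_existsb => e; rewrite setUC.
have cS := sym_connect_sym adjS.
suff H n u v : u \in segB x -> v \in segB x -> ix u <= ix v -> ix v - ix u <= n ->
    u \in Om \/ v \in Om -> [/\ connect (adj D) u v, u \in rest & v \in rest].
  have xx := rest_seg xR; have [xO _ _] := restP _ xR.
  have [le|/ltnW le] := leqP (ix x) (ix y).
    by have [] := H _ x y xx yx le (leqnn _) (or_introl xO).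
  by have [] := H _ y x yx xx le (leqnn _) (or_intror xO); rewrite cS.
elim: n u v => [|n IH] u v ux vx le len uvO.
  have E1 : ix u = ix v by move: le len; clear; lia.
  have [spx _] := seg_contig A1 pc ix B x; have E2 := ix_inj (spx u v ux vx) E1.
  have [vA vB _] := seg_memA1 vx; have vO : v \in Om by case: uvO; rewrite ?E2.
  by rewrite E2; split=> //; apply/restP.
move: le; rewrite leq_eqVlt => /predU1P[E1|lt].
  by apply: IH; rewrite // E1 ?subnn.
have [spx gap] := seg_contig A1 pc ix B x; have uv := spx u v ux vx.
have [z uz zE] := ix_gap uv lt.
have zx : z \in segB x.
  have [zv|zv] := eqVneq (ix z) (ix v).
    rewrite (_ : z = v) //; apply: ix_inj zv; apply: sp_trans uv; by rewrite sp_sym.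
  by apply: (gap u v); rewrite // ?zE // ltn_neqAle -zE zv zE.
have Tuz := ix_next uz zE; have [uO zO _] := mult_gt0 (leq_trans q0 Tuz).
have [||zv zR vR] := IH z v zx vx _ _ (or_introl zO).
- by rewrite zE.
- by move: len; rewrite zE; clear; lia.
have [uA uB eu] := seg_memA1 ux; have [zA zB ez] := seg_memA1 zx.
have uR : u \in rest by apply/restP.
split=> //; apply: connect_trans zv; apply: connect1; apply: thick_adjD => //.
by rewrite eu ez.
Qed.

Lemma connect_seg x y : x \in rest -> connect (adj D) x y -> y \in segB x /\ y \in rest.
Proof.
move=> xR /connectP[p]; elim: p x xR => [|z p IH] x xR /=; first by move=> _ ->; rewrite rest_seg.
by case/andP=> /adjD[_ zR ->] pz E1; apply: IH.
Qed.

Lemma componentsD : components D = segs.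
Proof.
have cls x : x \in rest -> [set y in verts D | connect (adj D) x y] = segB x.
  move=> xR; apply/setP=> y; rewrite in_set vertsD.
  apply/andP/idP => [[_ /(connect_seg xR)[]]//|yx].
  have c := seg_rest xR yx; split=> //; by have [] := connect_seg xR c.
rewrite /components /equivalence_partition /segs.
apply/setP=> X; apply/imsetP/imsetP => -[x xR ->]; exists x.
- by rewrite -vertsD.
- by rewrite cls // -vertsD.
- by rewrite vertsD.
- by rewrite cls.
Qed.

(** An edge to [delV] that survives comes from a thick pair, and only the ends of a segment have
    thick neighbours there. A hop edge over v_i joins [segl] to [segr] of v_i, and [hop_lt] bounds
    these. *)
Lemma seg_order X : X \in components D ->
  let J := induced D X in
  exists s : seq V, [/\ linear_order J s,
    (forall v a : V, v \in verts J -> a \in delV ->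
       adj (del_edges G delE) v a -> v = head v s \/ v = last v s)
  & hop_width J s <= hopb q t].
Proof.
rewrite componentsD => XS J; have /imsetP[r rR EX] := XS.
have XJ : verts J =i X.
  move=> x; rewrite /= in_setI -[x \in _ :&: _]/(x \in verts D) vertsD.
  apply: andb_idl; rewrite EX => xr; have c := seg_rest rR xr.
  by have [] := connect_seg rR c.
have cX : contig A1 pc ix X by rewrite EX; apply: seg_contig.
have [s [us ms ss st]] := contig_line ix_inj ix_next ix_gap cX.
have tr : transitive (fun x y => ix x < ix y) by move=> x y w; apply: ltn_trans.
have sl x0 i j : i < j -> j < size s -> ix (nth x0 s i) < ix (nth x0 s j).
  by move=> ij js; apply: (sorted_ltn_nth tr x0 st) => //; rewrite inE // (ltn_trans ij).
exists s; split; first by split=> // x; rewrite ms XJ.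
- move=> v a; rewrite XJ => vX aD /exists_inP[e]; rewrite in_setD => /andP[eZ eG] /eqP /= ee.
  have vs : v \in s by rewrite ms.
  have va : T v a.
    apply: contraR eZ => nva; rewrite in_setU; apply/orP; left.
    apply/bigcupP; exists a => //; apply/bigcupP; exists X; first by rewrite -componentsD componentsD.
    apply/crossingP; exists a, v; split=> //; rewrite ?in_set1 //; last by rewrite setUC.
    by rewrite in_set vX thick_sym.
  have s0 : 0 < size s by rewrite -has_predT; apply/hasP; exists v.
  pose i := index v s; have iE : nth v s i = v by apply: nth_index.
  have il : i < size s by rewrite index_mem.
  have [i0|i0] := posnP i; first by left; rewrite -nth0 -i0 iE.
  have [iz|iz] := eqVneq i (size s).-1; first by right; rewrite -nth_last -iz iE.
  have l1 : ix (head v s) < ix v by rewrite -nth0 -{2}iE; apply: sl.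
  have l2 : ix v < ix (last v s).
    rewrite -nth_last -{1}iE; apply: sl; last by rewrite prednK.
    by rewrite ltn_neqAle iz -ltnS prednK.
  have inX z : z \in s -> z \in segB r by rewrite ms EX.
  have hs : head v s \in s by rewrite -nth0 mem_nth.
  have ls : last v s \in s by rewrite -nth_last mem_nth // prednK.
  have [aA /negP[]] := seg_inner ix_inj ix_thick ix_inner (inX _ hs) (inX _ vs) (inX _ ls) l1 l2 va.
  exact: delV_B.
- apply/bigmax_leqP_seq => i; rewrite mem_index_iota => /andP[i2 il] _.
  (* This is v_i, since list positions start at 0. *)
  pose u := nth r s i.-1.
  have il' : i.-1 < size s by apply: leq_ltn_trans (leq_pred _) il.
  have uX : u \in X by rewrite -ms mem_nth.
  have [uA uB eu] : [/\ u \notin A1, u \notin B & segB u = X].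
    by rewrite EX in uX *; apply: seg_memA1.
  apply: ltnW; apply: leq_ltn_trans (hop_lt uA uB).
  apply: leq_trans (card_crossing _ _ _); apply/subset_leq_card/subsetP=> e.
  rewrite in_set => /andP[eJ /existsP[x /existsP[y /and3P[/eqP ee xt yd]]]].
  apply/crossingP; exists x, y; split=> //.
  + apply/setIdP; split; first by rewrite eu -ms (mem_take xt).
    have [j jl <-] := nthP r xt; rewrite size_takel ?(ltnW il') // in jl.
    by rewrite nth_take //; apply: sl.
  + apply/setIdP; split; first by rewrite eu -ms (mem_drop yd).
    have [j jl <-] := nthP r yd; rewrite size_drop in jl.
    rewrite nth_drop; apply: sl; last by move: jl; clear; lia.
    by move: i2; clear; lia.
  + by move: eJ; rewrite /= !in_set => /andP[/andP[/andP[]]].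
Qed.

End Assembly.

(** * Arithmetic of the constants *)

Lemma connectivity_bound t : 0 < t ->
  2 * ((2 * t + 2) * Mbound (t ^ 2) t + t ^ 2) <= 400 * t ^ 5.
Proof.
move=> t0; rewrite /Mbound.
have h1 : (t + 1) ^ 2 <= 4 * t ^ 2.
  by rewrite -[4 * _]/(2 ^ 2 * t ^ 2) -expnMn leq_exp2r //; lia.
have h2 : 2 * t + 2 <= 4 * t by lia.
have h3 : (2 * t + 2) * (t ^ 2 * (t + 1) ^ 2) <= 4 * t * (t ^ 2 * (4 * t ^ 2)).
  by apply: leq_mul => //; apply: leq_mul.
have h4 : 4 * t * (t ^ 2 * (4 * t ^ 2)) = 16 * t ^ 5 by rewrite !expnS expn0; lia.
have h5 : t ^ 2 <= t ^ 5 by rewrite leq_pexp2l.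
(* The left side is at most 2(16 t^5 + t^5) = 34 t^5. *)
by move: h3 h5; rewrite h4; clear; lia.
Qed.

Lemma hop_bound t : 1 < t -> hopb (t ^ 2) t <= 2 * t ^ 6.
Proof.
move=> t1; have h1 : t ^ 2 <= t ^ 4 by rewrite leq_pexp2l // ltnW.
have h2 : 4 * t ^ 4 <= t ^ 6.
  by rewrite (expnD t 2 4) leq_mul2r; apply/orP; right; rewrite -[4]/(2 ^ 2) leq_exp2r.
have h3 : t * (3 * t * t ^ 2) = 3 * t ^ 4 by rewrite !expnS expn0; lia.
by rewrite /hopb h3; move: h1 h2; clear; lia.
Qed.

Lemma deleted_edges_bound t a s : 2 < t -> a <= 4 * t ^ 2 -> s <= 2 * t ^ 2 ->
  a * (s * (3 * t * t ^ 2)) + s * (s * (t * (t ^ 2 + 6 * t * t ^ 2))) <= 6 * t ^ 10.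
Proof.
move=> t3 ha hs.
have h1 : a * (s * (3 * t * t ^ 2)) <= 4 * t ^ 2 * (2 * t ^ 2 * (3 * t * t ^ 2)).
  by apply: leq_mul => //; apply: leq_mul.
have h2 : s * (s * (t * (t ^ 2 + 6 * t * t ^ 2))) <=
    2 * t ^ 2 * (2 * t ^ 2 * (t * (t ^ 2 + 6 * t * t ^ 2))).
  by apply: leq_mul => //; apply: leq_mul.
have e1 : 4 * t ^ 2 * (2 * t ^ 2 * (3 * t * t ^ 2)) = 24 * t ^ 7.
  by rewrite !expnS expn0; lia.
have e2 : 2 * t ^ 2 * (2 * t ^ 2 * (t * (t ^ 2 + 6 * t * t ^ 2))) = 4 * t ^ 7 + 24 * t ^ 8.
  by rewrite !expnS expn0; lia.
have h3 : 3 * t ^ 7 <= t ^ 8 by rewrite (expnD t 1 7) leq_mul2r t3 orbT.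
have h4 : 9 * t ^ 8 <= t ^ 10.
  by rewrite (expnD t 2 8) leq_mul2r; apply/orP; right; rewrite -[9]/(3 ^ 2) leq_exp2r.
by move: h1 h2 h3 h4; rewrite e1 e2; clear; lia.
Qed.

Theorem theorem11 (t : nat) (V E : finType) (G : mgraph V E) :
  1 <= t ->
  edge_connected (400 * t ^ 5) G ->
  ~ strong_immersion (complete t) G ->
  exists (A : {set V}) (Z : {set E}),
    [/\ A \subset verts G /\ Z \subset edges G,
        #|A| <= 4 * t ^ 2 /\ #|Z| <= 6 * t ^ 10,
        #|components (del_verts (del_edges G Z) A)| <= 2 * t ^ 2
      & forall X : {set V},
          X \in components (del_verts (del_edges G Z) A) ->
          let J := induced (del_verts (del_edges G Z) A) X in
          exists s : seq V,
            [/\ linear_order J s,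
                (forall v a : V, v \in verts J -> a \in A ->
                   adj (del_edges G Z) v a -> v = head v s \/ v = last v s)
              & hop_width J s <= 2 * t ^ 6]].
Proof.
move=> t0 kG nimm.
have nohub : ~ has_hub (mult G) t (t ^ 2) by move/(hub_immersion t0).
(* With at most two vertices everything is deleted. From three vertices on, the merged part cannot
   be small, so [phi_Om] applies. *)
have [O2|O3] := leqP #|verts G| 2.
  exists (verts G), set0.
  have C0 : components (del_verts (del_edges G set0) (verts G)) = set0.
    by rewrite /components /= setICr /equivalence_partition imset0.
  split; rewrite ?C0 ?cards0 //; first by rewrite sub0set.
    by split=> //; apply: leq_trans O2 _; have : 0 < t ^ 2; rewrite ?expn_gt0 ?t0 //; lia.
  by move=> X; rewrite inE.
have q0 : 0 < t ^ 2 by rewrite expn_gt0 t0.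
have tq : t <= t ^ 2 by rewrite leq_pmulr.
have msym := multC G; have mirr := multxx G.
have msupp x y : 0 < mult G x y -> y \in verts G by case/mult_gt0.
have kcut (X : {set V}) : X \subset verts G -> X != set0 -> X != verts G ->
    400 * t ^ 5 <= cut (mult G) X (verts G :\: X) by apply: edge_connected_cut.
have kge := connectivity_bound t0.
have [ix [I0 I1 I2 I3 I4]] := exists_index msym mirr q0.
have Tsym := thick_sym (t ^ 2) msym.
have [||||B [dB hubB hopB]] := @exists_bads _ _ _ _ msym q0 tq nohub (branch (mult G) (t ^ 2))
  (piece_of (mult G) (t ^ 2)) ix I0 I1 I2 I3 I4 (tcomp (mult G) (t ^ 2)) t0.
- by move=> r x y; apply: class_closed.
- by move=> r S; apply: class_conn.
- move=> r x y xr /and3P[_ _ xy]; have yx : y \in class (thin_off (mult G) (t ^ 2)) x.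
    by rewrite class_root 1?eq_sym //; apply: off_sym.
  by rewrite /tcomp -(class_eq Tsym xr); apply: piece_tcomp yx.
- by move=> r; apply/set0Pn; exists r; apply: class_refl.
have phi_t := phi_Om msym mirr q0 t0 tq nohub msupp kcut kge O3.
have cA := card_deleted msym mirr q0 msupp hubB.
have cS := @card_segs _ _ _ _ msym mirr q0 msupp ix B dB hubB.
set ph := phi _ _ in phi_t cA cS.
(* The arithmetic needs t >= 3. If the total credit were 0, no vertex would be deleted and no
   segment would exist, but every vertex is deleted or lies in a segment. So the credit is positive,
   and it is at most t - 2. *)
have t3 : 2 < t.
  suff : 0 < ph by move: phi_t; clear; lia.
  rewrite lt0n; apply/eqP=> p0; rewrite p0 muln0 leqn0 cards_eq0 in cA.
  rewrite p0 muln0 leqn0 cards_eq0 imset_eq0 in cS.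
  have [x xG] : exists x, x \in verts G by apply/card_gt0P; apply: ltn_trans O3.
  have xA : x \notin verts G :&: (branch (mult G) (t ^ 2) :|: B) by rewrite (eqP cA) inE.
  rewrite in_setI xG /= in xA.
  by move/eqP/setP/(_ x): cS; rewrite in_setD xA xG inE.
have sS : #|segs G t ix B| <= 2 * t ^ 2.
  rewrite /segs /rest /delV setDIr setDv set0U; apply: leq_trans cS _.
  apply: (@leq_trans (14 * (t - 2))); first by move: phi_t; clear; lia.
  rewrite -{2}(subnK (ltnW t3)) expnS expn1; move: (t - 2) => u; clear.
  by have [h|h] := leqP 3 u; [nia | case: u h => [|[|[]]]].
have sA : #|delV G t B| <= 4 * t ^ 2.
  by apply: leq_trans cA _; move: phi_t t3; clear; rewrite expnS expn1; nia.
have cD := componentsD t0 B I0 I1 I2.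
exists (delV G t B), (delE G t ix B); split.
- by split; [apply: subsetIl | apply: delE_edges].
- split=> //; apply: leq_trans (deleted_edges_bound t3 sA sS).
  exact: (card_delE t0 nohub B I0 I1 I2 I3 I4).
- by rewrite cD.
- move=> X XC J; have [s [s1 s2 s3]] := seg_order t0 I0 I1 I2 I3 I4 hopB XC.
  by exists s; split=> //; apply: leq_trans s3 (hop_bound (ltnW t3)).
Qed.
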